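(* Let $A$ be a Dedekind domain with quotient field $K$. Then the following statements are equivalent: (1) For any finite field extension $L/K$ and any nonzero prime ideal $\mathfrak{p}$ of $A$, one has $\sum_{\mathfrak{P}\mid\mathfrak{p}} e_{\mathfrak{P}} f_{\mathfrak{P}}=[L:K]$, where the sum is over the prime ideals $\mathfrak{P}$ lying over $\mathfrak{p}$ of the integral closure $B$ of $A$ in $L$. (2) For any finite field extension $L/K$ and any nonzero prime ideal $\mathfrak{p}$ of $A$, the tensor product $L\otimes_K K_{\mathfrak{p}}^*$ is a semi-simple $K_{\mathfrak{p}}^*$-algebra. (3) $A$ is a G-ring. (4) For every nonzero prime ideal $\mathfrak{p}$ of $A$, the localization $A_{\mathfrak{p}}$ is Japanese.
   Context: All rings are commutative with identity. For a prime $\mathfrak{P}$ of the Dedekind domain $B$ over $\mathfrak{p}$, $e_{\mathfrak{P}}$ is the ramification index (the exponent of $\mathfrak{P}$ in the factorization of $\mathfrak{p}B$) and $f_{\mathfrak{P}}=[B/\mathfrak{P}:A/\mathfrak{p}]$ is the residue class degree. $K_{\mathfrak{p}}^*$ denotes the completion of $K$ with respect to the $\mathfrak{p}$-adic valuation. An integral domain $R$ with quotient field $F$ is Japanese if for every finite field extension $E/F$ the integral closure of $R$ in $E$ is a finite $R$-module. A Noetherian ring $R$ containing a field $k$ is geometrically regular over $k$ if $R\otimes_k k'$ is regular for every finite field extension $k'/k$. A homomorphism $R\to S$ of Noetherian rings is regular if it is flat and for every $\mathfrak{q}\in\operatorname{Spec} R$ the fiber ring $S\otimes_R k(\mathfrak{q})$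 is geometrically regular over the residue field $k(\mathfrak{q})$. A Noetherian ring $R$ is a G-ring if for every $\mathfrak{q}\in\operatorname{Spec} R$ the natural map from $R_{\mathfrak{q}}$ to its completion $(R_{\mathfrak{q}})^*$ is regular. *)

(* Defs.v *)
From HB Require Import structures.
From mathcomp Require Import all_boot all_algebra all_field ring.
From mathcomp Require Import boolp classical_sets functions fsbigop.

Set Implicit Arguments.
Unset Strict Implicit.
Unset Printing Implicit Defensive.

Import GRing.Theory.
Local Open Scope ring_scope.
Local Open Scope classical_set_scope.
Local Open Scope quotient_scope.

Section Ideals.
Variable R : comPzRingType.
Implicit Types I J P : set R.

Definition is_ideal I :=
  [/\ I 0, forall x y, I x -> I y -> I (x + y) & forall a x, I x -> I (a * x)].

Definition ideal_gen (X : set R) : set R := smallest is_ideal X.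

Definition idealM I J := ideal_gen [set x * y | x in I & y in J].

Definition ideal_prod (s : seq (set R)) : set R := foldr idealM setT s.

Definition idealX I n := iter n (idealM I) setT.

Definition is_prime_ideal P :=
  [/\ is_ideal P, ~ P 1 & forall x y, P (x * y) -> P x \/ P y].

Definition is_maximal_ideal P :=
  [/\ is_ideal P, ~ P 1 & forall J, is_ideal J -> ~ J 1 -> P `<=` J -> J = P].

Definition noetherian :=
  forall I, is_ideal I -> exists n (b : 'I_n -> R), I = ideal_gen (range b).

Record spec := Spec { spec_set :> set R; specP : is_prime_ideal spec_set }.

(* The multiplicity of P in a factorization of I into prime ideals; it is only
   meaningful when such a factorization exists and is unique. *)
Definition ideal_exp I P : nat :=
  xget 0%N [set n | exists s : seq (set R),
    [/\ forall Q, Q \in s -> is_prime_ideal Q, ideal_prod s = I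
      & count_mem P s = n]].

Lemma ideal_gen_ideal X : is_ideal (ideal_gen X).
Proof.
split; first by move=> J [[]].
- by move=> x y Ix Iy J [JI XJ]; case: (JI) => _ + _; apply; [apply: Ix|apply: Iy].
- by move=> a x Ix J [JI XJ]; case: (JI) => _ _; apply; apply: Ix.
Qed.

Lemma idealX0 I n : idealX I n 0.
Proof. by case: n => //= n; case: (ideal_gen_ideal [set x * y | x in I & y in idealX I n]). Qed.

End Ideals.
Arguments noetherian : clear implicits.
Arguments spec : clear implicits.

(* Quotient rings: [quot X] is R/(X), (X) being the ideal generated by X. *)

Section Quotient.
Variables (R : comPzRingType) (X : set R).
Local Notation I := (ideal_gen X).

Definition quot_rel : rel R := [rel x y | `[< I (x - y) >]].

Let I0 : I 0. Proof. by case: (ideal_gen_ideal X). Qed.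
Let ID x y : I x -> I y -> I (x + y). Proof. by case: (ideal_gen_ideal X) => _ + _; apply. Qed.
Let IM a x : I x -> I (a * x). Proof. by case: (ideal_gen_ideal X) => _ _; apply. Qed.
Let IN x : I x -> I (- x). Proof. by rewrite -mulN1r; apply: IM. Qed.

Lemma quot_rel_refl : reflexive quot_rel.
Proof. by move=> x; apply/asboolP; rewrite subrr. Qed.
Lemma quot_rel_sym : symmetric quot_rel.
Proof.
by move=> x y; apply/idP/idP => /asboolP/IN Ixy; apply/asboolP; rewrite -opprB.
Qed.
Lemma quot_rel_trans : transitive quot_rel.
Proof.
move=> y x z /asboolP Ixy /asboolP Iyz; apply/asboolP.
by rewrite -(subrK y x) -addrA; apply: ID.
Qed.

Canonical quot_equiv := EquivRel quot_rel quot_rel_refl quot_rel_sym quot_rel_trans.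
Definition quot := {eq_quot quot_rel}.
HB.instance Definition _ := Choice.on quot.

Definition to_quot (x : R) : quot := \pi_quot x.

Lemma to_quot_eq x y : to_quot x = to_quot y <-> I (x - y).
Proof.
split; first by move=> /eqmodP/asboolP.
by move=> Ixy; apply/eqmodP/asboolP.
Qed.

Lemma to_quot_surj (u : quot) : exists x, u = to_quot x.
Proof. by exists (repr u); rewrite /to_quot reprK. Qed.

Lemma repr_quot x : I (repr (to_quot x) - x).
Proof. by apply/to_quot_eq; rewrite /to_quot reprK. Qed.

Definition quot_add (u v : quot) := to_quot (repr u + repr v).
Definition quot_opp (u : quot) := to_quot (- repr u).
Definition quot_mul (u v : quot) := to_quot (repr u * repr v).

Lemma quot_addE x y : quot_add (to_quot x) (to_quot y) = to_quot (x + y).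
Proof.
apply/to_quot_eq; rewrite opprD addrACA; apply: ID; exact: repr_quot.
Qed.
Lemma quot_oppE x : quot_opp (to_quot x) = to_quot (- x).
Proof. by apply/to_quot_eq; rewrite -opprD; apply: IN; apply: repr_quot. Qed.
Lemma quot_mulE x y : quot_mul (to_quot x) (to_quot y) = to_quot (x * y).
Proof.
apply/to_quot_eq; set a := repr _; set b := repr _.
rewrite -(subrK (x * b) (a * b)) -addrA -mulrBl -mulrBr; apply: ID.
  by rewrite mulrC; apply: IM; apply: repr_quot.
by apply: IM; apply: repr_quot.
Qed.

Fact quot_addA : associative quot_add.
Proof.
move=> u v w; have [[x ->] [y ->] [z ->]] :=
  And3 (to_quot_surj u) (to_quot_surj v) (to_quot_surj w).
by rewrite !quot_addE addrA.
Qed.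
Fact quot_addC : commutative quot_add.
Proof. by move=> u v; rewrite /quot_add addrC. Qed.
Fact quot_add0 : left_id (to_quot 0) quot_add.
Proof. by move=> u; have [x ->] := to_quot_surj u; rewrite quot_addE add0r. Qed.
Fact quot_addN : left_inverse (to_quot 0) quot_opp quot_add.
Proof.
by move=> u; have [x ->] := to_quot_surj u; rewrite quot_oppE quot_addE addNr.
Qed.
HB.instance Definition _ := GRing.isZmodule.Build quot
  quot_addA quot_addC quot_add0 quot_addN.

Fact quot_mulA : associative quot_mul.
Proof.
move=> u v w; have [[x ->] [y ->] [z ->]] :=
  And3 (to_quot_surj u) (to_quot_surj v) (to_quot_surj w).
by rewrite !quot_mulE mulrA.
Qed.
Fact quot_mulC : commutative quot_mul.
Proof. by move=> u v; rewrite /quot_mul mulrC. Qed.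
Fact quot_mul1 : left_id (to_quot 1) quot_mul.
Proof. by move=> u; have [x ->] := to_quot_surj u; rewrite quot_mulE mul1r. Qed.
Fact quot_mulD : left_distributive quot_mul +%R.
Proof.
move=> u v w; have [[x ->] [y ->] [z ->]] :=
  And3 (to_quot_surj u) (to_quot_surj v) (to_quot_surj w).
have addE a b : to_quot a + to_quot b = to_quot (a + b) by exact: quot_addE.
by rewrite addE !quot_mulE addE mulrDl.
Qed.
HB.instance Definition _ := GRing.Zmodule_isComPzRing.Build quot
  quot_mulA quot_mulC quot_mul1 quot_mulD.

Fact to_quot_zmod : zmod_morphism to_quot.
Proof.
by move=> x y; rewrite -[RHS]/(quot_add _ (quot_opp _)) quot_oppE quot_addE.
Qed.
Fact to_quot_monoid : monoid_morphism to_quot.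
Proof. by split=> // x y; rewrite -quot_mulE. Qed.
HB.instance Definition _ := GRing.isZmodMorphism.Build R quot to_quot to_quot_zmod.
HB.instance Definition _ := GRing.isMonoidMorphism.Build R quot to_quot to_quot_monoid.

End Quotient.

(* The map R/(X) -> S/(Y) induced by f : R -> S when f maps X into (Y). *)
Definition quot_map (R S : comPzRingType) (f : R -> S) (X : set R) (Y : set S)
    (u : quot X) : quot Y :=
  to_quot Y (f (repr u)).

(* The degree [S : R] along h, i.e. the cardinality of a basis of S over R when
   h is an extension of finite degree of the field R. *)
Definition degree (R S : comPzRingType) (h : R -> S) : nat :=
  xget 0%N [set n | exists b : 'I_n -> S, forall y : S,
    exists! c : 'I_n -> R, y = \sum_(i < n) h (c i) * b i].

Section Localization.
Variables (R : comPzRingType) (p : spec R).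
Local Notation q := (spec_set p).

Let q0 : q 0. Proof. by case: (specP p) => -[]. Qed.
Let qC1 : ~ q 1. Proof. by case: (specP p). Qed.
Let qCM s t : ~ q s -> ~ q t -> ~ q (s * t).
Proof. by case: (specP p) => _ _ qP qs qt /qP []. Qed.

Definition denom := {s : R | `[< ~ q s >]}.
Definition mk_denom s (qs : ~ q s) : denom := exist _ s (asboolT qs).
Definition den (s : denom) : R := sval s.
Lemma denomP (s : denom) : ~ q (den s). Proof. exact: (asboolW (valP s)). Qed.
Arguments denomP : clear implicits.
Definition denom1 := mk_denom qC1.
Definition denomM (s t : denom) := mk_denom (qCM (denomP s) (denomP t)).
Lemma denE : den denom1 = 1 /\ (forall s t, den (denomM s t) = den s * den t).
Proof. by []. Qed.
Let den1 := proj1 denE.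
Let denM := proj2 denE.

(* a/s = b/t iff u(at - bs) = 0 for some u outside p *)
Definition loc_rel : rel (R * denom) :=
  [rel x y | `[< exists2 u, ~ q u & u * (x.1 * den y.2 - y.1 * den x.2) = 0 >]].

Lemma loc_rel_refl : reflexive loc_rel.
Proof. by move=> x; apply/asboolP; exists 1 => //; rewrite subrr mulr0. Qed.
Lemma loc_rel_sym : symmetric loc_rel.
Proof.
by move=> x y; apply/idP/idP => /asboolP[u qu e]; apply/asboolP; exists u => //;
  rewrite -opprB mulrN e oppr0.
Qed.
Lemma loc_rel_trans : transitive loc_rel.
Proof.
move=> [b t] [a s] [c r] /asboolP[u qu /= e] /asboolP[v qv /= e'].
apply/asboolP; exists (u * v * den t) => /=.
  by apply: qCM (denomP t); apply: qCM.
have -> : u * v * den t * (a * den r - c * den s) =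
  v * den r * (u * (a * den t - b * den s)) +
  u * den s * (v * (b * den r - c * den t)) by ring.
by rewrite e e' !mulr0 addr0.
Qed.

Canonical loc_equiv := EquivRel loc_rel loc_rel_refl loc_rel_sym loc_rel_trans.
Definition localization := {eq_quot loc_rel}.
HB.instance Definition _ := Choice.on localization.

Definition loc_frac (a : R) (s : denom) : localization := \pi_localization (a, s).

Lemma loc_frac_eq a s b t : loc_frac a s = loc_frac b t <->
  exists2 u, ~ q u & u * (a * den t - b * den s) = 0.
Proof.
split; first by move=> /eqmodP/asboolP.
by move=> E; apply/eqmodP/asboolP.
Qed.

Lemma loc_frac_surj (x : localization) : exists a s, x = loc_frac a s.
Proof. by case E: (repr x) => [a s]; exists a, s; rewrite /loc_frac -E reprK. Qed.

Definition loc_add (x y : localization) :=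
  loc_frac ((repr x).1 * den (repr y).2 + (repr y).1 * den (repr x).2)
           (denomM (repr x).2 (repr y).2).
Definition loc_opp (x : localization) := loc_frac (- (repr x).1) (repr x).2.
Definition loc_mul (x y : localization) :=
  loc_frac ((repr x).1 * (repr y).1) (denomM (repr x).2 (repr y).2).

Let reprP a s : exists2 u, ~ q u & u * ((repr (loc_frac a s)).1 * den s
                                  - a * den (repr (loc_frac a s)).2) = 0.
Proof.
apply/loc_frac_eq; rewrite -[RHS](reprK (loc_frac a s)) /loc_frac.
by case: (repr _).
Qed.

Lemma loc_addE a s b t : loc_add (loc_frac a s) (loc_frac b t) =
  loc_frac (a * den t + b * den s) (denomM s t).
Proof.
apply/loc_frac_eq; have [u qu e] := reprP a s; have [v qv e'] := reprP b t.
move: e e'; set x := repr _; set y := repr _ => e e'; rewrite !denM.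
exists (u * v); first exact: qCM.
transitivity (v * den t * den y.2 * (u * (x.1 * den s - a * den x.2)) +
              u * den s * den x.2 * (v * (y.1 * den t - b * den y.2))); first ring.
by rewrite e e' !mulr0 addr0.
Qed.

Lemma loc_oppE a s : loc_opp (loc_frac a s) = loc_frac (- a) s.
Proof.
apply/loc_frac_eq; have [u qu e] := reprP a s; exists u => //.
by rewrite !mulNr -opprD mulrN e oppr0.
Qed.

Lemma loc_mulE a s b t :
  loc_mul (loc_frac a s) (loc_frac b t) = loc_frac (a * b) (denomM s t).
Proof.
apply/loc_frac_eq; have [u qu e] := reprP a s; have [v qv e'] := reprP b t.
move: e e'; set x := repr _; set y := repr _ => e e'; rewrite !denM.
exists (u * v); first exact: qCM.
transitivity (v * den t * y.1 * (u * (x.1 * den s - a * den x.2)) +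
              u * a * den x.2 * (v * (y.1 * den t - b * den y.2))); first ring.
by rewrite e e' !mulr0 addr0.
Qed.

Let loc_frac_eq1 a (s : denom) b (t : denom) :
  a * den t = b * den s -> loc_frac a s = loc_frac b t.
Proof. by move=> e; apply/loc_frac_eq; exists 1 => //; rewrite e subrr mulr0. Qed.

Fact loc_addA : associative loc_add.
Proof.
move=> x y z; have [[a [s ->]] [b [t ->]] [c [r ->]]] :=
  And3 (loc_frac_surj x) (loc_frac_surj y) (loc_frac_surj z).
by rewrite !loc_addE; apply: loc_frac_eq1; rewrite ?denM ?den1; ring.
Qed.
Fact loc_addC : commutative loc_add.
Proof.
move=> x y; have [[a [s ->]] [b [t ->]]] := conj (loc_frac_surj x) (loc_frac_surj y).
by rewrite !loc_addE; apply: loc_frac_eq1; rewrite ?denM ?den1; ring.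
Qed.
Fact loc_add0 : left_id (loc_frac 0 denom1) loc_add.
Proof.
move=> x; have [a [s ->]] := loc_frac_surj x.
by rewrite !loc_addE; apply: loc_frac_eq1; rewrite ?denM ?den1; ring.
Qed.
Fact loc_addN : left_inverse (loc_frac 0 denom1) loc_opp loc_add.
Proof.
move=> x; have [a [s ->]] := loc_frac_surj x.
by rewrite loc_oppE loc_addE; apply: loc_frac_eq1; rewrite ?denM ?den1; ring.
Qed.
HB.instance Definition _ := GRing.isZmodule.Build localization
  loc_addA loc_addC loc_add0 loc_addN.

Lemma loc_fracD a s b t : loc_frac a s + loc_frac b t =
  loc_frac (a * den t + b * den s) (denomM s t).
Proof. exact: loc_addE. Qed.

Fact loc_mulA : associative loc_mul.
Proof.
move=> x y z; have [[a [s ->]] [b [t ->]] [c [r ->]]] :=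
  And3 (loc_frac_surj x) (loc_frac_surj y) (loc_frac_surj z).
by rewrite !loc_mulE; apply: loc_frac_eq1; rewrite ?denM ?den1; ring.
Qed.
Fact loc_mulC : commutative loc_mul.
Proof.
move=> x y; have [[a [s ->]] [b [t ->]]] := conj (loc_frac_surj x) (loc_frac_surj y).
by rewrite !loc_mulE; apply: loc_frac_eq1; rewrite ?denM ?den1; ring.
Qed.
Fact loc_mul1 : left_id (loc_frac 1 denom1) loc_mul.
Proof.
move=> x; have [a [s ->]] := loc_frac_surj x.
by rewrite !loc_mulE; apply: loc_frac_eq1; rewrite ?denM ?den1; ring.
Qed.
Fact loc_mulD : left_distributive loc_mul +%R.
Proof.
move=> x y z; have [[a [s ->]] [b [t ->]] [c [r ->]]] :=
  And3 (loc_frac_surj x) (loc_frac_surj y) (loc_frac_surj z).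
by rewrite loc_fracD !loc_mulE loc_fracD; apply: loc_frac_eq1; rewrite ?denM ?den1; ring.
Qed.
Fact loc_1neq0 : loc_frac 1 denom1 != 0.
Proof.
apply/eqP => /loc_frac_eq[u qu].
by rewrite den1 mul0r subr0 !mulr1 => u0; apply: qu; rewrite u0.
Qed.
HB.instance Definition _ := GRing.Zmodule_isComNzRing.Build localization
  loc_mulA loc_mulC loc_mul1 loc_mulD loc_1neq0.

Lemma loc_fracM a s b t :
  loc_frac a s * loc_frac b t = loc_frac (a * b) (denomM s t).
Proof. exact: loc_mulE. Qed.

Definition loc_unit : {pred localization} :=
  [pred x | `[< exists y, y * x = 1 >]].
Definition loc_inv (x : localization) := xget x [set y | y * x = 1].
Fact loc_mulVx : {in loc_unit, left_inverse 1 loc_inv *%R}.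
Proof. by move=> x /asboolP ux; apply: (@xgetPex _ x [set y | y * x = 1]). Qed.
Fact loc_unitP (x y : localization) : y * x = 1 -> loc_unit x.
Proof. by move=> yx; apply/asboolP; exists y. Qed.
Fact loc_inv_out : {in [predC loc_unit], loc_inv =1 id}.
Proof.
move=> x /negP nux; apply: xgetPN => y yx; apply: nux.
by apply/asboolP; exists y.
Qed.
HB.instance Definition _ := GRing.ComNzRing_hasMulInverse.Build localization
  loc_mulVx loc_unitP loc_inv_out.

Definition to_loc (a : R) : localization := loc_frac a denom1.

Fact to_loc_zmod : zmod_morphism to_loc.
Proof.
move=> x y; rewrite -[RHS]/(loc_add _ (loc_opp _)) loc_oppE loc_addE.
by apply: loc_frac_eq1; rewrite ?denM ?den1; ring.
Qed.
Fact to_loc_monoid : monoid_morphism to_loc.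
Proof. by split=> // x y; rewrite loc_fracM; apply: loc_frac_eq1; rewrite ?denM ?den1; ring. Qed.
HB.instance Definition _ :=
  GRing.isZmodMorphism.Build R localization to_loc to_loc_zmod.
HB.instance Definition _ :=
  GRing.isMonoidMorphism.Build R localization to_loc to_loc_monoid.

Definition loc_max : set localization := ideal_gen (to_loc @` q).

Lemma loc_maxP a s : loc_max (loc_frac a s) <-> q a.
Proof.
have [[_ qD qM] _ qP] := specP p.
split=> [/(_ [set x | forall a s, x = loc_frac a s -> q a])| qa].
  apply=> //; split; first split => [b t | x y + + b t|x y + b t].
  - move=> /esym/loc_frac_eq[u qu /eqP].
    rewrite den1 mul0r subr0 mulr1 => /eqP ub0.
    by have : q (u * b) by [rewrite ub0]; case/qP.
  - have [[a1 [s1 ->]] [a2 [s2 ->]]] := conj (loc_frac_surj x) (loc_frac_surj y).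
    move=> /(_ _ _ erefl) qa1 /(_ _ _ erefl) qa2.
    rewrite loc_fracD => /loc_frac_eq[u qu]; rewrite ?denM ?den1 => e.
    have : q (u * (den s1 * den s2 * b)).
      have -> : u * (den s1 * den s2 * b) =
                u * den t * den s2 * a1 + u * den t * den s1 * a2 + 
        - (u * ((a1 * den s2 + a2 * den s1) * den t - b * (den s1 * den s2))) by ring.
      by rewrite e oppr0 addr0; apply: qD; apply: qM.
    by case/qP => // /qP[/qP[]/denomP//|].
  - have [[a1 [s1 ->]] [a2 [s2 ->]]] := conj (loc_frac_surj x) (loc_frac_surj y).
    move=> /(_ _ _ erefl) qa2; rewrite loc_fracM => /loc_frac_eq[u qu]; rewrite ?denM ?den1 => e.
    have : q (u * (den s1 * den s2 * b)).
      have -> : u * (den s1 * den s2 * b) = u * den t * a1 * a2 +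
        - (u * (a1 * a2 * den t - b * (den s1 * den s2))) by ring.
      by rewrite e oppr0 addr0; apply: qM.
    by case/qP => // /qP[/qP[]/denomP//|].
  - move=> _ [c qc <-] b t /loc_frac_eq[u qu]; rewrite ?denM ?den1 => e.
    have : q (u * b).
      have -> : u * b = u * den t * c + - (u * (c * den t - b * 1)) by ring.
      by rewrite e oppr0 addr0; apply: qM.
    by case/qP.
have -> : loc_frac a s = loc_frac 1 s * to_loc a.
  by rewrite loc_fracM; apply: loc_frac_eq1; rewrite ?denM ?den1; ring.
have [_ _ IM] := ideal_gen_ideal (to_loc @` q); apply: IM.
by apply: sub_gen_smallest; exists a.
Qed.

Definition residue_field := quot loc_max.
HB.instance Definition _ := GRing.ComPzRing.on residue_field.

Let loc_max_gen : ideal_gen loc_max = loc_max.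
Proof. by apply: smallest_id; apply: ideal_gen_ideal. Qed.

Fact residue_1neq0 : 1 != 0 :> residue_field.
Proof.
apply/eqP => /to_quot_eq; rewrite subr0 loc_max_gen.
by move=> /loc_maxP.
Qed.
HB.instance Definition _ := GRing.PzSemiRing_isNonZero.Build residue_field residue_1neq0.

Definition residue_inv (x : residue_field) : residue_field :=
  xget 0 [set y | y * x = 1].
Fact residue_mulVf (x : residue_field) : x != 0 -> residue_inv x * x = 1.
Proof.
move=> /eqP x0; apply: (@xgetPex _ 0 [set y | y * x = 1]).
have [y xy] := to_quot_surj x; have [a [s ys]] := loc_frac_surj y.
have qa : ~ q a.
  move=> qa; apply: x0; rewrite xy; apply/to_quot_eq.
  by rewrite subr0 loc_max_gen ys; apply/loc_maxP.
exists (to_quot _ (loc_frac (den s) (mk_denom qa))) => /=.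
rewrite xy ys -rmorphM -[RHS]/(to_quot _ 1); congr (to_quot _ _).
by rewrite loc_fracM; apply: loc_frac_eq1; rewrite denM den1 mulr1 mul1r mulrC.
Qed.
Fact residue_inv0 : residue_inv 0 = 0.
Proof.
apply: xgetPN => y /=; rewrite mulr0 => /esym/eqP.
by rewrite (negbTE residue_1neq0).
Qed.
HB.instance Definition _ :=
  GRing.ComNzRing_isField.Build residue_field residue_mulVf residue_inv0.

Definition to_residue : R -> residue_field := to_quot loc_max \o to_loc.
HB.instance Definition _ := GRing.RMorphism.on to_residue.

End Localization.
Arguments to_residue {R} p _.
Arguments loc_max {R} p _.

Section LocalizationDomain.
Variables (R : idomainType) (p : spec R).

Fact loc_idomain (x y : localization p) : x * y = 0 -> (x == 0) || (y == 0).
Proof.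
have q0 : spec_set p 0 by case: (specP p) => -[].
have zP a s : a = 0 -> loc_frac a s = 0 :> localization p.
  by move=> ->; apply/loc_frac_eq; exists 1; [case: (specP p)|rewrite !mul0r subrr mulr0].
have [[a [s ->]] [b [t ->]]] := conj (loc_frac_surj x) (loc_frac_surj y).
rewrite loc_fracM => /loc_frac_eq[u qu /eqP].
rewrite /= mul0r subr0 mulr1 !mulf_eq0 => /or3P[/eqP u0|/eqP/zP->|/eqP/zP->].
- by case: qu; rewrite u0.
- by rewrite eqxx.
- by rewrite eqxx orbT.
Qed.
HB.instance Definition _ :=
  GRing.ComUnitRing_isIntegral.Build (localization p) loc_idomain.

End LocalizationDomain.

(* Completion: Cauchy sequences modulo null sequences, for the linear topology
   given by a filtration.  When this topology is compatible with the ring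
   structure, the Cauchy sequences form a subring of R^nat in which the null
   sequences form an ideal, so that taking the generated subring and the
   generated ideal adds nothing. *)

Record filtration (R : comPzRingType) := Filtration {
  fil :> nat -> set R;
  fil0 : forall k, fil k 0 }.

Section Completion.
Variables (R : comPzRingType) (U : filtration R).

Definition is_cauchy (x : nat -> R) :=
  forall k, exists N, forall m n, (N <= m)%N -> (N <= n)%N -> fil U k (x m - x n).

Definition is_null (x : nat -> R) :=
  forall k, exists N, forall n, (N <= n)%N -> fil U k (x n).

Definition is_subring (S : set (nat -> R)) :=
  [/\ S 1, forall x y, S x -> S y -> S (x - y)
    & forall x y, S x -> S y -> S (x * y)].

Definition cauchy_pred : {pred nat -> R} :=
  fun x => `[< smallest is_subring is_cauchy x >].

Fact cauchy_subring : subring_closed cauchy_pred.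
Proof.
split=> [|x y /asboolP Sx /asboolP Sy|x y /asboolP Sx /asboolP Sy];
  apply/asboolP => T TT; have [[T1 TB TM] _] := TT => //.
- by apply: TB; [apply: Sx|apply: Sy].
- by apply: TM; [apply: Sx|apply: Sy].
Qed.
HB.instance Definition _ :=
  GRing.isSubringClosed.Build (nat -> R) cauchy_pred cauchy_subring.

Definition cauchy_seq := {x : nat -> R | cauchy_pred x}.
HB.instance Definition _ := SubChoice.on cauchy_seq.
HB.instance Definition _ :=
  GRing.SubChoice_isSubComPzRing.Build (nat -> R) cauchy_pred cauchy_seq
    (subringClosedP cauchy_pred).

Definition null_seq : set cauchy_seq := [set x | is_null (val x)].

Definition completion := quot null_seq.
HB.instance Definition _ := GRing.ComPzRing.on completion.

Fact cst_cauchy (a : R) : cauchy_pred (cst a).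
Proof.
apply/asboolP; apply: sub_gen_smallest => k; exists 0%N => m n _ _.
by rewrite /cst subrr; apply: fil0.
Qed.
Definition cst_seq (a : R) : cauchy_seq := exist _ (cst a) (cst_cauchy a).
Fact cst_seq_zmod : zmod_morphism cst_seq.
Proof. by move=> a b; apply: val_inj. Qed.
Fact cst_seq_monoid : monoid_morphism cst_seq.
Proof. by split=> [|a b]; apply: val_inj. Qed.
HB.instance Definition _ :=
  GRing.isZmodMorphism.Build R cauchy_seq cst_seq cst_seq_zmod.
HB.instance Definition _ :=
  GRing.isMonoidMorphism.Build R cauchy_seq cst_seq cst_seq_monoid.

Definition to_completion : R -> completion := to_quot null_seq \o cst_seq.
HB.instance Definition _ := GRing.RMorphism.on to_completion.

End Completion.
Arguments to_completion {R} U _.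

Definition adic (R : comPzRingType) (I : set R) : filtration R :=
  Filtration (idealX0 I).

(* The valuation at a nonzero prime p of a Dedekind domain A, on the nonzero
   elements of its quotient field, and the topology that it defines there. *)
Definition padic_val (A : idomainType) (p : spec A) (x : {fraction A}) : int :=
  (ideal_exp (ideal_gen [set \n_(repr x)]) p)%:Z -
  (ideal_exp (ideal_gen [set \d_(repr x)]) p)%:Z.

(* The disjunct x = 0 stands for the value +oo at 0. *)
Definition padic (A : idomainType) (p : spec A) : filtration {fraction A} :=
  @Filtration _ (fun k => [set x | x = 0 \/ (k%:Z <= padic_val p x)%R])
    (fun k => or_introl erefl).

(* Tensor products: formal sums of pairs modulo the bilinear relations, for two
   abelian groups on which the elements of R act. *)

Section Tensor.
Variables (R : Type) (M N : zmodType) (aM : R -> M -> M) (aN : R -> N -> N).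

Inductive tensor_eq : seq (M * N) -> seq (M * N) -> Prop :=
| tensor_eq_refl s : tensor_eq s s
| tensor_eq_sym s t : tensor_eq s t -> tensor_eq t s
| tensor_eq_trans s t u : tensor_eq s t -> tensor_eq t u -> tensor_eq s u
| tensor_eq_cat s s' t t' :
    tensor_eq s s' -> tensor_eq t t' -> tensor_eq (s ++ t) (s' ++ t')
| tensor_eqC s t : tensor_eq (s ++ t) (t ++ s)
| tensor_eq0 y : tensor_eq [:: (0, y)] [::]
| tensor_eqDl x x' y : tensor_eq [:: (x + x', y)] [:: (x, y); (x', y)]
| tensor_eqDr x y y' : tensor_eq [:: (x, y + y')] [:: (x, y); (x, y')]
| tensor_eq_act r x y : tensor_eq [:: (aM r x, y)] [:: (x, aN r y)].

Definition tensor_rel : rel (seq (M * N)) := [rel s t | `[< tensor_eq s t >]].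
Lemma tensor_rel_refl : reflexive tensor_rel.
Proof. by move=> s; apply/asboolP/tensor_eq_refl. Qed.
Lemma tensor_rel_sym : symmetric tensor_rel.
Proof.
by move=> s t; apply/asboolP/asboolP => /tensor_eq_sym.
Qed.
Lemma tensor_rel_trans : transitive tensor_rel.
Proof.
move=> t s u /asboolP st /asboolP tu; apply/asboolP.
exact: tensor_eq_trans st tu.
Qed.
Canonical tensor_equiv :=
  EquivRel tensor_rel tensor_rel_refl tensor_rel_sym tensor_rel_trans.
Definition tensor := {eq_quot tensor_rel}.
HB.instance Definition _ := Choice.on tensor.

Definition tensor_pi (s : seq (M * N)) : tensor := \pi_tensor s.

Lemma tensor_pi_eq s t : tensor_pi s = tensor_pi t <-> tensor_eq s t.
Proof.
split; first by move=> /eqmodP/asboolP.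
by move=> E; apply/eqmodP/asboolP.
Qed.
Lemma tensor_pi_surj (u : tensor) : exists s, u = tensor_pi s.
Proof. by exists (repr u); rewrite /tensor_pi reprK. Qed.
Lemma repr_tensor s : tensor_eq (repr (tensor_pi s)) s.
Proof. by apply/tensor_pi_eq; rewrite /tensor_pi reprK. Qed.

Definition tensor_add (u v : tensor) := tensor_pi (repr u ++ repr v).
Definition tensor_opp (u : tensor) :=
  tensor_pi [seq (- x.1, x.2) | x <- repr u].

Lemma tensor_addE s t :
  tensor_add (tensor_pi s) (tensor_pi t) = tensor_pi (s ++ t).
Proof. by apply/tensor_pi_eq/tensor_eq_cat; apply: repr_tensor. Qed.

Fact tensor_addA : associative tensor_add.
Proof.
move=> u v w; have [[s ->] [t ->] [r ->]] :=
  And3 (tensor_pi_surj u) (tensor_pi_surj v) (tensor_pi_surj w).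
by rewrite !tensor_addE catA.
Qed.
Fact tensor_addC : commutative tensor_add.
Proof. by move=> u v; apply/tensor_pi_eq/tensor_eqC. Qed.
Fact tensor_add0 : left_id (tensor_pi [::]) tensor_add.
Proof. by move=> u; have [s ->] := tensor_pi_surj u; rewrite tensor_addE. Qed.
HB.instance Definition _ := GRing.isNmodule.Build tensor
  tensor_addA tensor_addC tensor_add0.

Definition pure (x : M) (y : N) : tensor := tensor_pi [:: (x, y)].

Lemma tensor_pi_cat s t : tensor_pi (s ++ t) = tensor_pi s + tensor_pi t.
Proof. by rewrite -tensor_addE. Qed.
Lemma tensor_pi_cons x s : tensor_pi (x :: s) = pure x.1 x.2 + tensor_pi s.
Proof. by rewrite -cat1s tensor_pi_cat; case: x. Qed.
Lemma tensor_piE s : tensor_pi s = \sum_(x <- s) pure x.1 x.2.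
Proof.
by elim: s => [|x s IHs]; rewrite ?big_nil// big_cons tensor_pi_cons IHs.
Qed.
Lemma pure0l y : pure 0 y = 0.
Proof. exact/tensor_pi_eq/tensor_eq0. Qed.
Lemma pureDl x x' y : pure (x + x') y = pure x y + pure x' y.
Proof. by rewrite -tensor_pi_cat; apply/tensor_pi_eq/tensor_eqDl. Qed.
Lemma pureDr x y y' : pure x (y + y') = pure x y + pure x y'.
Proof. by rewrite -tensor_pi_cat; apply/tensor_pi_eq/tensor_eqDr. Qed.
Lemma pure_act r x y : pure (aM r x) y = pure x (aN r y).
Proof. exact/tensor_pi_eq/tensor_eq_act. Qed.

Fact tensor_addN : left_inverse 0 tensor_opp +%R.
Proof.
move=> u; rewrite -[u in X in _ + X]reprK -/(tensor_pi _) /tensor_opp.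
elim: (repr u) => [|[x y] s IHs] /=; first by rewrite -tensor_pi_cat.
by rewrite !tensor_pi_cons addrACA IHs addr0 -pureDl addNr pure0l.
Qed.
HB.instance Definition _ := GRing.Nmodule_isZmodule.Build tensor tensor_addN.

Lemma pure0r x : pure x 0 = 0.
Proof. by apply: (addrI (pure x 0)); rewrite -pureDr !addr0. Qed.

Lemma tensor_ind (Q : tensor -> Prop) :
  (forall x y, Q (pure x y)) -> (forall u v, Q u -> Q v -> Q (u + v)) ->
  forall u, Q u.
Proof.
move=> Qp QD u; have [s ->] := tensor_pi_surj u; rewrite tensor_piE.
by elim/big_rec: _ => [|x v _]; [rewrite -(pure0l 0)|apply: QD].
Qed.

End Tensor.

(* The map M (x) N -> M (x) N' induced by g : N -> N'. *)
Definition tensor_mapr (R : Type) (M N N' : zmodType) (aM : R -> M -> M)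
    (aN : R -> N -> N) (aN' : R -> N' -> N') (g : N -> N')
    (u : tensor aM aN) : tensor aM aN' :=
  tensor_pi aM aN' [seq (x.1, g x.2) | x <- repr u].

Section TensorAlgebra.
Variables (R S T : comPzRingType) (f : {rmorphism R -> S}) (g : {rmorphism R -> T}).
Local Notation actS := (fun r (x : S) => f r * x).
Local Notation actT := (fun r (y : T) => g r * y).

Definition tensor_alg := tensor actS actT.
HB.instance Definition _ := GRing.Zmodule.on tensor_alg.

Local Notation pi := (tensor_pi actS actT).
Local Notation pure := (@pure R S T actS actT).

Definition tensor_seqM (s t : seq (S * T)) :=
  [seq (x.1 * y.1, x.2 * y.2) | x <- s, y <- t].
Definition tensor_mul (u v : tensor_alg) : tensor_alg :=
  pi (tensor_seqM (repr u) (repr v)).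

Let pi_seqM s t : pi (tensor_seqM s t) =
  \sum_(x <- s) \sum_(y <- t) pure (x.1 * y.1) (x.2 * y.2).
Proof. by rewrite tensor_piE big_allpairs_dep. Qed.

Let pi_seqMl s s' t : tensor_eq actS actT s s' ->
  pi (tensor_seqM s t) = pi (tensor_seqM s' t).
Proof.
rewrite !pi_seqM; elim=> {s s'} //.
- by move=> s s' u _ -> _ ->.
- by move=> s s' u u' _ IH _ IH'; rewrite !big_cat IH IH'.
- by move=> s u; rewrite !big_cat /= addrC.
- move=> y; rewrite big_seq1 big_nil big1// => z _.
  by rewrite mul0r pure0l.
- move=> x x' y; rewrite !big_cons !big_nil !addr0 -big_split /=.
  by apply: eq_bigr => z _; rewrite mulrDl pureDl.
- move=> x y y'; rewrite !big_cons !big_nil !addr0 -big_split /=.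
  by apply: eq_bigr => z _; rewrite mulrDl pureDr.
- move=> r x y; rewrite !big_seq1; apply: eq_bigr => z _ /=.
  by rewrite -!mulrA pure_act.
Qed.

Let pi_seqMC s t : pi (tensor_seqM s t) = pi (tensor_seqM t s).
Proof.
rewrite !pi_seqM exchange_big; apply: eq_bigr => y _; apply: eq_bigr => x _.
by rewrite mulrC [in X in pure _ X]mulrC.
Qed.

Fact tensor_mulC : commutative tensor_mul.
Proof. by move=> u v; apply: pi_seqMC. Qed.

Let mulE s t : tensor_mul (pi s) (pi t) = pi (tensor_seqM s t).
Proof.
rewrite /tensor_mul (pi_seqMl _ (repr_tensor _ _ s)) pi_seqMC.
by rewrite (pi_seqMl _ (repr_tensor _ _ t)) pi_seqMC.
Qed.

Lemma tensor_mul_pure x y x' y' :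
  tensor_mul (pure x y) (pure x' y') = pure (x * x') (y * y').
Proof. exact: mulE. Qed.

Fact tensor_mulD : left_distributive tensor_mul +%R.
Proof.
move=> u v w; have [[s ->] [t ->] [r ->]] :=
  And3 (tensor_pi_surj u) (tensor_pi_surj v) (tensor_pi_surj w).
rewrite -[X in tensor_mul X _]tensor_pi_cat !mulE -[RHS]tensor_pi_cat.
by rewrite /tensor_seqM map_cat flatten_cat.
Qed.
Let tensor_mulDr : right_distributive tensor_mul +%R.
Proof. by move=> u v w; rewrite ![tensor_mul u _]tensor_mulC tensor_mulD. Qed.

Fact tensor_mulA : associative tensor_mul.
Proof.
move=> u v w; elim/tensor_ind: u => [x y|u u' IH IH']; last first.
  by rewrite !tensor_mulD IH IH'.
elim/tensor_ind: v => [x' y'|v v' IH IH']; last first.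
  by rewrite !(tensor_mulD, tensor_mulDr) IH IH'.
elim/tensor_ind: w => [x2 y2|v v' IH IH']; last first.
  by rewrite !(tensor_mulD, tensor_mulDr) IH IH'.
by rewrite !tensor_mul_pure !mulrA.
Qed.
Fact tensor_mul1 : left_id (pure 1 1 : tensor_alg) tensor_mul.
Proof.
move=> u; elim/tensor_ind: u => [x y|u u' IH IH']; last first.
  by rewrite tensor_mulDr IH IH'.
by rewrite tensor_mul_pure !mul1r.
Qed.
HB.instance Definition _ := GRing.Zmodule_isComPzRing.Build tensor_alg
  tensor_mulA tensor_mulC tensor_mul1 tensor_mulD.

Definition tensor_inr (y : T) : tensor_alg := pure 1 y.

Fact tensor_inr_zmod : zmod_morphism tensor_inr.
Proof.
move=> y y'; apply: (addIr (tensor_inr y')).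
by rewrite subrK -[LHS]pureDr subrK.
Qed.
Fact tensor_inr_monoid : monoid_morphism tensor_inr.
Proof. by split=> // y y'; rewrite -[RHS]/(tensor_mul _ _) tensor_mul_pure mul1r. Qed.
HB.instance Definition _ :=
  GRing.isZmodMorphism.Build T tensor_alg tensor_inr tensor_inr_zmod.
HB.instance Definition _ :=
  GRing.isMonoidMorphism.Build T tensor_alg tensor_inr tensor_inr_monoid.

End TensorAlgebra.

Definition krull_chain (R : comPzRingType) (n : nat) :=
  exists c : 'I_n.+1 -> spec R,
    forall i j : 'I_n.+1, (i < j)%N -> spec_set (c i) `<` spec_set (c j).

Definition krull_dim (R : comPzRingType) (d : nat) :=
  krull_chain R d /\ forall n, krull_chain R n -> (n <= d)%N.

Definition regular_local (R : comPzRingType) :=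
  noetherian R /\ exists m : set R,
    [/\ is_maximal_ideal m, forall m', is_maximal_ideal m' -> m' = m
      & exists d, krull_dim R d /\ exists b : 'I_d -> R, m = ideal_gen (range b)].

Definition regular_ring (R : comPzRingType) :=
  noetherian R /\ forall p : spec R, regular_local (localization p).

Definition geometrically_regular (k : fieldType) (R : comPzRingType)
    (h : {rmorphism k -> R}) :=
  noetherian R /\
  forall k' : fieldExtType k, regular_ring (tensor_alg h (in_alg k')).

Definition flat (R S : comPzRingType) (f : {rmorphism R -> S}) :=
  forall (M N : lmodType R) (u : {linear M -> N}), injective u ->
  injective (@tensor_mapr R S M N (fun r x => f r * x) *:%R *:%R u).

(* The fiber over q is S (x)_R k(q), a k(q)-algebra through [tensor_inr]. *)
Definition regular_hom (R S : comPzRingType) (f : {rmorphism R -> S}) :=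
  [/\ noetherian R, noetherian S, flat f
    & forall q : spec R, geometrically_regular (tensor_inr f (to_residue q))].

Definition G_ring (R : comPzRingType) :=
  noetherian R /\
  forall q : spec R, regular_hom (to_completion (adic (loc_max q))).

(* Every ideal, i.e. every submodule of the regular module, is a direct
   summand. *)
Definition semisimple (T : comPzRingType) :=
  forall I : set T, is_ideal I -> exists J : set T,
    [/\ is_ideal J, I `&` J = [set 0] & forall x, exists2 y, I y & J (x - y)].

Section IntegralClosure.
Variables (R : idomainType) (L : fieldExtType {fraction R}).

Definition to_ext : R -> L := in_alg L \o @FracField.tofrac R.
HB.instance Definition _ := GRing.RMorphism.on to_ext.

Definition integral_pred : {pred L} := fun x => `[< integralOver to_ext x >].

Fact integral_subring : subring_closed integral_pred.
Proof.
split=> [|x y /asboolP ix /asboolP iy|x y /asboolP ix /asboolP iy]; apply/asboolP.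
- exact: integral1.
- exact: integral_sub.
- exact: integral_mul.
Qed.
HB.instance Definition _ :=
  GRing.isSubringClosed.Build L integral_pred integral_subring.

Definition integral_closure := {x : L | integral_pred x}.
HB.instance Definition _ := SubChoice.on integral_closure.
HB.instance Definition _ := [SubChoice_isSubComNzRing of integral_closure by <:].

Fact to_ext_integral (a : R) : integral_pred (to_ext a).
Proof. by apply/asboolP; apply: integral_id. Qed.
Definition to_closure (a : R) : integral_closure :=
  exist _ (to_ext a) (to_ext_integral a).

Fact to_closure_zmod : zmod_morphism to_closure.
Proof. by move=> a b; apply: val_inj; rewrite /= rmorphB. Qed.
Fact to_closure_monoid : monoid_morphism to_closure.
Proof.
by split=> [|a b]; apply: val_inj; rewrite /= ?rmorph1 ?rmorphM.
Qed.
HB.instance Definition _ :=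
  GRing.isZmodMorphism.Build R integral_closure to_closure to_closure_zmod.
HB.instance Definition _ :=
  GRing.isMonoidMorphism.Build R integral_closure to_closure to_closure_monoid.

Definition primes_over (p : spec R) : set (set integral_closure) :=
  [set P | is_prime_ideal P /\ to_closure @^-1` P = p].

Definition ramification_index (p : spec R) (P : set integral_closure) : nat :=
  ideal_exp (ideal_gen (to_closure @` p)) P.

Definition residue_degree (p : spec R) (P : set integral_closure) : nat :=
  degree (@quot_map R integral_closure to_closure p P).

End IntegralClosure.
Arguments to_closure {R} L _.
Arguments primes_over {R} L p _.

Definition japanese (R : idomainType) :=
  forall E : fieldExtType {fraction R},
  exists n (b : 'I_n -> integral_closure E),
  forall y, exists c : 'I_n -> R, y = \sum_(i < n) to_closure E (c i) * b i.

Definition integrally_closed (R : idomainType) :=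
  forall x : {fraction R}, integralOver (@FracField.tofrac R) x ->
  exists a, x = FracField.tofrac a.

(* Fields are included: their only prime ideal is zero. *)
Definition dedekind (A : idomainType) :=
  [/\ noetherian A, integrally_closed A
    & forall p : spec A, spec_set p <> [set 0] -> is_maximal_ideal (spec_set p)].

(* Main.v *)
Require Import Defs.
From HB Require Import structures.
From mathcomp Require Import all_boot all_order all_algebra all_field ring zify.
From mathcomp Require Import boolp classical_sets functions fsbigop.

Set Implicit Arguments.
Unset Strict Implicit.
Unset Printing Implicit Defensive.

Import Order.TTheory GRing.Theory Num.Theory.
Local Open Scope ring_scope.
Local Open Scope classical_set_scope.

(** Fix a nonzero prime p of A, a finite extension L of K of degree n, and let B be
    the integral closure of A in L. Each of the four conditions says that
<<
        B / pB  has dimension  n  over  A / p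
>>
    for all p and L ([full_residual_dim]). The dimension is at most n in general:
    a family of B which is free modulo pB is free over K, because a relation over K
    can be scaled so that its coefficients lie in A but not all in p
    ([residually_free_linear]). For the same reason B is a Dedekind domain, even when
    it is not finite over A: its ideals are finitely generated modulo the multiples
    of any nonzero element of A ([integral_closure_dedekind]).

    (1) Filtering B by the partial products of the factorization of pB, the quotients
    are isomorphic to the residue fields B / P, so that the dimension of B / pB is the
    sum of the e f ([sum_ramification_residue], [ramification_fullP]).

    (2) Let V be the tensor product of L and K_p, and W k the span in V of the p^k B,
    over the valuation ring of K_p. The intersection of the W k is an ideal of V. It
    contains no nonzero idempotent: an idempotent in W 1 is in the W j of a finitely
    generated subring of B for all j, and there the intersection is zero
    ([idempotent_W1_eq0]). If B / pB has dimension less than n, then lifting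
    its basis and taking limits expresses some y in B, independent of this basis, as
    a combination of it modulo this intersection, which is therefore nonzero
    ([divisible_neq0]); as the ideals of a semisimple ring are generated by
    idempotents, V is not semisimple. Conversely, let the dimension be n. Then a
    lifted basis spans W 0 over the valuation ring. Were the square of some nonzero
    v in V zero, v could be taken in W 0 and not in W 1; for y in B close to v, the
    square of y / pi would be integral at p, hence y / pi too, and v would be
    in W 1 ([full_reduced]). So V is reduced, and being finite dimensional over a
    field it is semisimple ([semisimple_fullP]).

    (3) The fiber of the completed local ring at the closed point is the residue field
    of p. At the generic point, the fiber over L is V again: the completed
    local ring is the valuation ring of K_p ([sigma]), and inverting the nonzero
    elements of A gives K_p ([formal_fiber_iso]). As V has dimension zero, it is regular
    exactly when it is reduced ([regular_reduced], [semisimple_regular]). Flatness is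
    automatic, torsion-free modules over a valuation ring being flat
    ([torsion_free_flat]). The local ring at p = 0 is a field, equal to its completion.

    (4) Let R be the localization at p. If the dimension is n, a lifted basis of B / pB
    generates the integral closure of R in L. If that closure is finite over R, a
    linear form which kills the lifted basis is bounded on B; but every element of B
    is a combination of the basis modulo p^k B for all k, so the form is zero and the
    basis spans L ([finite_full], [japanese_fullP]). *)

(** * Ideals *)

Section IdealArithmetic.
Variable R : comPzRingType.
Implicit Types (I J K P Q X : set R) (s : seq (set R)) (a b x y z : R).

Lemma ideal0 I : is_ideal I -> I 0. Proof. by case. Qed.

Lemma idealD I x y : is_ideal I -> I x -> I y -> I (x + y).
Proof. by case=> _ + _; apply. Qed.

Lemma ideal_mull I a x : is_ideal I -> I x -> I (a * x).
Proof. by case=> _ _; apply. Qed.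

Lemma ideal_mulr I a x : is_ideal I -> I x -> I (x * a).
Proof. by rewrite mulrC; apply: ideal_mull. Qed.

Lemma idealN I x : is_ideal I -> I x -> I (- x).
Proof. by move=> hI Ix; rewrite -mulN1r; apply: ideal_mull. Qed.

Lemma idealB I x y : is_ideal I -> I x -> I y -> I (x - y).
Proof. by move=> hI Ix Iy; apply: idealD => //; apply: idealN. Qed.

Lemma ideal_sum I T (r : seq T) (P : pred T) (F : T -> R) : is_ideal I ->
  (forall i, P i -> I (F i)) -> I (\sum_(i <- r | P i) F i).
Proof.
by move=> hI IF; elim/big_rec: _ => [|i x /IF Ii Ix]; [apply: ideal0|apply: idealD].
Qed.

Lemma idealT_eq I : is_ideal I -> I 1 -> I = setT.
Proof.
by move=> hI I1; apply/seteqP; split=> // x _; rewrite -[x]mulr1; apply: ideal_mull.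
Qed.

Lemma setT_ideal : is_ideal (@setT R). Proof. by []. Qed.

Lemma zero_ideal : is_ideal [set 0 : R].
Proof. by split=> // [x y -> ->|a x ->] /=; rewrite ?addr0 ?mulr0. Qed.

Lemma ideal_setI I J : is_ideal I -> is_ideal J -> is_ideal (I `&` J).
Proof.
move=> hI hJ; split=> [|x y [Ix Jx] [Iy Jy]|a x [Ix Jx]].
- by split; apply: ideal0.
- by split; apply: idealD.
- by split; apply: ideal_mull.
Qed.

Lemma ideal_colon I x : is_ideal I -> is_ideal [set z | I (x * z)].
Proof.
move=> hI; split=> [|y z|a y] /=; first by rewrite mulr0; apply: ideal0.
  by rewrite mulrDr; apply: idealD.
by rewrite mulrCA; apply: ideal_mull.
Qed.

Lemma ideal_neq0 I : is_ideal I -> I <> [set 0] -> exists2 x, I x & x != 0.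
Proof.
move=> hI I0; apply: contrapT => h; apply: I0; apply/seteqP; split=> [x Ix|x ->] /=.
  by apply: contrapT => /eqP x0; apply: h; exists x.
exact: ideal0.
Qed.

Lemma ideal_genS X : X `<=` ideal_gen X.
Proof. exact: sub_gen_smallest. Qed.

Lemma ideal_gen_sub X I : is_ideal I -> X `<=` I -> ideal_gen X `<=` I.
Proof. by move=> hI XI; apply: smallest_sub. Qed.

Lemma ideal_gen_id I : is_ideal I -> ideal_gen I = I.
Proof. by move=> hI; apply: smallest_id. Qed.

Lemma ideal_gen_rangeP n (b : 'I_n -> R) x :
  ideal_gen (range b) x <-> exists c : 'I_n -> R, x = \sum_i c i * b i.
Proof.
split=> [|[c ->]]; last first.
  apply: ideal_sum => [|i _]; first exact: ideal_gen_ideal.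
  by apply: (ideal_mull _ (ideal_gen_ideal _)); apply: ideal_genS; exists i.
move/(_ [set x | exists c : 'I_n -> R, x = \sum_i c i * b i]); apply.
split; first split.
- by exists (fun=> 0); rewrite big1// => i _; rewrite mul0r.
- move=> _ _ [c ->] [d ->]; exists (fun i => c i + d i).
  by rewrite -big_split; apply: eq_bigr => i _; rewrite mulrDl.
- move=> a _ [c ->]; exists (fun i => a * c i).
  by rewrite mulr_sumr; apply: eq_bigr => i _; rewrite mulrA.
- move=> _ [i _ <-]; exists (fun j => (j == i)%:R).
  rewrite (bigD1 i)//= eqxx mul1r big1 ?addr0// => j /negbTE ->.
  by rewrite mul0r.
Qed.

Lemma ideal_gen_range0 (b : 'I_0 -> R) : ideal_gen (range b) = [set 0].
Proof.
apply/seteqP; split=> [x /ideal_gen_rangeP[c ->]|_ ->]; first by rewrite big_ord0.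
by apply: ideal0; apply: ideal_gen_ideal.
Qed.

Lemma ideal_gen1P a x : ideal_gen [set a] x <-> exists c, x = c * a.
Proof.
split=> [|[c ->]]; last first.
  by apply: (ideal_mull _ (ideal_gen_ideal _)); apply: ideal_genS.
move/(_ [set x | exists c, x = c * a]); apply.
split; last by move=> _ ->; exists 1; rewrite mul1r.
split; first by exists 0; rewrite mul0r.
  by move=> _ _ [c ->] [d ->]; exists (c + d); rewrite mulrDl.
by move=> b _ [c ->]; exists (b * c); rewrite mulrA.
Qed.

Lemma ideal_gen1 : ideal_gen [set 1] = [set: R].
Proof. by apply: idealT_eq; [apply: ideal_gen_ideal|apply: ideal_genS]. Qed.

Lemma ideal_gen_eq0 X : ideal_gen X = [set 0] -> forall x, X x -> x = 0.
Proof. by move=> e x Xx; have := ideal_genS Xx; rewrite e. Qed.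

Lemma idealM_ideal I J : is_ideal (idealM I J).
Proof. exact: ideal_gen_ideal. Qed.

Lemma idealM_in I J x y : I x -> J y -> idealM I J (x * y).
Proof. by move=> Ix Jy; apply: ideal_genS; exists x => //; exists y. Qed.

Lemma idealM_sub I J K : is_ideal K ->
  (forall x y, I x -> J y -> K (x * y)) -> idealM I J `<=` K.
Proof. by move=> hK IJK; apply: ideal_gen_sub => // _ [x Ix [y Jy <-]]; apply: IJK. Qed.

Lemma idealMS I I' J J' : I `<=` I' -> J `<=` J' -> idealM I J `<=` idealM I' J'.
Proof.
move=> II JJ; apply: idealM_sub; first exact: idealM_ideal.
by move=> x y /II Ix /JJ Jy; apply: idealM_in.
Qed.

Lemma idealM_subl I J : is_ideal I -> idealM I J `<=` I.
Proof. by move=> hI; apply: idealM_sub => // x y Ix _; apply: ideal_mulr. Qed.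

Lemma idealM_subr I J : is_ideal J -> idealM I J `<=` J.
Proof. by move=> hJ; apply: idealM_sub => // x y _ Jy; apply: ideal_mull. Qed.

Lemma idealMC I J : idealM I J = idealM J I.
Proof.
by rewrite eqEsubset; split; apply: idealM_sub; try exact: idealM_ideal;
  move=> x y Ix Jy; rewrite mulrC; apply: idealM_in.
Qed.

Lemma idealT_mul I : is_ideal I -> idealM setT I = I.
Proof.
move=> hI; rewrite eqEsubset; split; first exact: idealM_subr.
by move=> x Ix; rewrite -[x]mul1r; apply: idealM_in.
Qed.

Lemma idealM_T I : is_ideal I -> idealM I setT = I.
Proof. by move=> hI; rewrite idealMC idealT_mul. Qed.

Let idealMA_sub I J K : idealM I (idealM J K) `<=` idealM (idealM I J) K.
Proof.
have hIJK := idealM_ideal (idealM I J) K.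
apply: idealM_sub => // x + Ix.
apply: (@idealM_sub _ _ [set z | idealM (idealM I J) K (x * z)]); first exact: ideal_colon.
by move=> y z Jy Kz /=; rewrite mulrA; do 2?apply: idealM_in.
Qed.

Lemma idealMA I J K : idealM I (idealM J K) = idealM (idealM I J) K.
Proof.
rewrite eqEsubset; split; first exact: idealMA_sub.
rewrite [X in X `<=` _]idealMC [X in _ `<=` X]idealMC (idealMC I) (idealMC J K).
exact: idealMA_sub.
Qed.

Lemma idealMCA I J K : idealM I (idealM J K) = idealM J (idealM I K).
Proof. by rewrite !idealMA (idealMC I J). Qed.

Lemma idealM_gen1 a I x : is_ideal I ->
  idealM (ideal_gen [set a]) I x <-> exists2 y, I y & x = a * y.
Proof.
move=> hI; split=> [|[y Iy ->]]; last by apply: idealM_in => //; apply: ideal_genS.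
apply: (@idealM_sub _ _ [set x | exists2 y, I y & x = a * y]).
  split=> [|_ _ [y Iy ->] [z Iz ->]|b _ [y Iy ->]] /=.
  - by exists 0; [apply: ideal0|rewrite mulr0].
  - by exists (y + z); [apply: idealD|rewrite mulrDr].
  - by exists (b * y); [apply: ideal_mull|rewrite mulrCA].
move=> _ y /ideal_gen1P[c ->] Iy; exists (c * y); first exact: ideal_mull.
by rewrite mulrAC mulrC.
Qed.

Lemma ideal_gen1M a b :
  idealM (ideal_gen [set a]) (ideal_gen [set b]) = ideal_gen [set a * b].
Proof.
apply/seteqP; split=> x.
  move=> /(idealM_gen1 _ _ (ideal_gen_ideal _))[y /ideal_gen1P[c ->] ->].
  by apply/ideal_gen1P; exists c; rewrite mulrCA.
move=> /ideal_gen1P[c ->]; apply/(idealM_gen1 _ _ (ideal_gen_ideal _)).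
by exists (c * b); [apply/ideal_gen1P; exists c|rewrite mulrCA].
Qed.

Lemma ideal_prod_ideal s : is_ideal (ideal_prod s).
Proof. by case: s => [|I s] /=; [apply: setT_ideal|apply: idealM_ideal]. Qed.

Lemma ideal_prod_cat s s' :
  ideal_prod (s ++ s') = idealM (ideal_prod s) (ideal_prod s').
Proof.
elim: s => [|I s IHs] /=; first by rewrite idealT_mul//; apply: ideal_prod_ideal.
by rewrite IHs idealMA.
Qed.

Lemma ideal_prod_rem Q s : Q \in s ->
  ideal_prod s = idealM Q (ideal_prod (rem Q s)).
Proof.
elim: s => //= I s IHs; rewrite inE; case: eqVneq => [->//|_ /= Qs].
by rewrite (IHs Qs) idealMCA.
Qed.

Lemma idealX_ideal I n : is_ideal (idealX I n).
Proof. by case: n => [|n]; [apply: setT_ideal|apply: idealM_ideal]. Qed.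

Lemma idealXE I n : idealX I n = ideal_prod (nseq n I).
Proof. by elim: n => //= n <-. Qed.

Lemma idealX1 I : is_ideal I -> idealX I 1 = I.
Proof. exact: idealM_T. Qed.

Lemma idealXS I n : is_ideal I -> idealX I n.+1 `<=` idealX I n.
Proof. by move=> hI; apply: idealM_subr; apply: idealX_ideal. Qed.

Lemma idealX_exp I x n : I x -> idealX I n (x ^+ n).
Proof.
move=> Ix; elim: n => [//|n IHn]; rewrite exprS; exact: idealM_in.
Qed.

Lemma prime_ideal P : is_prime_ideal P -> is_ideal P. Proof. by case. Qed.

Lemma prime_not1 P : is_prime_ideal P -> ~ P 1. Proof. by case. Qed.

Lemma prime_idealM P x y : is_prime_ideal P -> P (x * y) -> P x \/ P y.
Proof. by case=> _ _; apply. Qed.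

Lemma prime_exp P x n : is_prime_ideal P -> P (x ^+ n) -> P x.
Proof.
move=> hP; elim: n => [|n IHn]; first by case: hP.
by rewrite exprS => /(prime_idealM hP)[].
Qed.

Lemma prime_idealM_sub P I J : is_prime_ideal P ->
  idealM I J `<=` P -> I `<=` P \/ J `<=` P.
Proof.
move=> hP IJP; apply: contrapT => /not_orP[/existsNP[x /not_implyP[Ix nx]]].
move=> /existsNP[y /not_implyP[Jy ny]].
by have /IJP/(prime_idealM hP)[] := idealM_in Ix Jy.
Qed.

Lemma prime_prod_sub P s : is_prime_ideal P -> ideal_prod s `<=` P ->
  exists2 Q, Q \in s & Q `<=` P.
Proof.
move=> hP; elim: s => [|I s IHs] /=; first by move/(_ 1 I); case: hP.
move=> /(prime_idealM_sub hP)[IP|/IHs[Q Qs QP]]; first by exists I; rewrite ?mem_head.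
by exists Q; rewrite // inE Qs orbT.
Qed.

Definition ideal_adjoin I x : set R := [set z | exists2 u, I u & exists c, z = u + c * x].

Lemma ideal_adjoin_ideal I x : is_ideal I -> is_ideal (ideal_adjoin I x).
Proof.
move=> hI; split=> [|_ _ [u Pu [c ->]] [v Pv [d ->]]|a _ [u Pu [c ->]]].
- by exists 0; [apply: ideal0|exists 0; rewrite mul0r addr0].
- by exists (u + v); [apply: idealD|exists (c + d); rewrite mulrDl addrACA].
- by exists (a * u); [apply: ideal_mull|exists (a * c); rewrite mulrDr mulrA].
Qed.

Lemma ideal_adjoinS I x : I `<=` ideal_adjoin I x.
Proof. by move=> u Iu; exists u => //; exists 0; rewrite mul0r addr0. Qed.

Lemma ideal_adjoin_in I x : is_ideal I -> ideal_adjoin I x x.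
Proof. by move=> hI; exists 0; [apply: ideal0|exists 1; rewrite mul1r add0r]. Qed.

Lemma maximal_prime P : is_maximal_ideal P -> is_prime_ideal P.
Proof.
move=> [hP P1 Pmax]; split=> // x y Pxy.
apply: contrapT => /not_orP[Px Py].
have hJ := ideal_adjoin_ideal x hP.
have [[u Pu [c e]]|J1] := pselect (ideal_adjoin P x 1).
  apply: Py; rewrite -[y]mul1r e mulrDl -mulrA; apply: idealD => //.
    exact: ideal_mulr.
  exact: ideal_mull.
apply: Px; rewrite -(Pmax _ hJ J1 (@ideal_adjoinS P x)).
exact: ideal_adjoin_in.
Qed.

(** Maximality as invertibility of the elements outside P, modulo P. *)
Lemma maximal_idealP P : is_maximal_ideal P <->
  [/\ is_ideal P, ~ P 1 & forall x, ~ P x -> exists y, P (x * y - 1)].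
Proof.
split=> [[hP P1 Pmax]|[hP P1 Pinv]]; split=> //.
  move=> x Px.
  have hJ := ideal_adjoin_ideal x hP.
  have [[u Pu [c e]]|J1] := pselect (ideal_adjoin P x 1).
    exists c; have -> : x * c - 1 = - u by rewrite e; ring.
    exact: idealN.
  case: Px; rewrite -(Pmax _ hJ J1 (@ideal_adjoinS P x)).
  exact: ideal_adjoin_in.
move=> J hJ J1 PJ; apply/seteqP; split=> // x Jx; apply: contrapT => /Pinv[y Pxy].
apply: J1; rewrite -[1](subKr (x * y)); apply: idealB => //; first exact: ideal_mulr.
exact: PJ.
Qed.

(** If x y = 1 modulo P^n and x z = 1 modulo P, then (1 - x y)(1 - x z) is in P^(n+1). *)
Lemma maximal_inv_idealX P x n : is_maximal_ideal P -> ~ P x ->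
  exists y, idealX P n (x * y - 1).
Proof.
move=> hP Px; have /maximal_idealP[iP P1 Pinv] := hP.
elim: n => [|n [y Pn]]; first by exists 0.
have [z Pz] := Pinv x Px.
exists (y + z - x * y * z).
have -> : x * (y + z - x * y * z) - 1 = - ((x * z - 1) * (x * y - 1)) by ring.
by apply: (idealN (idealX_ideal P n.+1)); apply: idealM_in.
Qed.

End IdealArithmetic.

Section IdealPreimage.
Variables (R S : comPzRingType) (f : {rmorphism R -> S}).

Lemma ideal_preim (I : set S) : is_ideal I -> is_ideal (f @^-1` I).
Proof.
move=> hI; split=> [|x y|a x]; rewrite /= ?rmorph0 ?rmorphD ?rmorphM.
- exact: ideal0.
- exact: idealD.
- exact: ideal_mull.
Qed.

Lemma prime_preim (P : set S) : is_prime_ideal P -> is_prime_ideal (f @^-1` P).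
Proof.
move=> [hP P1 PM]; split=> [|/=|x y /=]; first exact: ideal_preim.
  by rewrite rmorph1.
by rewrite rmorphM; apply: PM.
Qed.

End IdealPreimage.

(** Noetherian induction, stated as the existence of maximal members: the union
    of a chain of ideals is finitely generated, hence equal to a member. *)
Lemma noetherian_max (R : comPzRingType) (Q : set (set R)) : noetherian R ->
  (exists I, is_ideal I /\ Q I) ->
  exists I, [/\ is_ideal I, Q I &
    forall J, is_ideal J -> Q J -> I `<=` J -> J = I].
Proof.
move=> nR [I0 [hI0 QI0]].
pose P : set (set R) := fun X => X = set0 \/ (is_ideal X /\ Q X).
have [|M [PM Mmax]] := @Zorn_bigcup R P.
  move=> F FP Ftot.
  have [F0|] := pselect (forall X, F X -> X = set0).
    by left; apply/seteqP; split=> // x [X /F0->].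
  move=> /existsNP[X0 /not_implyP[FX0 X0n]].
  have FI X : F X -> X <> set0 -> is_ideal X by move=> /FP[->//|[]].
  right.
  set U := \bigcup_(X in F) X.
  have hU : is_ideal U.
    split; first by exists X0 => //; apply: ideal0 (FI _ FX0 X0n).
      move=> x y [X FX Xx] [Y FY Yy].
      have Xn : X <> set0 by move=> e; rewrite e in Xx.
      have Yn : Y <> set0 by move=> e; rewrite e in Yy.
      have [XY|YX] := Ftot _ _ FX FY.
        by exists Y => //; apply: idealD (FI _ FY Yn) _ _ => //; apply: XY.
      by exists X => //; apply: idealD (FI _ FX Xn) _ _ => //; apply: YX.
    move=> a x [X FX Xx]; exists X => //.
    by apply: ideal_mull => //; apply: FI => // e; rewrite e in Xx.
  have [n [b Ub]] := nR U hU.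
  have bU i : U (b i) by rewrite Ub; apply: ideal_genS; exists i.
  suff [X FX [Xn bX]] : exists2 X, F X & X <> set0 /\ forall i, X (b i).
    have -> : U = X.
      apply/seteqP; split=> [|x Xx]; last by exists X.
      by rewrite Ub; apply: ideal_gen_sub; [exact: FI|move=> _ [i _ <-]].
    by case: (FP _ FX).
  suff [X FX [Xn bX]] : exists2 X, F X & X <> set0 /\ forall i, i \in enum 'I_n -> X (b i).
    by exists X => //; split=> // i; apply: bX; rewrite mem_enum.
  elim: (enum _) => [|i s [X FX [Xn bX]]]; first by exists X0.
  have [Y FY Yi] := bU i.
  have [XY|YX] := Ftot _ _ FX FY.
    exists Y => //; split=> [e|j]; first by rewrite e in Yi.
    by rewrite inE => /orP[/eqP->//|/bX/XY].
  exists X => //; split=> // j.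
  by rewrite inE => /orP[/eqP->|/bX//]; apply: YX.
have Mn : M <> set0.
  move=> M0; have := Mmax I0; rewrite M0 => h; apply: h; last by right.
  split=> [x []|/(_ 0 (ideal0 hI0)) []//].
have [//|[hM QM]] := PM; exists M; split=> // J hJ QJ MJ.
apply: contrapT => JM; apply: (Mmax J); last by right.
by split=> [//|JM']; apply: JM; apply/seteqP.
Qed.

Lemma noetherian_maximal_ideal (R : comPzRingType) (I : set R) : noetherian R ->
  is_ideal I -> ~ I 1 -> exists2 P, is_maximal_ideal P & I `<=` P.
Proof.
move=> nR hI I1.
have [|M [hM [M1 IM] Mmax]] := @noetherian_max R [set J | ~ J 1 /\ I `<=` J] nR.
  by exists I; split=> //; split.
exists M => //; split=> // J hJ J1 MJ; apply: Mmax => //; split=> // x /IM; exact: MJ.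
Qed.

(** * Rings in which nonzero ideals factor into primes *)

Section InvertibleIdeals.
Variable D : comNzRingType.
Implicit Types (I J K P Q : set D) (x y z : D).
Hypothesis domD : forall x y, x * y = 0 -> x = 0 \/ y = 0.

(** Fractional ideals are avoided: an ideal is invertible when it divides a
    nonzero principal ideal. *)
Definition invertible I := exists J x,
  [/\ is_ideal J, x <> 0 & idealM I J = ideal_gen [set x]].

Lemma domain_mulI x y z : x <> 0 -> x * y = x * z -> y = z.
Proof.
move=> x0 e; have /domD[//|] : x * (y - z) = 0 by rewrite mulrBr e subrr.
by move/eqP; rewrite subr_eq0 => /eqP.
Qed.

Lemma principal_mul_sub x I J : x <> 0 -> is_ideal I -> is_ideal J ->
  idealM (ideal_gen [set x]) I `<=` idealM (ideal_gen [set x]) J -> I `<=` J.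
Proof.
move=> x0 hI hJ IJ y Iy.
have /IJ/(idealM_gen1 _ _ hJ)[z Jz] : idealM (ideal_gen [set x]) I (x * y).
  by apply/idealM_gen1 => //; exists y.
by move=> /(domain_mulI x0) ->.
Qed.

Lemma principal_neq0 x : x <> 0 -> ideal_gen [set x] <> [set 0].
Proof. by move=> x0 /ideal_gen_eq0 h; apply: x0; apply: h. Qed.

Lemma invertible_mul_sub I J K : invertible I -> is_ideal J -> is_ideal K ->
  idealM I J `<=` idealM I K -> J `<=` K.
Proof.
move=> [I' [x [hI' x0 e]]] hJ hK JK.
apply: (principal_mul_sub x0 hJ hK).
rewrite -e [idealM I I']idealMC -!idealMA; exact: idealMS.
Qed.

Lemma invertible_mulI I J K : invertible I -> is_ideal J -> is_ideal K ->
  idealM I J = idealM I K -> J = K.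
Proof.
move=> hI hJ hK e; apply/seteqP.
by split; apply: (invertible_mul_sub hI) => //; rewrite e.
Qed.

Lemma invertible_neq0 I : invertible I -> I <> [set 0].
Proof.
move=> [J [x [hJ x0 e]]] I0; apply: (principal_neq0 x0); rewrite -e I0.
apply/seteqP; split; first by apply: idealM_subl; apply: zero_ideal.
by move=> _ ->; apply: ideal0; apply: idealM_ideal.
Qed.

Lemma invertibleT : invertible setT.
Proof.
exists setT, 1; split; [exact: setT_ideal|exact/eqP/oner_neq0|].
by rewrite idealT_mul ?ideal_gen1.
Qed.

Lemma invertible_principal x : x <> 0 -> invertible (ideal_gen [set x]).
Proof.
move=> x0; exists setT, x; split=> //.
by rewrite idealM_T//; apply: ideal_gen_ideal.
Qed.

Lemma invertibleM I J : invertible I -> invertible J -> invertible (idealM I J).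
Proof.
move=> [I' [x [hI' x0 eI]]] [J' [y [hJ' y0 eJ]]].
exists (idealM I' J'), (x * y); split; [exact: idealM_ideal|by move=> /domD[]|].
by rewrite -idealMA (idealMCA J) idealMA eI eJ ideal_gen1M.
Qed.

Lemma invertible_prod (s : seq (set D)) :
  (forall P, P \in s -> invertible P) -> invertible (ideal_prod s).
Proof.
elim: s => [|P s IHs] hs /=; first exact: invertibleT.
apply: invertibleM; first by apply: hs; rewrite mem_head.
by apply: IHs => Q Qs; apply: hs; rewrite inE Qs orbT.
Qed.

(** To contain is to divide. *)
Lemma invertible_dvd I J : invertible J -> is_ideal I -> I `<=` J ->
  exists2 Q, is_ideal Q & I = idealM J Q.
Proof.
move=> [J' [x [hJ' x0 e]]] hI IJ.
pose Q := [set z | idealM I J' (x * z)].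
have hQ : is_ideal Q := ideal_colon _ (idealM_ideal I J').
exists Q => //.
have eQ : idealM (ideal_gen [set x]) Q = idealM I J'.
  apply/seteqP; split=> [_ /(idealM_gen1 _ _ hQ)[z Qz ->]//|y Iy].
  have : idealM J J' y by move: Iy; apply: idealMS.
  rewrite e => /ideal_gen1P[c ey].
  by apply/idealM_gen1 => //; exists c; rewrite /Q /= mulrC -?ey.
apply: (@invertible_mulI (ideal_gen [set x])) => //.
- exact: invertible_principal.
- exact: idealM_ideal.
by rewrite idealMCA eQ idealMCA e idealMC.
Qed.

End InvertibleIdeals.

(** The last clause is integral closedness: a quotient y / x of elements of D
    which multiplies a nonzero finitely generated ideal into itself is in D. *)
Definition dedekind_domain (D : comNzRingType) :=
  [/\ (forall x y : D, x * y = 0 -> x = 0 \/ y = 0), noetherian D,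
      (forall P : set D, is_prime_ideal P -> P <> [set 0] -> is_maximal_ideal P)
    & forall (x y : D) I, x <> 0 -> is_ideal I -> I <> [set 0] ->
      (forall z, I z -> exists2 w, I w & y * z = x * w) -> exists d, y = x * d].

Section Factorization.
Variable D : comNzRingType.
Hypothesis dedD : dedekind_domain D.
Implicit Types (I J K P Q : set D) (a c x y z : D) (s : seq (set D)).

Let domD : forall x y, x * y = 0 -> x = 0 \/ y = 0. Proof. by case: dedD. Qed.
Let noethD : noetherian D. Proof. by case: dedD. Qed.
Let dimD P : is_prime_ideal P -> P <> [set 0] -> is_maximal_ideal P.
Proof. by case: dedD => _ _ + _; apply. Qed.

Definition nonzero_primes s :=
  forall Q, Q \in s -> is_prime_ideal Q /\ Q <> [set 0].

Lemma nonzero_primes_cat s s' :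
  nonzero_primes s -> nonzero_primes s' -> nonzero_primes (s ++ s').
Proof. by move=> hs hs' Q; rewrite mem_cat => /orP[/hs|/hs']. Qed.

Lemma nonzero_primes_rem s P : nonzero_primes s -> nonzero_primes (rem P s).
Proof. by move=> hs Q /mem_rem; apply: hs. Qed.

Lemma nonzero_primes_cons s P : is_prime_ideal P -> P <> [set 0] ->
  nonzero_primes s -> nonzero_primes (P :: s).
Proof. by move=> hP P0 hs Q; rewrite inE => /orP[/eqP->|/hs]. Qed.

Lemma prime_eq P Q : is_prime_ideal P -> P <> [set 0] -> is_prime_ideal Q ->
  P `<=` Q -> P = Q.
Proof.
move=> hP P0 hQ PQ; have [_ _ Pmax] := dimD hP P0.
by apply/esym/Pmax => //; case: hQ.
Qed.

Lemma prime_mem_prod s P : nonzero_primes s -> is_prime_ideal P ->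
  ideal_prod s `<=` P -> P \in s.
Proof.
move=> hs hP /(prime_prod_sub hP)[Q Qs QP].
by have [hQ Q0] := hs Q Qs; rewrite -(prime_eq hQ Q0 hP QP).
Qed.

(** A maximal counterexample M is not prime; for x y in M with neither factor in M,
    the product of M + (x) and M + (y) is contained in M. *)
Lemma nonzero_ideal_prod_sub I : is_ideal I -> I <> [set 0] ->
  exists2 s, nonzero_primes s & ideal_prod s `<=` I.
Proof.
move=> hI I0; apply: contrapT => nI.
pose bad := [set J : set D | J <> [set 0] /\
  ~ exists2 s, nonzero_primes s & ideal_prod s `<=` J].
have [|M [hM [M0 nM] Mmax]] := @noetherian_max D bad noethD.
  by exists I; split.
have M1 : ~ M 1.
  by move=> /(idealT_eq hM) MT; apply: nM; exists [::]; rewrite // MT.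
have [hP|nP] := pselect (is_prime_ideal M).
  apply: nM; exists [:: M]; last by rewrite /= idealM_T.
  by move=> Q; rewrite inE => /eqP->.
apply: nP; split=> // x y Mxy; apply: contrapT => /not_orP[Mx My].
have key z : ~ M z ->
    exists2 s, nonzero_primes s & ideal_prod s `<=` ideal_adjoin M z.
  move=> Mz; apply: contrapT => h; apply: Mz.
  rewrite -(Mmax (ideal_adjoin M z)); first exact: ideal_adjoin_in.
  - exact: ideal_adjoin_ideal.
  - split=> // e; apply: M0; apply/seteqP; split=> [w Mw|_ ->]; last exact: ideal0.
    by rewrite -e; apply: ideal_adjoinS.
  - exact: ideal_adjoinS.
have [[s hs sx] [s' hs' sy]] := (key x Mx, key y My).
apply: nM; exists (s ++ s'); first exact: nonzero_primes_cat.
rewrite ideal_prod_cat; apply: idealM_sub => // _ _ /sx[u Mu [c ->]] /sy[v Mv [d ->]].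
have -> : (u + c * x) * (v + d * y) = u * (v + d * y) + (c * x) * v + (c * d) * (x * y).
  by ring.
apply: idealD => //; last exact: ideal_mull.
apply: idealD => //.   exact: ideal_mulr.
exact: ideal_mull.
Qed.

(** In a shortest product of nonzero primes contained in (x), with x in P, one of the
    factors is P, so some y outside (x) satisfies y P <= (x). Let J be the ideal of all
    the y with y P <= (x). If P J were not (x), it would be x P by maximality, so that y / x would
    multiply P into itself and be in D by integral closedness. *)
Lemma prime_invertible P : is_prime_ideal P -> P <> [set 0] -> invertible P.
Proof.
move=> hP P0; have iP := prime_ideal hP.
have [x Px /eqP x0] := ideal_neq0 iP P0.
have [s hs sx] :=
  nonzero_ideal_prod_sub (ideal_gen_ideal [set x]) (principal_neq0 x0).
have xP : ideal_gen [set x] `<=` P by apply: ideal_gen_sub => // _ ->.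
have [Q [PQ Qx]] : exists Q : set D, idealM P Q `<=` ideal_gen [set x] /\
    ~ Q `<=` ideal_gen [set x].
  elim: (size s) {-2}s (leqnn (size s)) hs sx => {s} [|n IHn] s.
    rewrite leqn0 => /nilP -> _ /= sx; case: (prime_not1 hP).
    by apply: xP; apply: sx.
  move=> sn hs sx.
  have Ps : P \in s by apply: prime_mem_prod => //; apply: subset_trans sx xP.
  have [rx|rx] := pselect (ideal_prod (rem P s) `<=` ideal_gen [set x]).
    apply: IHn rx; last exact: nonzero_primes_rem.
    by rewrite size_rem// -ltnS prednK//; case: (s) Ps.
  by exists (ideal_prod (rem P s)); rewrite -ideal_prod_rem.
have /existsNP[y /not_implyP[Qy ny]] := Qx.
have hx := ideal_gen_ideal [set x].
pose J := [set z | forall p, P p -> ideal_gen [set x] (p * z)].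
have Jx : J x by move=> p Pp; apply/ideal_gen1P; exists p.
have Jy : J y by move=> p Pp; apply: PQ; apply: idealM_in.
have hJ : is_ideal J.
  split=> [p Pp|z w Jz Jw p Pp|a z Jz p Pp].
  - by rewrite mulr0; apply: (ideal0 hx).
  - by rewrite mulrDr; apply: (idealD hx); [apply: Jz|apply: Jw].
  - by rewrite mulrCA; apply: (ideal_mull _ hx); apply: Jz.
pose I0 := [set d | idealM P J (x * d)].
have hI0 : is_ideal I0 := ideal_colon _ (idealM_ideal P J).
have PI0 : P `<=` I0 by move=> d Pd; rewrite /I0 /= mulrC; apply: idealM_in.
have [|I01] := pselect (I0 1).
  rewrite /I0 /= mulr1 => PJx; exists J, x; split=> //; apply/seteqP; split.
    by apply: idealM_sub => // p z Pp; apply.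
  by apply: ideal_gen_sub => [|_ ->//]; apply: idealM_ideal.
have [_ _ Pmax] := dimD hP P0.
have eP := Pmax I0 hI0 I01 PI0.
case: ny; have [_ _ _ icD] := dedD.
have [z Pz|d ->] := icD x y P x0 iP P0; last by apply/ideal_gen1P; exists d; rewrite mulrC.
have /ideal_gen1P[w e] := Jy z Pz; exists w; last by rewrite mulrC e mulrC.
by rewrite -eP /I0 /= mulrC -e; apply: idealM_in.
Qed.

(** A maximal counterexample M is divisible by a maximal ideal P, and then the
    quotient Q contains M. *)
Lemma ideal_factor I : is_ideal I -> I <> [set 0] ->
  exists2 s, nonzero_primes s & I = ideal_prod s.
Proof.
move=> hI I0; apply: contrapT => nI.
pose bad := [set J : set D | J <> [set 0] /\
  ~ exists2 s, nonzero_primes s & J = ideal_prod s].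
have [|M [hM [M0 nM] Mmax]] := @noetherian_max D bad noethD.
  by exists I; split.
have M1 : ~ M 1 by move=> /(idealT_eq hM) MT; apply: nM; exists [::].
have [P mP MP] := noetherian_maximal_ideal noethD hM M1.
have hP := maximal_prime mP.
have P0 : P <> [set 0].
  move=> e; apply: M0; apply/seteqP; split=> [x /MP|_ ->]; first by rewrite e.
  exact: ideal0.
have [Q hQ eM] := invertible_dvd domD (prime_invertible hP P0) hM MP.
have MQ : M `<=` Q by rewrite eM; apply: idealM_subr.
have Q0 : Q <> [set 0].
  move=> e; apply: M0; apply/seteqP; split=> [x /MQ|_ ->]; first by rewrite e.
  exact: ideal0.
have [[s hs es]|nQ] := pselect (exists2 s, nonzero_primes s & Q = ideal_prod s).
  apply: nM; exists (P :: s); last by rewrite eM es.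
  exact: nonzero_primes_cons.
(* Otherwise M = P M, so that the inverse of P multiplies M into itself. *)
have eQ := Mmax Q hQ (conj Q0 nQ) MQ.
have [P' [x [hP' x0 ePP]]] := prime_invertible hP P0.
have P'x : P' `<=` ideal_gen [set x].
  move=> y P'y; have [_ _ _ icD] := dedD.
  have [z Mz|d ->] := icD x y M x0 hM M0; last first.
    by apply/ideal_gen1P; exists d; rewrite mulrC.
  have : idealM (ideal_gen [set x]) M (y * z).
    by rewrite -ePP (idealMC P) -idealMA -{1}eQ -eM; apply: idealM_in.
  by move/(idealM_gen1 _ _ hM).
have : idealM (ideal_gen [set x]) P x.
  rewrite idealMC; have : idealM P P' x by rewrite ePP; apply: ideal_genS.
  exact: idealMS.
move=> /(idealM_gen1 _ _ (prime_ideal hP))[d Pd].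
rewrite -{1}[x]mulr1 => /(domain_mulI domD x0) e.
by apply: (prime_not1 hP); rewrite e.
Qed.

Lemma factor_unique s s' : nonzero_primes s -> nonzero_primes s' ->
  ideal_prod s = ideal_prod s' -> perm_eq s s'.
Proof.
elim: s s' => [|P s IHs] s' hs hs' e.
  case: s' hs' e => // P s' hs' /= e.
  have [hP _] := hs' P (mem_head _ _); case: (prime_not1 hP).
  have : idealM P (ideal_prod s') 1 by rewrite -e.
  exact: idealM_subl (prime_ideal hP) _.
have [hP P0] := hs P (mem_head _ _).
have Ps' : P \in s'.
  by apply: prime_mem_prod => //; rewrite -e; apply: idealM_subl; apply: prime_ideal.
rewrite perm_sym (perm_trans (perm_to_rem Ps'))// perm_cons perm_sym.
apply: IHs.
- by move=> Q Qs; apply: hs; rewrite inE Qs orbT.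
- exact: nonzero_primes_rem.
apply: (invertible_mulI domD (prime_invertible hP P0)); try exact: ideal_prod_ideal.
by rewrite -ideal_prod_rem.
Qed.

Lemma ideal_exp_prod s P : nonzero_primes s ->
  ideal_exp (ideal_prod s) P = count_mem P s.
Proof.
move=> hs.
have inv : invertible (ideal_prod s).
  by apply: (invertible_prod domD) => Q /hs[]; apply: prime_invertible.
rewrite /ideal_exp; case: xgetP => [n _ [s' [hs' e <-]]|].
  suff hs0 : nonzero_primes s' by apply/permP; apply: factor_unique.
  move=> Q Qs; split; first exact: hs'.
  move=> Q0; apply: (invertible_neq0 inv); rewrite -e (ideal_prod_rem Qs) Q0.
  apply/seteqP; split; first by apply: idealM_subl; apply: zero_ideal.
  by move=> _ ->; apply: ideal0; apply: idealM_ideal.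
move=> /(_ (count_mem P s)) []; exists s; split=> //.
by move=> Q /hs[].
Qed.

Variable P : set D.
Hypotheses (hP : is_prime_ideal P) (P0 : P <> [set 0]).
Let iP := prime_ideal hP.
Let invP := prime_invertible hP P0.

Definition prime_val x : nat := ideal_exp (ideal_gen [set x]) P.

Lemma prime_valP x : x <> 0 -> exists s, [/\ nonzero_primes s,
  ideal_gen [set x] = ideal_prod s & prime_val x = count_mem P s].
Proof.
move=> x0.
have [s hs e] := ideal_factor (ideal_gen_ideal [set x]) (principal_neq0 x0).
by exists s; split; rewrite // /prime_val e ideal_exp_prod.
Qed.

Lemma prime_valM x y : x <> 0 -> y <> 0 ->
  prime_val (x * y) = (prime_val x + prime_val y)%N.
Proof.
move=> x0 y0; have [s [hs es ->]] := prime_valP x0.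
have [s' [hs' es' ->]] := prime_valP y0.
rewrite /prime_val -ideal_gen1M es es' -ideal_prod_cat ideal_exp_prod ?count_cat//.
exact: nonzero_primes_cat.
Qed.

Let primes_nseq k : nonzero_primes (nseq k P).
Proof. by move=> Q /nseqP[->]. Qed.

Lemma prime_valX k x : x <> 0 -> (k <= prime_val x)%N <-> idealX P k x.
Proof.
move=> x0; rewrite idealXE; split=> [|Px].
  have [s [hs es ->]] := prime_valP x0 => le_k.
  suff : ideal_gen [set x] `<=` ideal_prod (nseq k P) by apply; apply: ideal_genS.
  rewrite es; elim: k s {hs es} le_k => [//|k IHk] s le_k.
  have Ps : P \in s by rewrite -has_pred1 has_count (leq_trans _ le_k).
  rewrite (ideal_prod_rem Ps); apply: idealMS => //; apply: IHk.
  by rewrite count_rem Ps /= eqxx; case: (count _ _) le_k => // n; rewrite ltnS subn1.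
have invk : invertible (ideal_prod (nseq k P)).
  by apply: (invertible_prod domD) => Q /nseqP[->].
have [|Q hQ e] := invertible_dvd domD invk (ideal_gen_ideal [set x]).
  by apply: ideal_gen_sub => [|_ ->//]; apply: ideal_prod_ideal.
have Q0 : Q <> [set 0].
  move=> Q0; apply: (principal_neq0 x0); rewrite e Q0.
  apply/seteqP; split; first by apply: idealM_subr; apply: zero_ideal.
  by move=> _ ->; apply: ideal0; apply: idealM_ideal.
have [s hs es] := ideal_factor hQ Q0.
rewrite /prime_val e es -ideal_prod_cat ideal_exp_prod; last exact: nonzero_primes_cat.
by rewrite count_cat count_nseq /= eqxx mul1n leq_addr.
Qed.

Lemma prime_val_gt0 x : x <> 0 -> (0 < prime_val x)%N <-> P x.
Proof. by move=> x0; rewrite prime_valX// idealX1. Qed.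

Lemma prime_uniformizer : exists pi, [/\ P pi, pi <> 0 & prime_val pi = 1%N].
Proof.
have [pi /not_implyP[Ppi nPpi]] : exists pi, ~ (P pi -> idealX P 2 pi).
  apply: contrapT => /forallNP h.
  have PP : P `<=` idealM P P.
    by move=> x Px; have /contrapT/(_ Px) := h x; rewrite /= idealM_T.
  apply: (prime_not1 hP).
  apply: (invertible_mul_sub domD invP (@setT_ideal D) iP _ (I : setT 1)).
  by rewrite idealM_T.
have pi0 : pi <> 0 by move=> e; apply: nPpi; rewrite e; apply: ideal0; apply: idealX_ideal.
exists pi; split=> //; apply/eqP; rewrite eqn_leq; apply/andP; split.
  by rewrite leqNgt; apply/negP => /(prime_valX _ pi0).
exact/prime_val_gt0.
Qed.

(** An element whose valuation at P is at least that of y is a multiple of y up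
    to an element outside P: take it in the part of (y) prime to P. *)
Lemma prime_val_dvd x y : x <> 0 -> y <> 0 -> (prime_val y <= prime_val x)%N ->
  exists a c, ~ P a /\ a * x = c * y.
Proof.
move=> x0 y0; have [t [ht et vy]] := prime_valP y0; rewrite vy => le_yx.
pose u := [seq Q <- t | Q != P].
have hu : nonzero_primes u by move=> Q; rewrite mem_filter => /andP[_ /ht].
have eu : ideal_gen [set y] = idealM (idealX P (prime_val y)) (ideal_prod u).
  rewrite et idealXE -ideal_prod_cat vy.
  elim: (t) @u {ht et vy le_yx hu} => [|Q r IHr] //=; case: eqVneq => [->|_] /=.
    by rewrite IHr.
  by rewrite IHr !ideal_prod_cat /= idealMCA.
have [s us Ps] : exists2 s, ideal_prod u s & ~ P s.
  apply: contrapT => h.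
  suff : P \in u by rewrite mem_filter eqxx.
  by apply: prime_mem_prod => // s us; apply: contrapT => Ps; apply: h; exists s.
suff /ideal_gen1P[c e] : ideal_gen [set y] (s * x) by exists s, c.
rewrite eu idealMC; apply: idealM_in => //; apply/prime_valX => //.
by rewrite vy.
Qed.

End Factorization.

(** * Integral closedness and the valuation of a nonzero prime *)

(** The determinant trick: an element of F which multiplies the ideal generated
    by the b i into itself is an eigenvalue of a matrix over D. *)
Lemma integral_of_stable_ideal (D : comNzRingType) (F : fieldType)
    (h : {rmorphism D -> F}) (x y : D) n (b : 'I_n -> D) (i0 : 'I_n) :
  h x != 0 -> h (b i0) != 0 ->
  (forall i, exists2 w, ideal_gen (range b) w & y * b i = x * w) ->
  integralOver h (h y / h x).
Proof.
move=> hx0 hb0 hyb.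
have /choice[M hM] : forall i, exists M : 'I_n -> D,
    y * b i = x * \sum_j M j * b j.
  move=> i; by have [w /ideal_gen_rangeP[c ->] e] := hyb i; exists c.
pose N : 'M[D]_n := \matrix_(i, j) M j i.
exists (char_poly N); first exact: char_poly_monic.
rewrite map_char_poly -eigenvalue_root_char; apply/eigenvalueP.
exists (\row_j h (b j)); last first.
  by apply/eqP => /rowP/(_ i0); rewrite !mxE => /eqP; apply/negP.
apply/rowP => i; rewrite !mxE.
apply: (mulfI hx0); rewrite mulrA mulrCA divff// mulr1 -rmorphM hM rmorphM rmorph_sum.
by congr (_ * _); apply: eq_bigr => j _; rewrite !mxE rmorphM mulrC.
Qed.

Section FractionField.
Variable A : idomainType.
Local Notation K := {fraction A}.
Local Notation "a %:F" := (@FracField.tofrac A a).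
Implicit Types (a b s : A) (x y : K).

Lemma frac_repr x : x = (\n_(repr x))%:F / (\d_(repr x))%:F.
Proof.
have d0 : (\d_(repr x))%:F != 0 by rewrite tofrac_eq0 denom_ratioP.
apply: (mulIf d0); rewrite mulfVK//.
rewrite -{1}[x]reprK -[LHS]/(FracField.mul _ _) !piE.
apply/eqmodP; rewrite /= FracField.equivfE /FracField.mulf.
rewrite !numden_Ratio ?mulf_neq0 ?denom_ratioP//; try exact: oner_neq0.
by rewrite !mulr1 mulrC.
Qed.

Lemma fracP x : exists a b, b != 0 /\ x = a%:F / b%:F.
Proof. by eexists _, _; split; [apply: denom_ratioP|apply: frac_repr]. Qed.

Lemma common_denominator n (c : 'I_n -> K) :
  exists2 d, d != 0 & exists a : 'I_n -> A, forall i, c i = (a i)%:F / d%:F.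
Proof.
have /choice[f hf] : forall i, exists z : A * A,
    z.2 != 0 /\ c i = z.1%:F / z.2%:F.
  move=> i; by have [a [b h]] := fracP (c i); exists (a, b).
exists (\prod_i (f i).2); first by apply/prodf_neq0 => i _; case: (hf i).
exists (fun i => (f i).1 * \prod_(j | j != i) (f j).2) => i; have [f0 ->] := hf i.
have -> : \prod_j (f j).2 = (f i).2 * \prod_(j | j != i) (f j).2 by rewrite (bigD1 i).
rewrite !tofracM -mulf_div divff ?mulr1//.
by rewrite tofrac_eq0; apply/prodf_neq0 => j _; case: (hf j).
Qed.

Lemma dedekindW : dedekind A -> dedekind_domain A.
Proof.
move=> [nA icA dimA]; split=> //.
- by move=> x y /eqP; rewrite mulf_eq0 => /orP[]/eqP; [left|right].
- by move=> P hP; exact: (dimA (Spec hP)).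
move=> x y I x0 hI I0 hyI.
have [n [b eI]] := nA I hI.
have bI i : I (b i) by rewrite eI; apply: ideal_genS; exists i.
have [i0 bi0] : exists i0, b i0 != 0.
  apply: contrapT => /forallNP h; have [z + /eqP z0] := ideal_neq0 hI I0.
  rewrite eI => /ideal_gen_rangeP[c ez]; apply: z0.
  rewrite ez big1// => i _; have := h i; move/negP; rewrite negbK => /eqP ->.
  by rewrite mulr0.
have /icA[d e] : integralOver (@FracField.tofrac A) (y%:F / x%:F).
  apply: (@integral_of_stable_ideal _ _ _ x y n b i0); rewrite ?tofrac_eq0//.
    exact/eqP.
  by move=> i; rewrite -eI; apply: hyI.
exists d; apply/eqP; rewrite -tofrac_eq tofracM -e mulrC divfK//.
by rewrite tofrac_eq0; apply/eqP.
Qed.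

End FractionField.

Section Valuation.
Variable A : idomainType.
Hypothesis hA : dedekind A.
Variable p : spec A.
Hypothesis p0 : spec_set p <> [set 0].
Local Notation K := {fraction A}.
Local Notation "a %:F" := (@FracField.tofrac A a).
Implicit Types (a b s : A) (x y : K) (k : int).

Let dedA := dedekindW hA.
Let hp := specP p.
Let ip := prime_ideal hp.

Lemma spec_maximal : is_maximal_ideal p.
Proof. by have [_ _] := hA; apply. Qed.

Local Notation v := (prime_val (spec_set p)).
Local Notation w := (padic_val p).

Lemma padic_valE a b : a != 0 -> b != 0 ->
  w (a%:F / b%:F) = (v a)%:Z - (v b)%:Z.
Proof.
move=> /eqP a0 /eqP b0; rewrite /padic_val -!/(prime_val _ _).
set x := a%:F / b%:F; set n := \n_(repr x); set d := \d_(repr x).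
have /eqP d0 : d != 0 := denom_ratioP _.
have d0' : d%:F != 0 by rewrite tofrac_eq0; apply/eqP.
have b0' : b%:F != 0 by rewrite tofrac_eq0; apply/eqP.
have e : a * d = n * b.
  apply/eqP; rewrite -tofrac_eq !tofracM; apply/eqP.
  by have := frac_repr x; rewrite /x -/x => /eqP; rewrite eqr_div// => /eqP.
have n0 : n <> 0.
  by move=> n0; have /eqP := e; rewrite n0 mul0r mulf_eq0 => /orP[]/eqP.
have := congr1 v e; rewrite !(prime_valM dedA)//; lia.
Qed.

Lemma padic_val_tofrac a : a != 0 -> w a%:F = (v a)%:Z.
Proof.
move=> a0; rewrite -[a%:F]divr1 -tofrac1 padic_valE ?oner_neq0//.
suff -> : v 1 = 0%N by rewrite subr0.
have n1 : (1 : A) <> 0 by apply/eqP; apply: oner_neq0.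
have := prime_valM dedA p n1 n1; rewrite mulr1 => /esym/eqP.
by rewrite -[X in _ == X]addn0 eqn_add2l => /eqP.
Qed.

Lemma padic_valM x y : x != 0 -> y != 0 -> w (x * y) = w x + w y.
Proof.
have [[a [b [b0 ->]]] [c [d [d0 ->]]]] := (fracP x, fracP y).
rewrite !mulf_eq0 !invr_eq0 !tofrac_eq0 (negbTE b0) (negbTE d0) !orbF => a0 c0.
rewrite mulf_div -!tofracM !padic_valE ?mulf_neq0//.
by rewrite !(prime_valM dedA); [lia|exact/eqP..].
Qed.

(** The k-th power of the maximal ideal of the valuation ring of p, for k in Z. *)
Definition vset k : set K := [set x | x = 0 \/ k <= w x].

Lemma vset_neq0 k x : x != 0 -> vset k x <-> k <= w x.
Proof. by move=> x0; split=> [[e|//]|]; [rewrite e eqxx in x0|right]. Qed.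

Lemma vset0 k : vset k 0. Proof. by left. Qed.

Lemma vsetM j k x y : vset j x -> vset k y -> vset (j + k) (x * y).
Proof.
have [->|x0] := eqVneq x 0; first by rewrite mul0r => *; apply: vset0.
have [->|y0] := eqVneq y 0; first by rewrite mulr0 => *; apply: vset0.
move=> /(vset_neq0 _ x0) jx /(vset_neq0 _ y0) ky; right; rewrite padic_valM//.
exact: lerD.
Qed.

Lemma vset_le j k x : j <= k -> vset k x -> vset j x.
Proof. by move=> jk [->|kx]; [left|right; apply: le_trans kx]. Qed.

Lemma vset_tofrac (k : nat) a : vset k a%:F <-> idealX p k a.
Proof.
have [->|a0] := eqVneq a 0.
  by split=> _; [apply: ideal0; apply: idealX_ideal|left; rewrite tofrac0].
rewrite vset_neq0 ?tofrac_eq0// padic_val_tofrac// lez_nat.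
by apply: prime_valX => //; apply/eqP.
Qed.

Lemma vset0_tofrac a : vset 0 a%:F. Proof. exact/(vset_tofrac 0). Qed.

Lemma vset1_tofrac a : vset 1 a%:F <-> spec_set p a.
Proof. by rewrite (vset_tofrac 1) idealX1. Qed.

Lemma denom_neq0 s : ~ spec_set p s -> s != 0.
Proof. by move=> ps; apply/eqP => s0; apply: ps; rewrite s0; apply: ideal0. Qed.

Lemma padic_val_unit s : ~ spec_set p s -> w s%:F = 0.
Proof.
move=> ps; have s0 := denom_neq0 ps; rewrite padic_val_tofrac//.
apply/eqP; rewrite eqz_nat -leqn0 leqNgt; apply/negP => /prime_val_gt0 h; apply: ps.
by apply: h => //; apply/eqP.
Qed.

(** The valuation ring is the localization of A at p. *)
Lemma vset0P x : vset 0 x <-> exists a s, ~ spec_set p s /\ x = a%:F / s%:F.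
Proof.
split=> [|[a [s [ps ->]]]]; last first.
  have [->|a0] := eqVneq a 0; first by left; rewrite tofrac0 mul0r.
  have s0 := denom_neq0 ps; right; rewrite padic_valE//.
  by have := padic_val_unit ps; rewrite padic_val_tofrac// => ->; rewrite subr0.
have [-> _|x0] := eqVneq x 0.
  by exists 0, 1; split; [case: hp|rewrite tofrac0 mul0r].
move=> /(vset_neq0 _ x0); have [a [b [b0 ex]]] := fracP x.
have a0 : a != 0 by move: x0; rewrite ex mulf_eq0 tofrac_eq0 negb_or => /andP[].
rewrite ex padic_valE// subr_ge0 lez_nat => le_ba.
have [s [c [ps e]]] := prime_val_dvd dedA hp p0 (elimN eqP a0) (elimN eqP b0) le_ba.
have s0 := denom_neq0 ps.
exists c, s; split=> //; apply/eqP; rewrite eqr_div ?tofrac_eq0//.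
by rewrite -!tofracM (mulrC a) e.
Qed.

Definition uniformizer : A :=
  xget 0 [set a | [/\ spec_set p a, a <> 0 & v a = 1%N]].
Local Notation pi := uniformizer.

Let piP : [/\ spec_set p pi, pi <> 0 & v pi = 1%N].
Proof.
rewrite /uniformizer; case: xgetP => [a _ //|].
have [a ha] := prime_uniformizer dedA hp p0.
by move/(_ a).
Qed.

Lemma uniformizer_in : spec_set p pi. Proof. by case: piP. Qed.
Lemma uniformizer_neq0 : pi%:F != 0.
Proof. by rewrite tofrac_eq0; apply/eqP; case: piP. Qed.
Lemma padic_val_uniformizer : w pi%:F = 1.
Proof. by rewrite padic_val_tofrac; case: piP => // _ /eqP// _ ->. Qed.

Definition pi_exp k : K := pi%:F ^ k.

Lemma pi_exp_neq0 k : pi_exp k != 0.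
Proof. by rewrite /pi_exp expfz_neq0// uniformizer_neq0. Qed.

Lemma pi_expD j k : pi_exp (j + k) = pi_exp j * pi_exp k.
Proof. by rewrite /pi_exp expfzDr// uniformizer_neq0. Qed.

Lemma pi_expN k : pi_exp (- k) = (pi_exp k)^-1.
Proof. by rewrite /pi_exp -invr_expz. Qed.

Lemma pi_exp0 : pi_exp 0 = 1. Proof. by []. Qed.

Lemma padic_val_pi_exp k : w (pi_exp k) = k.
Proof.
have pos (n : nat) : w (pi_exp n) = n.
  elim: n => [|n IHn]; first by rewrite pi_exp0 -tofrac1 padic_val_unit//; case: hp.
  rewrite -addn1 PoszD pi_expD padic_valM ?pi_exp_neq0// IHn.
  by rewrite [pi_exp 1]expr1z padic_val_uniformizer.
case: k => n; first exact: pos.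
have := padic_valM (pi_exp_neq0 n.+1) (pi_exp_neq0 (Negz n)).
rewrite pos -pi_expD NegzE subrr pi_exp0 -(pi_exp0) pos; lia.
Qed.

Lemma vset_pi_exp k : vset k (pi_exp k).
Proof. by right; rewrite padic_val_pi_exp. Qed.

Lemma vsetE j k x : vset (j + k) x <-> vset k (pi_exp (- j) * x).
Proof.
split=> [h|h].
  have := vsetM (vset_pi_exp (- j)) h.
  by rewrite addrA addNr add0r.
have := vsetM (vset_pi_exp j) h.
by rewrite mulrA -pi_expD subrr pi_exp0 mul1r.
Qed.

Lemma vsetD k x y : vset k x -> vset k y -> vset k (x + y).
Proof.
rewrite -[k]addr0 !vsetE mulrDr.
move=> /vset0P[a [s [ps ->]]] /vset0P[b [t [pt ->]]]; apply/vset0P.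
exists (a * t + b * s), (s * t); split; first by case: hp => _ _ h /h[].
by rewrite addf_div ?tofrac_eq0; [rewrite tofracD !tofracM|exact: denom_neq0..].
Qed.

Lemma vsetN k x : vset k x -> vset k (- x).
Proof.
move=> h; rewrite -mulN1r -[k]add0r; apply: vsetM => //.
by rewrite -tofrac1 -tofracN; apply: vset0_tofrac.
Qed.

Lemma vsetB k x y : vset k x -> vset k y -> vset k (x - y).
Proof. by move=> hx hy; apply: vsetD => //; apply: vsetN. Qed.

Lemma vset_sum k I (r : seq I) (P : pred I) (f : I -> K) :
  (forall i, P i -> vset k (f i)) -> vset k (\sum_(i <- r | P i) f i).
Proof. by move=> h; elim/big_rec: _ => [|i y /h hi hy]; [left|apply: vsetD]. Qed.

Lemma vset_exists x : exists k, vset k x.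
Proof. by exists (w x); right. Qed.

Lemma vset_sep x : (forall k : nat, vset k x) -> x = 0.
Proof.
move=> h; apply/eqP; apply: contrapT => /negP x0.
have := h `|w x|.+1%N; rewrite vset_neq0//; lia.
Qed.

Lemma vset_val x : x != 0 -> vset (w x) x /\ ~ vset (w x + 1) x.
Proof. by move=> x0; split; [right|rewrite vset_neq0//; lia]. Qed.

Lemma vset1M x : ~ vset 1 x -> forall k y, vset k (x * y) -> vset k y.
Proof.
move=> nx k y; have [->|y0] := eqVneq y 0; first by left.
have x0 : x != 0 by apply: contra_notN nx => /eqP->; left.
by rewrite !vset_neq0 ?mulf_neq0// padic_valM//; move: nx; rewrite vset_neq0//; lia.
Qed.

(** Elements of A are dense in the valuation ring, since denominators prime to p
    are invertible modulo every power of p. *)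
Lemma vset0_approx (k : nat) x : vset 0 x -> exists a, vset k (x - a%:F).
Proof.
move=> /vset0P[a [s [ps ->]]].
have [t ht] := maximal_inv_idealX k spec_maximal ps.
exists (a * t).
have s0 : s%:F != 0 by rewrite tofrac_eq0 denom_neq0.
have -> : a%:F / s%:F - (a * t)%:F = a%:F / s%:F * - (s * t - 1)%:F.
  rewrite !(tofracM, tofracB, tofrac1) opprB mulrBr mulr1 mulrA divfK//.
rewrite -[k%:Z]add0r; apply: vsetM; first by apply/vset0P; exists a, s.
by apply: vsetN; apply/vset_tofrac.
Qed.

Lemma vset0_common_denominator n (c : 'I_n -> K) : (forall i, vset 0 (c i)) ->
  exists2 s, ~ spec_set p s & exists a : 'I_n -> A, forall i, c i = (a i)%:F / s%:F.
Proof.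
move=> hc.
have /choice[f hf] : forall j, exists z : A * A, ~ spec_set p z.2 /\
    c j = z.1%:F / z.2%:F.
  by move=> j; have /vset0P[a [s h]] := hc j; exists (a, s).
have ps (P : pred 'I_n) : ~ spec_set p (\prod_(j | P j) (f j).2).
  elim/big_rec: _ => [|j z _ pz]; first by case: hp.
  by case: hp => _ _ h /h[]//; case: (hf j).
exists (\prod_j (f j).2); first exact: ps.
exists (fun j => (f j).1 * \prod_(l | l != j) (f l).2) => j; have [pj ->] := hf j.
have -> : \prod_l (f l).2 = (f j).2 * \prod_(l | l != j) (f l).2 by rewrite (bigD1 j).
rewrite !tofracM -mulf_div divff ?mulr1// tofrac_eq0 denom_neq0//; exact: ps.
Qed.

(** Divide by a member of least valuation, then clear denominators prime to p. *)
Lemma primitive_scaling n (c : 'I_n -> K) : (exists i, c i != 0) ->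
  exists2 d, d != 0 & exists2 a : 'I_n -> A,
    (forall i, (a i)%:F = d * c i) & exists i, ~ spec_set p (a i).
Proof.
move=> [i0 ci0].
have [i ci imin] : exists2 i, c i != 0 & forall j, c j != 0 -> w (c i) <= w (c j).
  by case: (@Order.TotalTheory.arg_minP _ _ _ i0 (fun i => c i != 0) (fun i => w (c i)) ci0) => i; exists i.
have int j : vset 0 (pi_exp (- w (c i)) * c j).
  rewrite -vsetE addr0; have [->|cj] := eqVneq (c j) 0; first by left.
  by right; apply: imin.
have [s ps [a ha]] := vset0_common_denominator int.
have s0 : s%:F != 0 by rewrite tofrac_eq0 denom_neq0.
exists (s%:F * pi_exp (- w (c i))); first by rewrite mulf_neq0 ?pi_exp_neq0.
exists a => [j|]; first by rewrite -mulrA ha mulrC divfK.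
exists i => /vset1_tofrac h1.
have h2 : vset 0 (1%:F / s%:F) by apply/vset0P; exists 1, s.
have := vsetM h1 h2; rewrite tofrac1 mul1r -ha addr0 -vsetE.
by have [] := vset_val ci.
Qed.

End Valuation.

(** * Linear algebra modulo a maximal ideal *)

Section ResidualBasis.
Variables (A B : comPzRingType) (h : {rmorphism A -> B}).
Variable p : set A.
Hypothesis mp : is_maximal_ideal p.
Implicit Types (M N I : set B).

Let ip : is_ideal p. Proof. by case: mp. Qed.

(** Gaussian elimination over the field A / p, written in A. *)
Lemma residual_dependence d m (C : 'I_m -> 'I_d -> A) : (d < m)%N ->
  exists v : 'I_m -> A,
    (exists i, ~ p (v i)) /\ forall j, p (\sum_i v i * C i j).
Proof.
have p1 : ~ p 1 by case: mp.
elim: d m C => [|d IHd] [//|m] C dm.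
  by exists (fun=> 1); split=> [|[]//]; exists ord0.
have [pC|/existsNP[i1 pC]] := pselect (forall i, p (C i ord0)).
  have [v [v0 vC]] := IHd _ (fun i j => C i (lift ord0 j)) (ltnW dm).
  exists v; split=> // j; have [->|[k ->]] : j = ord0 \/ exists k, j = lift ord0 k.
    by case: (unliftP ord0 j) => [k|] ->; [right; exists k|left].
    by apply: ideal_sum => // i _; apply: ideal_mull.
  exact: vC.
have [t pt] : exists t, p (C i1 ord0 * t - 1).
  by have /maximal_idealP[_ _] := mp; apply.
have [v' [[k0 pv'] vC]] := IHd _
  (fun k j => C (lift i1 k) (lift ord0 j) -
              t * C (lift i1 k) ord0 * C i1 (lift ord0 j)) dm.
pose v i := if unlift i1 i is Some k then v' k
  else - \sum_k v' k * (t * C (lift i1 k) ord0).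
have v1 : v i1 = - \sum_k v' k * (t * C (lift i1 k) ord0).
  by rewrite /v unlift_none.
have vl k : v (lift i1 k) = v' k by rewrite /v liftK.
exists v; split=> [|j]; first by exists (lift i1 k0); rewrite vl.
rewrite (bigD1_ord i1)//= v1; under eq_bigr do rewrite vl.
rewrite mulNr mulr_suml -sumrN -big_split /=.
have [->|[l ->]] : j = ord0 \/ exists l, j = lift ord0 l.
  by case: (unliftP ord0 j) => [k|] ->; [right; exists k|left].
  apply: ideal_sum => // k _.
  have -> : - (v' k * (t * C (lift i1 k) ord0) * C i1 ord0) +
    v' k * C (lift i1 k) ord0 = - (v' k * C (lift i1 k) ord0 * (C i1 ord0 * t - 1)) by ring.
  by apply: idealN => //; apply: ideal_mull.
have := vC l; congr p; apply: eq_bigr => k _; ring.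
Qed.

Definition residually_free N n (b : 'I_n -> B) := forall c : 'I_n -> A,
  N (\sum_i h (c i) * b i) -> forall i, p (c i).

(** The b i represent a basis of M / N over A / p. *)
Definition residual_basis M N n (b : 'I_n -> B) :=
  [/\ forall i, M (b i),
      forall y, M y -> exists c : 'I_n -> A, N (y - \sum_i h (c i) * b i)
    & residually_free N b].

Definition fcat T m n (f : 'I_m -> T) (g : 'I_n -> T) (i : 'I_(m + n)) : T :=
  match fintype.split i with inl j => f j | inr j => g j end.

Lemma sum_fcat T T' (V : nmodType) (F : T -> T' -> V) m n
    (f : 'I_m -> T) (g : 'I_n -> T) (f' : 'I_m -> T') (g' : 'I_n -> T') :
  \sum_i F (fcat f g i) (fcat f' g' i) =
  \sum_i F (f i) (f' i) + \sum_i F (g i) (g' i).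
Proof.
rewrite big_split_ord /=; congr (_ + _); apply: eq_bigr => i _.
  by rewrite /fcat (unsplitK (inl i)).
by rewrite /fcat (unsplitK (inr i)).
Qed.

Lemma fcat_lshift T m n (f : 'I_m -> T) (g : 'I_n -> T) i : fcat f g (lshift n i) = f i.
Proof. by rewrite /fcat (unsplitK (inl i)). Qed.

Lemma fcat_rshift T m n (f : 'I_m -> T) (g : 'I_n -> T) i : fcat f g (rshift m i) = g i.
Proof. by rewrite /fcat (unsplitK (inr i)). Qed.

Lemma forall_fcat T m n (f : 'I_m -> T) (g : 'I_n -> T) (Q : T -> Prop) :
  (forall i, Q (f i)) -> (forall i, Q (g i)) -> forall i, Q (fcat f g i).
Proof. by move=> Qf Qg i; rewrite /fcat; case: fintype.split. Qed.

Lemma fcat_eta T m n (c : 'I_(m + n) -> T) :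
  c = fcat (fun i => c (lshift n i)) (fun i => c (rshift m i)).
Proof. by apply/funext => i; rewrite /fcat; case: fintype.splitP => j e; congr c; apply: val_inj. Qed.

(** The bound n gives a free family of maximal size, which spans. *)
Lemma residual_basis_exists M N n : is_ideal M -> is_ideal N ->
  (forall a y, p a -> M y -> N (h a * y)) ->
  (forall d (b : 'I_d -> B), (forall i, M (b i)) -> residually_free N b -> (d <= n)%N) ->
  exists d (b : 'I_d -> B), residual_basis M N b.
Proof.
move=> hM hN pMN bound.
pose Q d := `[< exists b : 'I_d -> B, (forall i, M (b i)) /\ residually_free N b >].
have exQ : exists d, Q d by exists 0%N; apply/asboolP; exists (fun=> 0); split=> [[]|c _ []].
have Qn d : Q d -> (d <= n)%N by move=> /asboolP[b [Mb fb]]; apply: (bound d b).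
case: (ex_maxnP exQ Qn) => d /asboolP[b [Mb fb]] dmax.
exists d, b; split=> // y My; apply: contrapT => /forallNP ny.
suff /dmax : Q (d + 1)%N by rewrite addn1 ltnn.
apply/asboolP; exists (fcat b (fun=> y)); split; first exact: forall_fcat.
move=> c; rewrite [c]fcat_eta (sum_fcat (fun a z => h a * z)) big_ord1.
set c1 := fun i => c (lshift 1 i); set e := c (rshift d ord0) => Nc.
have [pe|pe] := pselect (p e); last first.
  have [t pt] : exists t, p (e * t - 1) by have /maximal_idealP[_ _] := mp; apply.
  case: (ny (fun i => - (t * c1 i))).
  have -> : y - \sum_i h (- (t * c1 i)) * b i =
      h t * (\sum_i h (c1 i) * b i + h e * y) + - (h (e * t - 1) * y).
    rewrite -sumrN mulrDr mulr_sumr rmorphB rmorphM rmorph1.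
    under eq_bigr do rewrite rmorphN rmorphM mulNr opprK -mulrA.
    ring.
  by apply: idealD => //; [apply: ideal_mull|apply: idealN => //; apply: pMN].
have pc1 : forall i, p (c1 i).
  apply: fb; rewrite -[X in N X](addrK (h e * y)); apply: idealB => //.
  exact: pMN.
by apply: forall_fcat => // i; rewrite ord1.
Qed.

Lemma residual_basis_le M N d d' (b : 'I_d -> B) (b' : 'I_d' -> B) :
  is_ideal N -> (forall a y, p a -> M y -> N (h a * y)) ->
  residual_basis M N b -> (forall i, M (b' i)) -> residually_free N b' -> (d' <= d)%N.
Proof.
move=> hN pMN [Mb sb fb] Mb' fb'; rewrite leqNgt; apply/negP => dd'.
have /choice[C hC] : forall i, exists c : 'I_d -> A, N (b' i - \sum_j h (c j) * b j).
  by move=> i; apply: sb.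
have [v [[i pv] vC]] := residual_dependence C dd'.
apply: pv; apply: fb'.
have -> : \sum_i h (v i) * b' i = \sum_i h (v i) * (b' i - \sum_j h (C i j) * b j) +
    \sum_j h (\sum_i v i * C i j) * b j.
  under [X in _ + X]eq_bigr do rewrite rmorph_sum mulr_suml.
  rewrite exchange_big -big_split /=; apply: eq_bigr => k _.
  under [X in _ = _ + X]eq_bigr do rewrite rmorphM -mulrA.
  by rewrite mulrBr mulr_sumr subrK.
apply: idealD => //; apply: ideal_sum => // k _; first exact: ideal_mull.
exact: pMN.
Qed.

Lemma residual_basis_card M N d d' (b : 'I_d -> B) (b' : 'I_d' -> B) :
  is_ideal N -> (forall a y, p a -> M y -> N (h a * y)) ->
  residual_basis M N b -> residual_basis M N b' -> d = d'.
Proof.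
move=> hN pMN hb hb'; have [Mb _ fb] := hb; have [Mb' _ fb'] := hb'.
apply/eqP; rewrite eqn_leq (residual_basis_le hN pMN hb' Mb fb).
exact: (residual_basis_le hN pMN hb Mb' fb').
Qed.

(** Additivity of the dimension along N' <= N <= M. *)
Lemma residual_basis_cat M N N' d d' (b : 'I_d -> B) (b' : 'I_d' -> B) :
  is_ideal M -> is_ideal N -> is_ideal N' -> N' `<=` N -> N `<=` M ->
  (forall a y, p a -> M y -> N' (h a * y)) ->
  residual_basis M N b -> residual_basis N N' b' -> residual_basis M N' (fcat b b').
Proof.
move=> hM hN hN' N'N NM pMN' [Mb sb fb] [Nb' sb' fb']; split.
- by apply: forall_fcat => // i; apply: NM.
- move=> y /sb[c /sb'[c' hc]]; exists (fcat c c').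
  by rewrite (sum_fcat (fun a z => h a * z)) opprD addrA.
move=> c; rewrite [c]fcat_eta (sum_fcat (fun a z => h a * z)).
set c1 := fun i => c (lshift d' i); set c2 := fun i => c (rshift d i) => Nc.
have pc1 : forall i, p (c1 i).
  apply: fb; rewrite -[X in N X](addrK (\sum_i h (c2 i) * b' i)).
  apply: idealB => //; first exact: N'N.
  by apply: ideal_sum => // i _; apply: ideal_mull.
apply: forall_fcat => //; apply: fb'.
rewrite -[X in N' X](addKr (\sum_i h (c1 i) * b i)); apply: idealD => //.
by apply: idealN => //; apply: ideal_sum => // i _; apply: pMN'.
Qed.

(** For I invertible, multiplication by an element of I outside P I is an
    isomorphism from B / P to I / P I. *)
Lemma residual_basis_mul I P x d (b : 'I_d -> B) :
  is_ideal I -> is_maximal_ideal P -> I x -> ~ idealM P I x ->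
  (forall y, I y -> exists z, idealM P I (y - x * z)) ->
  residual_basis setT P b -> residual_basis I (idealM P I) (fun i => x * b i).
Proof.
move=> hI mP Ix PIx span [_ sb fb]; have [iP P1 Pmax] := mP; split=> [i|y Iy|c Nc].
- exact: ideal_mulr.
- have [z hz] := span y Iy; have [c hc] := sb z Logic.I; exists c.
  have -> : y - \sum_i h (c i) * (x * b i) =
      (y - x * z) + (z - \sum_i h (c i) * b i) * x.
    rewrite mulrBl mulr_suml; under [X in _ - X]eq_bigr do rewrite mulrCA mulrC.
    by rewrite addrA (mulrC z) subrK.
  by apply: (idealD (idealM_ideal _ _)) => //; apply: idealM_in.
apply: fb.
pose J := [set z | idealM P I (x * z)].
have hJ : is_ideal J := ideal_colon _ (idealM_ideal P I).
rewrite -(Pmax J hJ) /J /=.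
- by rewrite mulr_sumr; move: Nc; congr (idealM _ _ _); apply: eq_bigr => i _; rewrite mulrCA.
- by rewrite mulr1.
- by move=> z Pz /=; rewrite mulrC; apply: idealM_in.
Qed.

End ResidualBasis.

(** Isolating the lowest coefficient which is not in Z. *)
Lemma sum_lowest (R : comPzRingType) (Z : set R) n (c : 'I_n -> R) x :
  is_ideal Z -> (exists i, ~ Z (c i)) ->
  exists (i : 'I_n) y, ~ Z (c i) /\ Z (\sum_j c j * x ^+ j - x ^+ i * (c i + x * y)).
Proof.
move=> hZ [i0 /asboolPn Zi0].
case: (arg_minnP (P := fun i => ~~ `[< Z (c i) >]) val Zi0) => i /asboolPn Zi imin.
exists i, (\sum_(j < n | (i < j)%N) c j * x ^+ (j - i.+1)); split=> //.
have -> : \sum_j c j * x ^+ j - x ^+ i * (c i +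
    x * \sum_(j < n | (i < j)%N) c j * x ^+ (j - i.+1)) =
    \sum_(j < n | (j < i)%N) c j * x ^+ j.
  rewrite mulrDr mulrA -exprSr mulr_sumr.
  under [X in _ - (_ + X)]eq_bigr => j ij do rewrite mulrCA -exprD subnKC//.
  rewrite (bigID (fun j : 'I_n => (j < i)%N))/= [X in _ + X - _](bigD1 i) ?ltnn//=.
  under [X in _ + (_ + X) - _]eq_bigl => j do rewrite -leqNgt andbC eq_sym -ltn_neqAle.
  by rewrite [X in _ - (X + _)]mulrC addrK.
apply: ideal_sum => // j ji; apply: ideal_mulr => //.
by apply: contrapT => /asboolPn/imin; rewrite leqNgt ji.
Qed.

(** * The integral closure in a finite extension *)

Section IntegralClosureTheory.
Variables (A : idomainType) (L : fieldExtType {fraction A}).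
Local Notation K := {fraction A}.
Local Notation "a %:F" := (@FracField.tofrac A a).
Local Notation B := (integral_closure L).
Local Notation te := (to_ext L).
Local Notation tc := (to_closure L).
Implicit Types (a s : A) (b : B) (x y : L).

Definition closure_val : {rmorphism B -> L} := (val : B -> L).
Local Notation cv := closure_val.

Lemma integral_closureP b : integralOver te (cv b).
Proof. exact: asboolW (valP b). Qed.

Lemma integral_closure_lift x : integralOver te x -> exists b : B, cv b = x.
Proof. by move=> ix; exists (exist _ x (asboolT ix)). Qed.

Lemma closure_val_inj : injective cv. Proof. by move=> b b' e; apply: val_inj. Qed.

Lemma to_extE a : te a = a%:F%:A. Proof. by []. Qed.

Lemma val_to_closure a : cv (tc a) = te a. Proof. by []. Qed.

Lemma val_to_closureM a b : cv (tc a * b) = a%:F *: cv b.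
Proof. by rewrite rmorphM val_to_closure to_extE mulr_algl. Qed.

Lemma val_to_closure_sum n (c : 'I_n -> A) (b : 'I_n -> B) :
  cv (\sum_i tc (c i) * b i) = \sum_i (c i)%:F *: cv (b i).
Proof. by rewrite rmorph_sum; apply: eq_bigr => i _; apply: val_to_closureM. Qed.

Lemma to_ext_eq0 a : (te a == 0) = (a == 0).
Proof. by rewrite fmorph_eq0 tofrac_eq0. Qed.

Lemma to_closure_eq0 a : tc a = 0 -> a = 0.
Proof.
move=> e; apply/eqP; rewrite -to_ext_eq0 -val_to_closure e; apply/eqP; exact: rmorph0.
Qed.

(** Multiplying a root of a monic polynomial by a common denominator s of the
    coefficients gives a root of the polynomial with coefficients q_i s^(n-i). *)
Lemma integral_scale (s x : L) (q : {poly L}) : q \is monic -> root q x ->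
  integralOver te s -> (forall i, (i < (size q).-1)%N -> integralOver te (s * q`_i)) ->
  integralOver te (s * x).
Proof.
move=> mq rq is_ iq; set n := (size q).-1 in iq.
have sq : size q = n.+1 by rewrite prednK// size_poly_gt0 monic_neq0.
have qn : q`_n = 1 by move/monicP: mq.
pose r := \poly_(i < n.+1) (q`_i * s ^+ (n - i)).
have rn : r`_n = 1 by rewrite coef_poly ltnSn qn mul1r subnn.
have sr : size r = n.+1.
  apply/eqP; rewrite eqn_leq size_poly /=.
  by apply: contraT; rewrite -ltnNge ltnS => /(nth_default 0); rewrite rn => /eqP; rewrite oner_eq0.
apply: (@integral_root_monic _ _ _ _ r).
- by apply/monicP; rewrite lead_coefE sr.
- apply/rootP; rewrite horner_poly; move/rootP: rq; rewrite horner_coef sq => rq.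
  rewrite -[RHS](mulr0 (s ^+ n)) -[X in _ = _ * X]rq mulr_sumr; apply: eq_bigr => i _.
  have -> : s ^+ n = s ^+ (n - i) * s ^+ i by rewrite -exprD subnK// -ltnS.
  by rewrite exprMn; ring.
apply/integral_poly => i; rewrite coef_poly.
have [lt_in|_] := ltnP; last exact: integral0.
have iX (z : L) k : integralOver te z -> integralOver te (z ^+ k).
  by move=> iz; elim: k => [|k IHk]; [apply: integral1|rewrite exprS; apply: integral_mul].
move: lt_in; rewrite ltnS leq_eqVlt => /predU1P[->|lt_in].
  by rewrite qn mul1r; apply: iX.
have -> : (n - i = (n - i.+1).+1)%N by rewrite subnSK.
by rewrite exprS mulrA [q`_i * s]mulrC; apply: integral_mul; [apply: iq|apply: iX].
Qed.

Lemma integral_closure_span x : exists a b, a != 0 /\ cv b = a%:F *: x.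
Proof.
set q := minPoly 1 x; set n := (size q).-1.
have /choice[k hk] : forall i, exists k : K, q`_i = k%:A.
  by move=> i; have /polyOverP/(_ i)/vlineP[k ->] := minPolyOver 1 x; exists k.
have [d d0 [a ha]] := common_denominator (fun i : 'I_n => k i).
have [b hb] : exists b : B, cv b = te d * x.
  apply: integral_closure_lift; apply: (@integral_scale _ _ q).
  - exact: monic_minPoly.
  - exact: root_minPoly.
  - exact: integral_id.
  move=> i ni; rewrite hk (ha (Ordinal ni)) to_extE mulr_algl scalerA mulrC divfK ?tofrac_eq0// -to_extE.
  exact: integral_id.
by exists d, b; rewrite hb to_extE mulr_algl.
Qed.

Definition linearly_free n (b : 'I_n -> L) :=
  forall c : 'I_n -> K, \sum_i c i *: b i = 0 -> forall i, c i = 0.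

Lemma zero_maximal (F : fieldType) : is_maximal_ideal [set 0 : F].
Proof.
apply/maximal_idealP; split; [exact: zero_ideal|exact/eqP/oner_neq0|].
by move=> x /eqP x0; exists x^-1; rewrite /= divff// subrr.
Qed.

Lemma linearly_free_le n (b : 'I_n -> L) : linearly_free b -> (n <= \dim {:L})%N.
Proof.
move=> fb; rewrite leqNgt; apply/negP => lt_n.
have [v [[i vi] vC]] := residual_dependence (zero_maximal K)
  (fun i j => coord (vbasis {:L}) j (b i)) lt_n.
apply: vi; apply: fb; rewrite [LHS](coord_vbasis (memvf _)).
apply: big1 => j _; rewrite linear_sum (_ : \sum_i _ = 0) ?scale0r//.
by rewrite -[RHS](vC j); apply: eq_bigr => l _; rewrite linearZ.
Qed.

Lemma linearly_free_adjoin n (b : 'I_n -> L) x : linearly_free b ->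
  (forall c : 'I_n -> K, x <> \sum_i c i *: b i) ->
  linearly_free (fcat b (fun=> x) : 'I_(n + 1) -> L).
Proof.
move=> fb nx c; rewrite [c]fcat_eta (sum_fcat (@GRing.scale _ L)) big_ord1.
set c1 := fun i => c (lshift 1 i); set e := c (rshift n ord0) => e0.
have [ee|ne] := eqVneq e 0.
  move: e0; rewrite ee scale0r addr0 => /fb c10.
  by apply: (forall_fcat (Q := fun z => z = 0)) => i; [exact: c10|rewrite ord1].
case: (nx (fun i => - (e^-1 * c1 i))).
under eq_bigr do rewrite scaleNr -scalerA.
rewrite sumrN -scaler_sumr; apply/eqP; rewrite -subr_eq0 opprK.
by rewrite -[x](scalerK ne) -scalerDr addrC e0 scaler0.
Qed.

Lemma linearly_free_full n (b : 'I_n -> L) : linearly_free b -> n = \dim {:L} ->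
  forall x, exists c : 'I_n -> K, x = \sum_i c i *: b i.
Proof.
move=> fb en x; apply: contrapT => /forallNP nx.
by have /linearly_free_le := linearly_free_adjoin fb nx; rewrite en addn1 ltnn.
Qed.

Lemma not_spanning d (b : 'I_d -> L) : (d < \dim {:L})%N ->
  exists x, forall c : 'I_d -> K, x <> \sum_i c i *: b i.
Proof.
move=> ltd; apply: contrapT => /forallNP h.
have /choice[C hC] : forall j : 'I_(\dim {:L}), exists c : 'I_d -> K,
    (vbasis {:L})`_j = \sum_i c i *: b i.
  by move=> j; have /existsNP[c /contrapT e] := h (vbasis {:L})`_j; exists c.
have [v [[j vj] vC]] := residual_dependence (zero_maximal K) C ltd.
have /freeP fr := basis_free (vbasisP {:L}).
apply: vj; apply: fr.
under eq_bigr do rewrite hC scaler_sumr.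
rewrite exchange_big big1// => i _.
under eq_bigr do rewrite scalerA.
by rewrite -scaler_suml (vC i) scale0r.
Qed.

Lemma contract_neq0 (I : set B) : is_ideal I -> I <> [set 0] ->
  exists2 a, a != 0 & I (tc a).
Proof.
move=> hI /(ideal_neq0 hI)[x Ix x0].
have x0' : cv x != 0 by rewrite -(rmorph0 cv) (inj_eq closure_val_inj).
have [a [b [a0 e]]] := integral_closure_span (cv x)^-1.
exists a => //; suff -> : tc a = b * x by apply: ideal_mull.
apply: closure_val_inj; rewrite rmorphM e -scalerAl mulVf//.
Qed.

Lemma integral_closure_domain (b b' : B) : b * b' = 0 -> b = 0 \/ b' = 0.
Proof.
move/(congr1 cv); rewrite rmorphM rmorph0 => /eqP; rewrite mulf_eq0.
by move=> /orP[]/eqP e; [left|right]; apply: closure_val_inj; rewrite e rmorph0.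
Qed.

Lemma integral_trans x : integralOver cv x -> integralOver te x.
Proof.
move=> [q mq rq]; apply: integral_root_monic rq _; first exact: monic_map.
by apply/integral_poly => i; rewrite coef_map; apply: integral_closureP.
Qed.

Section Dedekind.
Hypothesis hA : dedekind A.

Section Prime.
Variable p : spec A.
Hypothesis p0 : spec_set p <> [set 0].
Let mp := spec_maximal hA p0.

(** A linear relation over K, scaled so that its coefficients are in A and not all
    in p, is a relation modulo p. *)
Lemma residually_free_linear (N : set B) n (b : 'I_n -> B) : N 0 ->
  residually_free tc p N b -> linearly_free (cv \o b).
Proof.
move=> N0 fb c c0; apply: contrapT => /existsNP[i /eqP ci].
have [d d0 [a ha [j pj]]] := primitive_scaling hA p0 (ex_intro _ i ci).
apply: pj; apply: fb; rewrite (_ : \sum_i _ = 0)//; apply: closure_val_inj.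
rewrite val_to_closure_sum rmorph0 -[RHS](scaler0 _ d) -[X in _ = _ *: X]c0 scaler_sumr.
by apply: eq_bigr => l _; rewrite ha scalerA.
Qed.

Lemma residually_free_le (N : set B) n (b : 'I_n -> B) : N 0 ->
  residually_free tc p N b -> (n <= \dim {:L})%N.
Proof. by move=> N0 fb; apply: linearly_free_le (residually_free_linear N0 fb). Qed.

Lemma closure_residual_basis (M N : set B) : is_ideal M -> is_ideal N ->
  (forall a b, spec_set p a -> M b -> N (tc a * b)) ->
  exists d (b : 'I_d -> B), residual_basis tc p M N b.
Proof.
move=> hM hN pMN; apply: (@residual_basis_exists _ _ tc p mp M N (\dim {:L})) => //.
by move=> d b _; apply: residually_free_le; apply: ideal0.
Qed.

End Prime.

Definition extend_ideal (I : set A) : set B := ideal_gen (tc @` I).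

(** For a nonzero in an ideal I of B, factor (a) = p1 ... pr in A: the quotients
    of I by its intersections with p1 ... pi B are finite dimensional, so that I
    is finitely generated modulo a B. *)
Lemma integral_closure_noetherian : noetherian B.
Proof.
move=> I hI; have [I0|/(contract_neq0 hI)[a /eqP a0 Ia]] := pselect (I = [set 0]).
  by exists 0%N, (fun=> 0); rewrite ideal_gen_range0.
have [s hs es] := ideal_factor (dedekindW hA) (ideal_gen_ideal [set a]) (principal_neq0 a0).
have [m [g [Ig sg]]] : exists m (g : 'I_m -> B), (forall i, I (g i)) /\
    forall y : B, I y -> exists c : 'I_m -> A,
      extend_ideal (ideal_prod s) (y - \sum_i tc (c i) * g i).
  elim: (s) hs => [_|q r IHr hs].
    exists 0%N, (fun=> 0); split=> [[]//|y _]; exists (fun=> 0).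
    suff -> : extend_ideal (ideal_prod [::]) = setT by [].
    apply: idealT_eq; first exact: ideal_gen_ideal.
    by apply: ideal_genS; exists 1; rewrite ?rmorph1.
  have [m [g [Ig sg]]] := IHr (fun Q Qr => hs Q (@mem_behead _ (q :: r) Q Qr)).
  have [hq q0] := hs q (mem_head _ _).
  set J := extend_ideal (ideal_prod r); set J' := extend_ideal (ideal_prod (q :: r)).
  have hJ : is_ideal J := ideal_gen_ideal _.
  have hJ' : is_ideal J' := ideal_gen_ideal _.
  have [d [b [Mb sb _]]] : exists d (b : 'I_d -> B),
      residual_basis tc q (I `&` J) (I `&` J') b.
    apply: (@closure_residual_basis (Spec hq) q0).
    - exact: ideal_setI.
    - exact: ideal_setI.
    move=> c y qc [Iy Jy]; split; first exact: ideal_mull.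
    move: y Jy {Iy}; apply: (@ideal_gen_sub _ _ [set y | J' (tc c * y)]).
      exact: ideal_colon.
    move=> _ [e re <-] /=; apply: ideal_genS; exists (c * e); last by rewrite rmorphM.
    exact: idealM_in.
  exists (m + d)%N, (fcat g b); split.
    by apply: forall_fcat => // i; case: (Mb i).
  move=> y Iy; have [c hc] := sg y Iy.
  have [|c' [_ hc']] := sb (y - \sum_i tc (c i) * g i).
    split=> //; apply: idealB => //; apply: ideal_sum => // i _; exact: ideal_mull.
  by exists (fcat c c'); rewrite (sum_fcat (fun u z => tc u * z)) opprD addrA.
exists (m + 1)%N, (fcat g (fun=> tc a)).
apply/seteqP; split=> [y Iy|]; last first.
  apply: ideal_gen_sub => // _ [i _ <-]; move: i; exact: forall_fcat.
have [c] := sg y Iy; rewrite -es => hc.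
have [e he] : exists e, y - \sum_i tc (c i) * g i = e * tc a.
  suff /ideal_gen1P : ideal_gen [set tc a] (y - \sum_i tc (c i) * g i) by [].
  move: hc; apply: ideal_gen_sub; first exact: ideal_gen_ideal.
  by move=> _ [_ /ideal_gen1P[e ->] <-]; apply/ideal_gen1P; exists (tc e); rewrite rmorphM.
apply/ideal_gen_rangeP; exists (fcat (fun i => tc (c i)) (fun=> e)).
by rewrite (sum_fcat (fun u z => u * z)) big_ord1 -he addrC subrK.
Qed.

(** Sufficiently many powers of x are dependent modulo P over A / q, where q is the
    contraction of P. Dividing a relation by the lowest power of x with a coefficient
    outside q leaves an invertible constant term, which is a multiple of x. *)
Lemma closure_prime_maximal (P : set B) : is_prime_ideal P -> P <> [set 0] ->
  is_maximal_ideal P.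
Proof.
move=> hP P0; have iP := prime_ideal hP.
pose q := Spec (prime_preim tc hP).
have q0 : spec_set q <> [set 0].
  have [a a0 Pa] := contract_neq0 iP P0 => e.
  have : spec_set q a by [].
  by rewrite e => /eqP; apply/negP.
have /maximal_idealP[iq _ qinv] := spec_maximal hA q0.
apply/maximal_idealP; split=> //; first exact: prime_not1.
move=> x Px.
pose b (i : 'I_(\dim {:L}).+1) := x ^+ i.
have /existsNP[c /not_implyP[Pc /existsNP qc]] : ~ residually_free tc q P b.
  by move=> /(residually_free_le q0 (ideal0 iP)); rewrite ltnn.
have [i [y [Pi Pxy]]] := @sum_lowest _ P _ (fun i => tc (c i)) x iP qc.
have {}Pxy : P (tc (c i) + x * y).
  have : P (x ^+ i * (tc (c i) + x * y)).
    rewrite -(subKr (\sum_j tc (c j) * x ^+ j) (_ * _)); exact: idealB.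
  by case/(prime_idealM hP) => // /(prime_exp hP).
have [t qt] := qinv (c i) Pi.
exists (- (y * tc t)).
have -> : x * - (y * tc t) - 1 = tc (c i * t - 1) - (tc (c i) + x * y) * tc t.
  by rewrite rmorphB rmorphM rmorph1; ring.
by apply: idealB => //; apply: ideal_mulr.
Qed.

Lemma integral_closure_dedekind : dedekind_domain B.
Proof.
split; [exact: integral_closure_domain|exact: integral_closure_noetherian
       |exact: closure_prime_maximal|].
move=> x y I x0 hI I0 hyI.
have [n [b eI]] := integral_closure_noetherian hI.
have val0 (z : B) : z <> 0 -> cv z != 0.
  by move=> z0; rewrite -(rmorph0 cv) (inj_eq closure_val_inj); apply/eqP.
have [i0 bi0] : exists i0, b i0 <> 0.
  apply: contrapT => /forallNP h; have [z + /eqP z0] := ideal_neq0 hI I0.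
  rewrite eI => /ideal_gen_rangeP[c ez]; apply: z0.
  by rewrite ez big1// => i _; rewrite (contrapT (h i)) mulr0.
have /integral_trans/integral_closure_lift[d hd] :
    integralOver cv (cv y / cv x).
  apply: (@integral_of_stable_ideal _ _ _ x y n b i0); try exact: val0.
  move=> i; rewrite -eI; apply: hyI; rewrite eI; apply: ideal_genS; by exists i.
exists d; apply: closure_val_inj; rewrite rmorphM hd mulrC divfK//; exact: val0.
Qed.

End Dedekind.
End IntegralClosureTheory.

(** * Ramification and residue degrees *)

Lemma quot_mapE (R S : comPzRingType) (h : {rmorphism R -> S}) (X : set R) (Y : set S) a :
  (forall x, X x -> Y (h x)) -> quot_map h Y (to_quot X a) = to_quot Y (h a).
Proof.
move=> XY; apply/to_quot_eq; rewrite -rmorphB.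
suff sub : ideal_gen X `<=` [set x | ideal_gen Y (h x)] by apply: sub; apply: repr_quot.
apply: ideal_gen_sub.
  have hY := ideal_gen_ideal Y.
  split=> [|x y|b x]; rewrite /= ?rmorph0 ?rmorphD ?rmorphM; [exact: ideal0|exact: idealD|].
  exact: ideal_mull.
by move=> x /XY; apply: ideal_genS.
Qed.

Lemma degree_quot (R S : comPzRingType) (h : {rmorphism R -> S}) (p : set R) (P : set S)
    d (b : 'I_d -> S) : is_maximal_ideal p -> is_ideal P ->
  (forall x, p x -> P (h x)) -> residual_basis h p setT P b ->
  degree (@quot_map R S h p P) = d.
Proof.
move=> mp hP pP hb; have [ip _ _] := mp.
have pS a y : p a -> setT y -> P (h a * y) by move=> /pP Pa _; apply: ideal_mulr.
have quotp x y : to_quot p x = to_quot p y <-> p (x - y).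
  by rewrite to_quot_eq ideal_gen_id.
have quotP x y : to_quot P x = to_quot P y <-> P (x - y).
  by rewrite to_quot_eq ideal_gen_id.
have sumE n (c : 'I_n -> R) (e : 'I_n -> S) :
    \sum_i quot_map h P (to_quot p (c i)) * to_quot P (e i) =
    to_quot P (\sum_i h (c i) * e i).
  rewrite rmorph_sum; apply: eq_bigr => i _.
  by rewrite rmorphM (quot_mapE _ pP).
rewrite /degree; case: xgetP => [n _ [e he]|]; last first.
  move=> /(_ d) []; exists (fun i => to_quot P (b i)) => y.
  have [_ sb fb] := hb; have [z ->] := to_quot_surj y.
  have [c hc] := sb z Logic.I; exists (fun i => to_quot p (c i)); split.
    by rewrite sumE; apply/quotP.
  move=> c' ; have /choice[c1 hc1] : forall i, exists a, c' i = to_quot p a.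
    by move=> i; apply: to_quot_surj.
  rewrite (_ : c' = fun i => to_quot p (c1 i)); last exact/funext.
  rewrite sumE => /quotP hz; apply/funext => i; apply/quotp.
  apply: (fb (fun i => c i - c1 i)).
  have -> : \sum_i h (c i - c1 i) * b i =
      (z - \sum_i h (c1 i) * b i) - (z - \sum_i h (c i) * b i).
    under eq_bigr do rewrite rmorphB mulrBl.
    by rewrite sumrB; ring.
  exact: idealB.
have /choice[e1 he1] : forall i, exists z, e i = to_quot P z by move=> i; apply: to_quot_surj.
have ee : e = fun i => to_quot P (e1 i) by apply/funext.
apply: (residual_basis_card mp hP pS (b := e1) (b' := b) _ hb); split=> // [y _|c Pc].
  have [c [+ _]] := he (to_quot P y).
  have /choice[c1 hc1] : forall i, exists a, c i = to_quot p a by move=> i; apply: to_quot_surj.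
  have -> : c = fun i => to_quot p (c1 i) by apply/funext.
  by rewrite ee sumE => /quotP; exists c1.
have [c0 [_ uniq0]] := he 0.
have e0 : c0 = fun i => to_quot p 0.
  by apply: uniq0; rewrite ee sumE big1 ?rmorph0// => i _; rewrite mul0r.
have ec : c0 = fun i => to_quot p (c i).
  apply: uniq0; rewrite ee sumE -(rmorph0 (to_quot P)); apply/esym/quotP.
  by rewrite subr0.
move=> i; rewrite -[c i]subr0; apply/quotp.
by rewrite -[LHS]/((fun i => to_quot p (c i)) i) -ec e0.
Qed.

Section RamificationResidue.
Variables (A : idomainType) (L : fieldExtType {fraction A}).
Hypothesis hA : dedekind A.
Variable p : spec A.
Hypothesis p0 : spec_set p <> [set 0].
Local Notation B := (integral_closure L).
Local Notation tc := (to_closure L).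
Local Notation pB := (@extend_ideal A L (spec_set p)).
Implicit Types (I P : set B) (s : seq (set B)).

Let mp := spec_maximal hA p0.
Let dedB := integral_closure_dedekind L hA.
Let domB := @integral_closure_domain A L.

Lemma extend_ideal_ideal : is_ideal pB. Proof. exact: ideal_gen_ideal. Qed.

Lemma extend_ideal_mull a (y : B) : spec_set p a -> pB (tc a * y).
Proof.
move=> pa; apply: (ideal_mulr _ extend_ideal_ideal); apply: ideal_genS; by exists a.
Qed.

Lemma extend_ideal_neq0 : pB <> [set 0].
Proof.
have [a pa /eqP a0] := ideal_neq0 (prime_ideal (specP p)) p0 => e.
apply: a0; apply: (@to_closure_eq0 A L).
have : pB (tc a * 1) by exact: extend_ideal_mull.
by rewrite e mulr1.
Qed.

Lemma primes_overP P : is_prime_ideal P -> primes_over L p P <-> pB `<=` P.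
Proof.
move=> hP; have iP := prime_ideal hP; split=> [[_ Pp]|pP].
  by apply: ideal_gen_sub => // _ [a pa <-]; move: pa; rewrite -Pp.
split=> //; have [_ _ pmax] := mp; apply: pmax; first exact: prime_ideal (prime_preim tc hP).
  by case: (prime_preim tc hP).
by move=> a pa; apply: pP; apply: ideal_genS; exists a.
Qed.

Lemma residue_basis_exists P : primes_over L p P ->
  exists b : 'I_(residue_degree p P) -> B, residual_basis tc p setT P b.
Proof.
move=> PP; have [hP _] := PP; have iP := prime_ideal hP.
have pP := (primes_overP hP).1 PP.
have pP' a y : spec_set p a -> setT y -> P (tc a * y).
  by move=> pa _; apply: pP; apply: extend_ideal_mull.
have [d [b hb]] := closure_residual_basis hA p0 (@setT_ideal B) iP pP'.
suff -> : residue_degree p P = d by exists b.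
apply: degree_quot hb => // x px; rewrite -[X in P X]mulr1; exact: pP'.
Qed.

(** For each factor P, the quotient I / P I is isomorphic to B / P, where I is the
    product of the remaining factors. *)
Lemma residual_basis_prod s : nonzero_primes s -> pB `<=` ideal_prod s ->
  exists b : 'I_(\sum_(P <- s) residue_degree p P)%N -> B,
    residual_basis tc p setT (ideal_prod s) b.
Proof.
elim: s => [|P s IHs] hs ps.
  by rewrite big_nil; exists (fun=> 0); split=> // [y _|c _ []//]; exists (fun=> 0).
have hs' : nonzero_primes s by move=> Q Qs; apply: hs; rewrite inE Qs orbT.
have [hP P0] := hs P (mem_head _ _).
have iP := prime_ideal hP; have hI := ideal_prod_ideal s.
have invI : invertible (ideal_prod s).
  by apply: (invertible_prod domB) => Q /hs'[]; apply: prime_invertible.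
set I := ideal_prod s in ps hI invI *.
have PII : idealM P I `<=` I by apply: idealM_subr.
have [b hb] := IHs hs' (subset_trans ps PII).
have PP : primes_over L p P.
  by apply/primes_overP => //; apply: subset_trans ps _; apply: idealM_subl.
have [b' hb'] := residue_basis_exists PP.
have mP : is_maximal_ideal P by case: dedB => _ _ + _; apply.
have [x Ix PIx] : exists2 x, I x & ~ idealM P I x.
  apply: contrapT => h; apply: (prime_not1 hP).
  apply: (invertible_mul_sub domB invI (@setT_ideal B) iP _ (Logic.I : setT 1)).
  rewrite idealM_T// idealMC => y Iy; apply: contrapT => ny; apply: h.
  by exists y.
have span y : I y -> exists z, idealM P I (y - x * z).
  have hPI := idealM_ideal P I.
  have hJ := ideal_adjoin_ideal x hPI.
  have JI : ideal_adjoin (idealM P I) x `<=` I.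
    move=> _ [u /PII Iu [c ->]]; apply: idealD => //; exact: ideal_mull.
  have [Q hQ eQ] := invertible_dvd domB invI hJ JI.
  have PQ : P `<=` Q.
    apply: (invertible_mul_sub domB invI) => //.
    rewrite -eQ (idealMC I); exact: ideal_adjoinS.
  have [_ _ Pmax] := mP.
  have [Q1|Q1] := pselect (Q 1); last first.
    case: PIx; rewrite -(Pmax Q hQ Q1 PQ) idealMC -eQ; exact: ideal_adjoin_in.
  have e : ideal_adjoin (idealM P I) x = I by rewrite eQ (idealT_eq hQ Q1) idealM_T.
  rewrite -{1}e => -[u PIu [c ->]]; exists c.
  by rewrite (mulrC x) addrK.
have hb2 := residual_basis_mul hI mP Ix PIx span hb'.
rewrite big_cons addnC; exists (fcat b (fun i => x * b' i)).
apply: (residual_basis_cat _ hI) hb hb2 => //; first exact: idealM_ideal.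
by move=> a y pa _; apply: ps; apply: extend_ideal_mull.
Qed.

(** The fundamental identity: B / pB has dimension the sum of the e f. *)
Lemma sum_ramification_residue :
  exists b : 'I_(\sum_(P \in primes_over L p)
       (ramification_index p P * residue_degree p P)%N) -> B,
    residual_basis tc p setT pB b.
Proof.
have [s hs es] := ideal_factor dedB extend_ideal_ideal extend_ideal_neq0.
have mem_s P : P \in s <-> primes_over L p P.
  split=> [Ps|PP]; last first.
    have [hP _] := PP; apply: (prime_mem_prod dedB hs hP).
    by rewrite -es; apply/primes_overP.
  have [hP _] := hs P Ps; apply/primes_overP => //.
  by rewrite es (ideal_prod_rem Ps); apply: idealM_subl; apply: prime_ideal.
have -> : primes_over L p = [set` undup s].
  by apply/seteqP; split=> P /=; rewrite mem_undup => /mem_s.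
rewrite -fsbig_seq ?undup_uniq//.
have -> : \sum_(P <- undup s) (ramification_index p P * residue_degree p P)%N =
    (\sum_(P <- s) residue_degree p P)%N.
  transitivity (\sum_(P <- undup s) (ramification_index p P * residue_degree p P))%N.
    by [].
  rewrite -[RHS](@big_undup_iterop_count nat 0%N addn); apply: eq_bigr => P _.
  rewrite Monoid.iteropE iter_addn_0 mulnC; congr (_ * _)%N.
  by rewrite -(ideal_exp_prod dedB P hs) -es.
by rewrite [X in residual_basis _ _ _ X]es; apply: residual_basis_prod; rewrite -?es.
Qed.

End RamificationResidue.

(** * Completions of ring topologies *)

Section Completion.
Variables (R : comPzRingType) (U : filtration R).

(** The ring operations are continuous when the U k are the basic neighbourhoods of 0. *)
Definition ring_topology :=
  [/\ forall k x y, U k x -> U k y -> U k (x - y),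
      forall j k x, (j <= k)%N -> U k x -> U j x,
      forall k, exists j, forall x y, U j x -> U j y -> U k (x * y)
    & forall a k, exists j, forall x, U j x -> U k (a * x)].

Hypothesis topU : ring_topology.
Implicit Types (x y : nat -> R) (u v : cauchy_seq U).

Lemma topologyB k a b : U k a -> U k b -> U k (a - b).
Proof. by case: topU => h _ _ _; apply: h. Qed.

Lemma topology_le j k a : (j <= k)%N -> U k a -> U j a.
Proof. by case: topU => _ h _ _; apply: h. Qed.

Lemma topologyN k a : U k a -> U k (- a).
Proof. by move=> h; rewrite -sub0r; apply: topologyB => //; apply: fil0. Qed.

Lemma topologyD k a b : U k a -> U k b -> U k (a + b).
Proof. by move=> h h'; rewrite -[b]opprK; apply: topologyB => //; apply: topologyN. Qed.

(** A Cauchy sequence differs from a constant by arbitrarily small terms, hence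
    multiplies small elements to small ones. *)
Lemma cauchy_scale x k : is_cauchy U x ->
  exists j N, forall n a, (N <= n)%N -> U j a -> U k (x n * a).
Proof.
move=> hx; have [_ _ topM topZ] := topU.
have [j hj] := topM k; have [N hN] := hx j; have [i hi] := topZ (x N) k.
exists (maxn i j), N => n a Nn Ua.
rewrite -(subrK (x N) (x n)) mulrDl; apply: topologyD.
  by apply: hj; [apply: hN|apply: topology_le Ua; apply: leq_maxr].
by apply: hi; apply: topology_le Ua; apply: leq_maxl.
Qed.

Lemma cauchy_mul x y : is_cauchy U x -> is_cauchy U y -> is_cauchy U (x * y).
Proof.
move=> hx hy k.
have [j [N hj]] := cauchy_scale k hx; have [j' [N' hj']] := cauchy_scale k hy.
have [M hM] := hy j; have [M' hM'] := hx j'.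
exists (maxn (maxn N N') (maxn M M')) => m n.
rewrite !geq_max => /andP[/andP[Nm N'm] /andP[Mm M'm]] /andP[/andP[Nn N'n] /andP[Mn M'n]].
have -> : (x * y) m - (x * y) n = x m * (y m - y n) + y n * (x m - x n).
  by rewrite !mulrBr (mulrC (y n)) [y n * x n]mulrC addrA subrK.
by apply: topologyD; [apply: hj => //; apply: hM|apply: hj' => //; apply: hM'].
Qed.

Lemma cauchy_predP x : cauchy_pred U x <-> is_cauchy U x.
Proof.
split=> [/asboolP h|hx]; last by apply/asboolP; apply: sub_gen_smallest.
apply: h; split=> //; split=> [k|y z hy hz k|]; last exact: cauchy_mul.
  by exists 0%N => m n _ _; rewrite subrr; apply: fil0.
have [[N hN] [M hM]] := (hy k, hz k); exists (maxn N M) => m n.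
rewrite !geq_max => /andP[Nm Mm] /andP[Nn Mn].
have -> : (y - z) m - (y - z) n = (y m - y n) - (z m - z n).
  rewrite [(y - z) m]/(y m - z m) [(y - z) n]/(y n - z n).
  by rewrite !opprB addrACA [RHS]addrACA (addrC (- z m)).
by apply: topologyB; [apply: hN|apply: hM].
Qed.

Definition mk_cauchy x (hx : is_cauchy U x) : cauchy_seq U :=
  exist _ x ((cauchy_predP x).2 hx).

Lemma cauchy_seqP u : is_cauchy U (val u).
Proof. by apply/cauchy_predP; apply: valP. Qed.

Lemma null_seq_ideal : is_ideal (@null_seq R U).
Proof.
split=> [k|u v hu hv k|u v hv k].
- by exists 0%N => n _; apply: fil0.
- have [[N hN] [M hM]] := (hu k, hv k); exists (maxn N M) => n.
  rewrite !geq_max => /andP[Nn Mn]; rewrite [val _ n]/(val u n + val v n).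
  by apply: topologyD; [apply: hN|apply: hM].
have [j [N hj]] := cauchy_scale k (cauchy_seqP u); have [M hM] := hv j.
exists (maxn N M) => n; rewrite geq_max => /andP[Nn Mn].
rewrite [val _ n]/(val u n * val v n); apply: hj => //; exact: hM.
Qed.

Local Notation cls := (to_quot (@null_seq R U)).

Lemma completion_eq u v : cls u = cls v <-> is_null U (fun n => val u n - val v n).
Proof. by rewrite to_quot_eq ideal_gen_id; last exact: null_seq_ideal. Qed.

Lemma completion_eq0 u : cls u = 0 <-> is_null U (val u).
Proof.
rewrite -(rmorph0 cls) completion_eq.
suff -> : (fun n => val u n - val (0 : cauchy_seq U) n) = val u by [].
by apply/funext => n; rewrite [val (0 : cauchy_seq U) n]/(0 : R) subr0.
Qed.

Lemma to_completionE a : to_completion U a = cls (cst_seq U a). Proof. by []. Qed.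

End Completion.

(** * The completion at a nonzero prime *)

Section PadicCompletion.
Variable A : idomainType.
Hypothesis hA : dedekind A.
Variable p : spec A.
Hypothesis p0 : spec_set p <> [set 0].
Local Notation K := {fraction A}.
Local Notation "a %:F" := (@FracField.tofrac A a).
Local Notation Kp := (completion (padic p)).
Local Notation iota := (to_completion (padic p)).
Local Notation vset := (@vset A p).
Local Notation cls := (to_quot (@null_seq K (padic p))).
Implicit Types (x y : K) (k : int) (z t : Kp) (u v : cauchy_seq (padic p)).

Lemma padic_topology : ring_topology (padic p).
Proof.
split=> [k x y|j k x jk|k|x k].
- exact: vsetB.
- by apply: vset_le; rewrite lez_nat.
- exists k => x y Ux Uy; have := vsetM hA Ux Uy.
  by apply: vset_le; rewrite lerDl.
- have [m hm] := vset_exists p x; exists `|k%:Z - m|%N => y Uy.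
  by have := vsetM hA hm Uy; apply: vset_le; lia.
Qed.
Let top := padic_topology.

(** The closure of vset k, that is, the k-th power of the maximal ideal of the
    valuation ring of the completion. *)
Definition cvset k : set Kp := [set z | exists u, z = cls u /\
  exists N, forall n, (N <= n)%N -> vset k (val u n)].

Lemma cvsetP k u : cvset k (cls u) <-> exists N, forall n, (N <= n)%N -> vset k (val u n).
Proof.
split=> [[v [/(completion_eq top) e [N hN]]]|h]; last by exists u.
have [M hM] := e `|k|%N; exists (maxn N M) => n; rewrite geq_max => /andP[Nn Mn].
rewrite -(subrK (val v n) (val u n)); apply: (vsetD hA p0); last exact: hN.
by have := hM n Mn; apply: vset_le; lia.
Qed.

Lemma cvset0 k : cvset k 0.
Proof.
rewrite -(rmorph0 cls); apply/cvsetP; exists 0%N => n _; exact: vset0.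
Qed.

Lemma cvsetD k z t : cvset k z -> cvset k t -> cvset k (z + t).
Proof.
move=> [u [-> [N hN]]] [v [-> [M hM]]]; rewrite -rmorphD; apply/cvsetP.
exists (maxn N M) => n; rewrite geq_max => /andP[Nn Mn].
rewrite [val _ n]/(val u n + val v n).
by apply: (vsetD hA p0); [apply: hN|apply: hM].
Qed.

Lemma cvsetN k z : cvset k z -> cvset k (- z).
Proof.
move=> [u [-> [N hN]]]; rewrite -rmorphN; apply/cvsetP; exists N => n Nn.
by rewrite [val _ n]/(- val u n); apply: (vsetN hA p0); apply: hN.
Qed.

Lemma cvsetB k z t : cvset k z -> cvset k t -> cvset k (z - t).
Proof. by move=> hz ht; apply: cvsetD => //; apply: cvsetN. Qed.

Lemma cvsetM j k z t : cvset j z -> cvset k t -> cvset (j + k) (z * t).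
Proof.
move=> [u [-> [N hN]]] [v [-> [M hM]]]; rewrite -rmorphM; apply/cvsetP.
exists (maxn N M) => n; rewrite geq_max => /andP[Nn Mn].
rewrite [val _ n]/(val u n * val v n).
by apply: (vsetM hA); [apply: hN|apply: hM].
Qed.

Lemma cvset_le j k z : j <= k -> cvset k z -> cvset j z.
Proof.
move=> jk [u [-> [N hN]]]; apply/cvsetP; exists N => n /hN; exact: vset_le.
Qed.

Lemma cvset_iota k x : cvset k (iota x) <-> vset k x.
Proof.
rewrite to_completionE cvsetP; split=> [[N /(_ N (leqnn N))]//|h].
by exists 0%N.
Qed.

Lemma cvset_exists z : exists k, cvset k z.
Proof.
have [u ->] := to_quot_surj z; have [N hN] := cauchy_seqP top u 0%N.
have [k hk] := vset_exists p (val u N); exists (Num.min k 0); apply/cvsetP.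
exists N => n Nn; rewrite -(subrK (val u N) (val u n)); apply: (vsetD hA p0).
  by have := hN n N Nn (leqnn _); apply: vset_le; lia.
by move: hk; apply: vset_le; lia.
Qed.

Lemma cvset_sep z : (forall k : nat, cvset k z) -> z = 0.
Proof.
have [u ->] := to_quot_surj z; move=> h; apply/(completion_eq0 top) => k.
exact/cvsetP.
Qed.

Lemma cvset_approx (k : nat) z : exists x, cvset k (z - iota x).
Proof.
have [u ->] := to_quot_surj z; have [N hN] := cauchy_seqP top u k.
exists (val u N); rewrite to_completionE -rmorphB; apply/cvsetP; exists N => n Nn.
rewrite [val _ n]/(val u n - val u N); exact: hN.
Qed.

Lemma cvset_limit (x : nat -> K) : (forall n : nat, vset n (x n.+1 - x n)) ->
  exists z, forall n : nat, cvset n (z - iota (x n)).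
Proof.
move=> hx.
have dx (k m n : nat) : (k <= m)%N -> (m <= n)%N -> vset k (x n - x m).
  move=> km; elim: n => [|n IHn].
    by rewrite leqn0 => /eqP m0; rewrite m0 subrr; left.
  rewrite leq_eqVlt => /predU1P[->|]; first by rewrite subrr; left.
  rewrite ltnS => mn; rewrite -(subrK (x n) (x n.+1)) -addrA.
  apply: (vsetD hA p0); last exact: IHn.
  by have := hx n; apply: vset_le; rewrite lez_nat; apply: leq_trans mn.
have cx : is_cauchy (padic p) x.
  move=> k; exists k => m n km kn; have [mn|/ltnW nm] := leqP m n; last exact: dx.
  by rewrite -opprB; apply: (vsetN hA p0); apply: dx.
exists (cls (mk_cauchy top cx)) => n; rewrite to_completionE -rmorphB; apply/cvsetP.
exists n => m nm; rewrite [val _ m]/(x m - x n); exact: dx.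
Qed.

Lemma iota_eq0 x : iota x = 0 -> x = 0.
Proof.
move=> e; apply: (vset_sep (p := p)) => k; apply/cvset_iota; rewrite e; exact: cvset0.
Qed.

Lemma completion_1neq0 : (1 : Kp) <> 0.
Proof.
by rewrite -(rmorph1 iota) => /iota_eq0/eqP; rewrite oner_eq0.
Qed.

Lemma cvset_scale j k z : cvset (j + k) z <-> cvset k (iota (pi_exp p (- j)) * z).
Proof.
split=> [h|h].
  have := cvsetM ((cvset_iota _ _).2 (vset_pi_exp hA p0 (- j))) h.
  by rewrite addrA addNr add0r.
have := cvsetM ((cvset_iota _ _).2 (vset_pi_exp hA p0 j)) h.
by rewrite mulrA -rmorphM -(pi_expD hA p0) subrr pi_exp0 rmorph1 mul1r.
Qed.

(** The valuations are bounded below, and not all of them are infinite. *)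
Lemma cvset_val n (z : 'I_n -> Kp) : (exists i, z i <> 0) ->
  exists k, (forall i, cvset k (z i)) /\ exists i, ~ cvset (k + 1) (z i).
Proof.
move=> [i0 zi0].
have [m hm] : exists m, forall i, cvset m (z i).
  have /choice[f hf] : forall i, exists k, cvset k (z i) by move=> i; apply: cvset_exists.
  exists (- (\max_i `|f i|%N)%:Z) => i; apply: cvset_le (hf i).
  by have := leq_bigmax (F := fun i => `|f i|%N) i; lia.
have [N hN] : exists N : nat, ~ forall i, cvset (m + N%:Z) (z i).
  apply: contrapT => /forallNP h; apply: zi0; apply: cvset_sep => k.
  by have /contrapT/(_ i0) := h `|k%:Z - m|%N; apply: cvset_le; lia.
elim: N hN => [|N IHN]; first by rewrite addr0.
move=> hN; have [h|/IHN//] := pselect (forall i, cvset (m + N%:Z) (z i)).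
exists (m + N%:Z); split=> //; apply/existsNP.
by rewrite -addrA -PoszD addn1.
Qed.

(** The inverses of approximations of a unit converge to its inverse. *)
Lemma completion_unit (y : Kp) : cvset 0 y -> ~ cvset 1 y -> exists2 t, cvset 0 t & y * t = 1.
Proof.
move=> hy ny.
have /choice[a ha] : forall n : nat, exists x, cvset n.+1 (y - iota x).
  by move=> n; apply: cvset_approx.
have a0 n : vset 0 (a n).
  apply/cvset_iota; rewrite -(subKr y (iota (a n))); apply: cvsetB => //.
  by apply: cvset_le (ha n).
have a1 n : ~ vset 1 (a n).
  move=> /cvset_iota h; apply: ny; rewrite -(subrK (iota (a n)) y).
  by apply: cvsetD => //; apply: cvset_le (ha n); lia.
have an0 n : a n != 0 by apply: contra_notN (a1 n) => /eqP ->; left.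
have b0 n : vset 0 (a n)^-1.
  apply: (vset1M hA (a1 n)); rewrite divff//.
  by rewrite -(@tofrac1 A); apply: vset0_tofrac.
have [t ht] : exists t, forall n : nat, cvset n (t - iota (a n)^-1).
  apply: cvset_limit => n.
  have -> : (a n.+1)^-1 - (a n)^-1 = (a n - a n.+1) * ((a n)^-1 * (a n.+1)^-1).
    by rewrite mulrBl mulrA divff// mul1r [a n.+1 * _]mulrCA divff// mulr1.
  rewrite -[n%:Z]addr0; apply: (vsetM hA); last first.
    by rewrite -[0]addr0; apply: (vsetM hA).
  apply/cvset_iota; rewrite rmorphB.
  have -> : iota (a n) - iota (a n.+1) = (y - iota (a n.+1)) - (y - iota (a n)) by ring.
  by apply: cvsetB; [apply: cvset_le (ha n.+1)|apply: cvset_le (ha n)]; lia.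
have t0 : cvset 0 t.
  rewrite -(subrK (iota (a 0%N)^-1) t); apply: cvsetD; first exact: (ht 0%N).
  exact/cvset_iota.
exists t => //; apply/eqP; rewrite -subr_eq0; apply/eqP; apply: cvset_sep => n.
have -> : y * t - 1 = (y - iota (a n)) * t + iota (a n) * (t - iota (a n)^-1).
  have : iota (a n) * iota (a n)^-1 = 1 by rewrite -rmorphM divff// rmorph1.
  by move=> e; rewrite mulrBl mulrBr e; ring.
apply: cvsetD.
  by rewrite -[n%:Z]addr0; apply: cvsetM => //; apply: cvset_le (ha n); lia.
by rewrite -[n%:Z]add0r; apply: cvsetM => //; apply/cvset_iota.
Qed.

Lemma completion_normalize z : z <> 0 -> exists k,
  cvset 0 (iota (pi_exp p (- k)) * z) /\ ~ cvset 1 (iota (pi_exp p (- k)) * z).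
Proof.
move=> z0; have [k [/(_ ord0) hz [_ nz]]] := @cvset_val 1 (fun=> z) (ex_intro _ ord0 z0).
by exists k; rewrite -!cvset_scale addr0.
Qed.

Lemma completion_field z : z <> 0 -> exists t, z * t = 1.
Proof.
move=> /completion_normalize[k [hy ny]].
have [t _ yt] := completion_unit hy ny.
by exists (iota (pi_exp p (- k)) * t); rewrite mulrCA mulrA.
Qed.

Lemma completion_maximal : is_maximal_ideal [set 0 : Kp].
Proof.
apply/maximal_idealP; split; [exact: zero_ideal|exact: completion_1neq0|].
by move=> z /completion_field[t e]; exists t; rewrite /= e subrr.
Qed.

Lemma completion_neq0M z t : z <> 0 -> z * t = 0 -> t = 0.
Proof. by move=> /completion_field[s e] zt; rewrite -[t]mul1r -e mulrAC zt mul0r. Qed.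

Lemma cvset0_approx (k : nat) z : cvset 0 z -> exists a, cvset k (z - iota a%:F).
Proof.
move=> hz; have [x hx] := cvset_approx k z.
have : vset 0 x.
  apply/cvset_iota; rewrite -(subKr z (iota x)); apply: cvsetB => //.
  by apply: cvset_le hx.
move=> /(vset0_approx hA p0 k)[a ha]; exists a.
rewrite -(subrK (iota x) z) -addrA -rmorphB; apply: cvsetD => //.
exact/cvset_iota.
Qed.

End PadicCompletion.

(** * Tensor products *)

Lemma tensor_lift_exists (R : Type) (M N V : zmodType) (aM : R -> M -> M)
    (aN : R -> N -> N) (f : M -> N -> V) :
  (forall x x' y, f (x + x') y = f x y + f x' y) ->
  (forall x y y', f x (y + y') = f x y + f x y') ->
  (forall r x y, f (aM r x) y = f x (aN r y)) ->
  exists F : {additive tensor aM aN -> V}, forall x y, F (pure aM aN x y) = f x y.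
Proof.
move=> fDl fDr fZ.
have f0 y : f 0 y = 0 by apply: (addIr (f 0 y)); rewrite add0r -fDl add0r.
pose ev s := \sum_(x <- s) f x.1 x.2.
have ev_eq s t : tensor_eq aM aN s t -> ev s = ev t.
  rewrite /ev; elim=> {s t} //.
  - by move=> s t u _ -> _ ->.
  - by move=> s s' t t' _ e _ e'; rewrite !big_cat /= e e'.
  - by move=> s t; rewrite !big_cat /= addrC.
  - by move=> y; rewrite big_seq1 big_nil.
  - by move=> x x' y; rewrite !big_cons big_nil /= !addr0 fDl.
  - by move=> x y y'; rewrite !big_cons big_nil /= !addr0 fDr.
  - by move=> r x y; rewrite !big_seq1 fZ.
pose F (u : tensor aM aN) := ev (repr u).
have FE s : F (tensor_pi aM aN s) = ev s by apply: ev_eq; apply: repr_tensor.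
have FD u v : F (u + v) = F u + F v.
  have [[s ->] [t ->]] := (tensor_pi_surj u, tensor_pi_surj v).
  by rewrite -tensor_pi_cat !FE /ev big_cat.
have FB : zmod_morphism F.
  by move=> u v; apply: (addIr (F v)); rewrite -FD !subrK.
pose aF := GRing.isZmodMorphism.Build _ _ F FB.
exists (HB.pack_for {additive tensor aM aN -> V} F aF) => x y /=.
by rewrite FE /ev big_seq1.
Qed.

Section TensorAlgebraMaps.
Variables (R S T : comPzRingType) (f : {rmorphism R -> S}) (g : {rmorphism R -> T}).
Local Notation ST := (tensor_alg f g).
Local Notation pure := (@pure R S T (fun r x => f r * x) (fun r y => g r * y)).

Definition tensor_inl (x : S) : ST := pure x 1.

Fact tensor_inl_zmod : zmod_morphism tensor_inl.
Proof.
move=> y y'; apply: (addIr (tensor_inl y')).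
by rewrite subrK -[LHS]pureDl subrK.
Qed.
Fact tensor_inl_monoid : monoid_morphism tensor_inl.
Proof. by split=> // y y'; rewrite -[RHS]/(tensor_mul _ _) tensor_mul_pure mul1r. Qed.
HB.instance Definition _ :=
  GRing.isZmodMorphism.Build S ST tensor_inl tensor_inl_zmod.
HB.instance Definition _ :=
  GRing.isMonoidMorphism.Build S ST tensor_inl tensor_inl_monoid.

Lemma pureE x y : pure x y = tensor_inl x * tensor_inr f g y :> ST.
Proof. by rewrite -[RHS]/(tensor_mul _ _) tensor_mul_pure mulr1 mul1r. Qed.

Lemma tensor_inl_base r : tensor_inl (f r) = tensor_inr f g (g r).
Proof.
rewrite /tensor_inl /tensor_inr -{1}[f r]mulr1 -[g r]mulr1.
exact: (pure_act (fun r x => f r * x) (fun r y => g r * y)).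
Qed.

Lemma tensor_alg_ind (Q : ST -> Prop) :
  (forall x y, Q (tensor_inl x * tensor_inr f g y)) ->
  (forall u v, Q u -> Q v -> Q (u + v)) -> forall u, Q u.
Proof.
by move=> Qp QD; apply: tensor_ind => // x y; rewrite pureE.
Qed.

Lemma tensor_alg_lift (V : comPzRingType) (a : {rmorphism S -> V})
    (b : {rmorphism T -> V}) : (forall r, a (f r) = b (g r)) ->
  exists F : {rmorphism ST -> V},
    forall x y, F (tensor_inl x * tensor_inr f g y) = a x * b y.
Proof.
move=> ab.
have [|||F FE] := @tensor_lift_exists R S T V (fun r x => f r * x)
    (fun r y => g r * y) (fun x y => a x * b y).
- by move=> x x' y; rewrite rmorphD mulrDl.
- by move=> x y y'; rewrite rmorphD mulrDr.
- by move=> r x y; rewrite !rmorphM ab mulrAC mulrC.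
have FM : monoid_morphism (F : ST -> V).
  split=> [|u v]; first by rewrite -[1]/(pure 1 1) FE !rmorph1 mulr1.
  elim/tensor_alg_ind: u => [x y|u u' IH IH']; last first.
    by rewrite mulrDl !raddfD IH IH' mulrDl.
  elim/tensor_alg_ind: v => [x' y'|v v' IH IH']; last first.
    by rewrite mulrDr !raddfD IH IH' mulrDr.
  rewrite mulrACA -!rmorphM -!pureE !FE !rmorphM; ring.
exists (HB.pack_for {rmorphism ST -> V} (F : ST -> V) (GRing.isMonoidMorphism.Build _ _ (F : ST -> V) FM)
  (GRing.isZmodMorphism.Build _ _ (F : ST -> V) (raddfB F))) => x y /=.
by rewrite -pureE FE.
Qed.

End TensorAlgebraMaps.

(** The ring (S (x)_R k) (x)_k k' has the universal property of S (x)_R k'. *)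
Section TensorTower.
Variables (R S k k' : comPzRingType) (f : {rmorphism R -> S}) (h : {rmorphism R -> k})
  (e : {rmorphism k -> k'}).
Local Notation T := (tensor_alg (tensor_inr f h) e).

Definition tower_inl : {rmorphism S -> T} :=
  tensor_inl (tensor_inr f h) e \o tensor_inl f h.
Definition tower_inr : {rmorphism k' -> T} := tensor_inr (tensor_inr f h) e.

Lemma tower_base r : tower_inl (f r) = tower_inr (e (h r)).
Proof.
exact: etrans (congr1 (tensor_inl _ _) (tensor_inl_base f h r))
              (tensor_inl_base (tensor_inr f h) e (h r)).
Qed.

Lemma tower_ind (Q : T -> Prop) : (forall s y, Q (tower_inl s * tower_inr y)) ->
  (forall u v, Q u -> Q v -> Q (u + v)) -> forall t, Q t.
Proof.
move=> Qp QD; elim/tensor_alg_ind => [u y|u v]; last exact: QD.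
elim/tensor_alg_ind: u => [s c|u v Qu Qv]; last first.
  by rewrite rmorphD mulrDl; apply: QD.
rewrite (rmorphM (tensor_inl _ e)) -mulrA.
rewrite [X in _ * (X * _)](tensor_inl_base (tensor_inr f h) e c).
by rewrite -(rmorphM (tensor_inr _ e)); apply: Qp.
Qed.

Lemma tower_lift (V : comPzRingType) (a : {rmorphism S -> V}) (b : {rmorphism k' -> V}) :
  (forall r, a (f r) = b (e (h r))) -> exists F : {rmorphism T -> V},
  (forall s, F (tower_inl s) = a s) /\ forall y, F (tower_inr y) = b y.
Proof.
move=> ab; have [F1 F1E] := @tensor_alg_lift _ _ _ f h V a (b \o e) ab.
have [|F FE] := @tensor_alg_lift _ _ _ (tensor_inr f h) e V F1 b.
  by move=> c; have := F1E 1 c; rewrite !rmorph1 !mul1r.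
exists F; split=> [s|y]; last by have := FE 1 y; rewrite !rmorph1 !mul1r.
have := FE (tensor_inl f h s) 1; rewrite !rmorph1 !mulr1 => ->.
by have := F1E s 1; rewrite !rmorph1 !mulr1.
Qed.

End TensorTower.

(** * Reduced zero-dimensional rings *)

Section Semisimple.
Variable T : comPzRingType.
Implicit Types (x y e : T) (I J : set T).

Definition reduced_ring := forall x, x * x = 0 -> x = 0.

(** Strong pi-regularity: the powers of every x generate a stationary chain. *)
Definition pi_regular := forall x, exists j y, x ^+ j * (1 - x * y) = 0.

Lemma reduced_exp x n : reduced_ring -> x ^+ n.+1 = 0 -> x = 0.
Proof.
move=> redT; elim: n => [//|n IHn] xn; apply: IHn; apply: redT.
by rewrite -exprD addSnnS exprD xn mulr0.
Qed.

Lemma von_neumann x : reduced_ring -> pi_regular -> exists y, x = x * x * y.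
Proof.
move=> redT preg; have [j [y e]] := preg x; exists y.
apply/eqP; rewrite -subr_eq0; apply/eqP; apply: (@reduced_exp _ j redT).
have -> : x - x * x * y = x * (1 - x * y) by ring.
by rewrite exprMn exprSr (exprS (1 - _)) mulrACA e mul0r.
Qed.

(** If x = x x y then f = x y is an idempotent which generates the ideal of x, and two
    idempotents e and f generate the same ideal as e + f - e f. *)
Lemma idempotent_generator n (b : 'I_n -> T) : reduced_ring -> pi_regular ->
  exists e, [/\ ideal_gen (range b) e, e * e = e & forall i, b i * e = b i].
Proof.
move=> redT preg; elim: n b => [|n IHn] b.
  by exists 0; split=> [||[]//]; [apply: ideal0; apply: ideal_gen_ideal|rewrite mul0r].
have hb := ideal_gen_ideal (range b).
have [e [Ie ee be]] := IHn (fun i => b (lift ord0 i)).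
have [y by_] := von_neumann (b ord0) redT preg.
set x := b ord0 in by_; pose f := x * y.
have xf : x * f = x by rewrite /f mulrA.
have ff : f * f = f by rewrite {1}/f mulrAC xf.
exists (e + f - e * f); split.
- have Ie' : ideal_gen (range b) e.
    by move: e Ie {ee be}; apply: ideal_gen_sub => // _ [i _ <-]; apply: ideal_genS; exists (lift ord0 i).
  have If : ideal_gen (range b) f.
    by apply: (ideal_mulr _ hb); apply: ideal_genS; exists ord0.
  by apply: (idealB hb); [apply: (idealD hb)|apply: (ideal_mull _ hb)].
- have -> : (e + f - e * f) * (e + f - e * f) =
    e * e + f * f + e * e * (f * f) + (e * f) *+ 2 - (e * e * f) *+ 2 - (e * (f * f)) *+ 2.
    by ring.
  by rewrite ee ff; ring.
move=> i; case: (unliftP ord0 i) => [j|] ->.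
  have -> : b (lift ord0 j) * (e + f - e * f) =
    b (lift ord0 j) * e + f * (b (lift ord0 j) - b (lift ord0 j) * e) by ring.
  by rewrite be subrr mulr0 addr0.
have -> : b ord0 * (e + f - e * f) = x * f + e * (x - x * f) by rewrite -/x; ring.
by rewrite xf subrr mulr0 addr0.
Qed.

Lemma semisimple_of_idempotent : (forall I, is_ideal I ->
  exists e, [/\ I e, e * e = e & forall x, I x -> x * e = x]) -> semisimple T.
Proof.
move=> H I hI; have [e [Ie ee eI]] := H I hI.
exists [set x | x * e = 0]; split.
- split=> [|x y xe ye|a x xe] /=; first by rewrite mul0r.
    by rewrite mulrDl xe ye addr0.
  by rewrite -mulrA xe mulr0.
- apply/seteqP; split=> [x [/eI {2}<-]//|_ -> /=].
  by split; [apply: ideal0|rewrite mul0r].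
by move=> x; exists (x * e); [apply: ideal_mull|rewrite /= mulrBl -mulrA ee subrr].
Qed.

Lemma semisimple_idempotent I : semisimple T -> is_ideal I ->
  exists e, [/\ I e, e * e = e & forall x, I x -> x * e = x].
Proof.
move=> ssT hI; have [J [hJ IJ0 IJT]] := ssT I hI.
have [e Ie Je] := IJT 1; exists e.
have eI x : I x -> x * e = x.
  move=> Ix; apply/eqP; rewrite eq_sym -subr_eq0; apply/eqP.
  suff : (I `&` J) (x - x * e) by rewrite IJ0.
  split; first by apply: idealB => //; apply: ideal_mulr.
  by rewrite -{1}[x]mulr1 -mulrBr; apply: ideal_mull.
by split=> //; apply: eI.
Qed.

Lemma semisimple_reduced : reduced_ring -> pi_regular -> noetherian T -> semisimple T.
Proof.
move=> redT preg nT; apply: semisimple_of_idempotent => I hI.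
have [n [b eI]] := nT I hI.
have [e [Ie ee be]] := idempotent_generator b redT preg.
exists e; split=> //; first by rewrite eI.
move=> x; rewrite eI => /ideal_gen_rangeP[c ->].
by rewrite mulr_suml; apply: eq_bigr => i _; rewrite -mulrA be.
Qed.

End Semisimple.

(** * The algebra over the completion *)

Section CompletedAlgebra.
Variable A : idomainType.
Hypothesis hA : dedekind A.
Variable p : spec A.
Hypothesis p0 : spec_set p <> [set 0].
Variable L : fieldExtType {fraction A}.
Local Notation K := {fraction A}.
Local Notation "a %:F" := (@FracField.tofrac A a).
Local Notation Kp := (completion (padic p)).
Local Notation iota := (to_completion (padic p)).
Local Notation V := (tensor_alg (in_alg L) iota).
Local Notation iL := (tensor_inl (in_alg L) iota).
Local Notation iK := (tensor_inr (in_alg L) iota).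
Local Notation cvset := (@cvset A p).
Local Notation n := (\dim {:L}).

Lemma iL_scale (c : K) x : iL (c *: x) = iK (iota c) * iL x.
Proof. by rewrite -tensor_inl_base -rmorphM /= mulr_algl. Qed.

(** Linear forms extend to K_p-linear forms on V; the coordinate forms of a basis of L
    then give coordinates on V. *)
Lemma scalar_extension (f : {scalar L}) : exists F : {additive V -> Kp},
  forall x z, F (iL x * iK z) = iota (f x) * z.
Proof.
have [|||F FE] := @tensor_lift_exists K L Kp Kp (fun r x => in_alg L r * x)
    (fun r y => iota r * y) (fun x z => iota (f x) * z).
- by move=> x x' z; rewrite linearD rmorphD mulrDl.
- by move=> x z z'; rewrite mulrDr.
- by move=> r x z; rewrite /= mulr_algl linearZ rmorphM mulrAC mulrC.
by exists F => x z; rewrite -pureE FE.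
Qed.

Lemma scalar_extension_mull (f : {scalar L}) (F : {additive V -> Kp}) :
  (forall x z, F (iL x * iK z) = iota (f x) * z) ->
  forall z v, F (iK z * v) = z * F v.
Proof.
move=> FE z v; elim/tensor_alg_ind: v => [x t|v w IH IH'].
  by rewrite mulrCA -rmorphM !FE mulrCA.
by rewrite mulrDr !raddfD IH IH' mulrDr.
Qed.

Lemma completed_coef_eq0 m (b : 'I_m -> L) (z : 'I_m -> Kp) : linearly_free b ->
  \sum_i iL (b i) * iK (z i) = 0 -> forall i, z i = 0.
Proof.
move=> fb zb i; pose X := [tuple b j | j < m].
have frX : free X.
  apply/freeP => k ek j; apply: (fb k); apply: etrans ek.
  by apply: eq_bigr => l _; rewrite (nth_map j) ?size_enum_ord// nth_ord_enum.
have [F FE0] := scalar_extension (coord X i).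
have FE x t : F (iL x * iK t) = iota (coord X i x) * t := FE0 x t.
have := congr1 F zb; rewrite raddf0 raddf_sum (bigD1 i)//= FE.
have cX j : coord X i (b j) = (j == i)%:R.
  by rewrite -(coord_free j i frX) (nth_map j) ?size_enum_ord// nth_ord_enum.
rewrite cX eqxx rmorph1 mul1r big1 ?addr0// => j ji.
by rewrite FE cX (negbTE ji) rmorph0 mul0r.
Qed.

Lemma completed_coords : exists F : 'I_n -> V -> Kp,
  [/\ forall j x z, F j (iL x * iK z) = iota (coord (vbasis {:L}) j x) * z,
      forall j u v, F j (u + v) = F j u + F j v,
      forall j z v, F j (iK z * v) = z * F j v
    & forall v, v = \sum_(j < n) iL (vbasis {:L})`_j * iK (F j v)].
Proof.
have /choice[F FE] : forall j : 'I_n, exists F : {additive V -> Kp},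
    forall x z, F (iL x * iK z) = iota (coord (vbasis {:L}) j x) * z.
  by move=> j; apply: (scalar_extension (coord (vbasis {:L}) j)).
exists (fun j => F j); split.
- exact: FE.
- by move=> j u v; rewrite raddfD.
- by move=> j; apply: (scalar_extension_mull (FE j)).
elim/tensor_alg_ind => [x z|u v IH IH'].
  rewrite [in LHS](coord_vbasis (memvf x)) rmorph_sum mulr_suml.
  apply: eq_bigr => j _; rewrite FE /= iL_scale -mulrA mulrCA; congr (_ * _).
  by rewrite rmorphM.
rewrite [LHS](congr2 +%R IH IH') -big_split /=; apply: eq_bigr => j _.
by rewrite raddfD rmorphD mulrDr.
Qed.

Lemma completed_span (b : 'I_n -> L) : linearly_free b ->
  forall v, exists z : 'I_n -> Kp, v = \sum_i iL (b i) * iK (z i).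
Proof.
move=> fb; elim/tensor_alg_ind => [x z|u v [z ->] [t ->]].
  have [c ->] := linearly_free_full fb erefl x.
  exists (fun i => iota (c i) * z); rewrite rmorph_sum mulr_suml.
  by apply: eq_bigr => i _; rewrite /= iL_scale rmorphM mulrAC mulrA mulrC mulrA.
exists (fun i => z i + t i); rewrite -big_split; apply: eq_bigr => i _ /=.
by rewrite rmorphD mulrDr.
Qed.

(** The first n + 1 powers of v are dependent over the field K_p; divide a relation by
    the lowest power of v with a nonzero coefficient. *)
Lemma completed_pi_regular : pi_regular V.
Proof.
move=> v; have [F [_ FD Fz Fv]] := completed_coords.
have F0 j : F j 0 = 0 by apply: (addIr (F j 0)); rewrite add0r -FD add0r.
have [c [[i0 ci0] hc]] := residual_dependence (completion_maximal hA p0)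
  (fun (i : 'I_n.+1) j => F j (v ^+ i)) (ltnSn n).
have sc : \sum_i iK (c i) * v ^+ i = 0.
  rewrite [LHS]Fv big1// => j _.
  suff -> : F j (\sum_i iK (c i) * v ^+ i) = 0 by rewrite rmorph0 mulr0.
  rewrite -[RHS](hc j); elim: (index_enum _) => [|i s IHs]; first by rewrite !big_nil F0.
  by rewrite !big_cons FD Fz IHs.
have [[i [y [ci e]]]|h] := pselect (exists (i : 'I_n.+1) y, iK (c i) <> 0 /\
    \sum_j iK (c j) * v ^+ j - v ^+ i * (iK (c i) + v * y) = 0).
  have [d ed] : exists d, c i * d = 1.
    by apply: (completion_field hA p0) => c0; apply: ci; rewrite c0 rmorph0.
  exists i, (- y * iK d); move: e; rewrite sc sub0r => /eqP; rewrite oppr_eq0 => /eqP e.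
  have -> : 1 - v * (- y * iK d) = iK d * (iK (c i) + v * y).
    have : iK (c i) * iK d = 1 by rewrite -rmorphM ed rmorph1.
    by move=> <-; ring.
  by rewrite mulrCA e mulr0.
exists 0%N, 0; rewrite mulr0 subr0 mulr1 expr0.
have ci1 : exists d, c i0 * d = 1 by apply: (completion_field hA p0).
have iK0 : iK (c i0) = 0.
  apply: contrapT => nz; apply: h.
  have [|i [y [h1 h2]]] := @sum_lowest V [set 0] _ (fun i => iK (c i)) v (@zero_ideal V).
    by exists i0.
  by exists i, y.
by have [d ed] := ci1; rewrite -(rmorph1 iK) -ed rmorphM /= iK0 mul0r.
Qed.

Lemma completed_noetherian : noetherian V.
Proof.
move=> I hI; have [F [_ FD Fz Fv]] := completed_coords.
have F0 j : F j 0 = 0 by apply: (addIr (F j 0)); rewrite add0r -FD add0r.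
have Fs j m (c : 'I_m -> Kp) (b : 'I_m -> V) :
    F j (\sum_i iK (c i) * b i) = \sum_i c i * F j (b i).
  by elim: (index_enum _) => [|i s IHs]; rewrite ?big_nil ?F0// !big_cons FD Fz IHs.
have zV := @zero_ideal V.
have [|d b _|d [b [Ib sb _]]] := residual_basis_exists
  (completion_maximal hA p0) (h := iK) (n := n) hI zV.
- by move=> a y -> _; rewrite rmorph0 mul0r.
- move=> fb; rewrite leqNgt; apply/negP => lt_nd.
  have [c [[i ci] hc]] := residual_dependence (completion_maximal hA p0)
    (fun i j => F j (b i)) lt_nd.
  apply: ci; apply: fb; rewrite /= [LHS]Fv big1// => j _.
  by rewrite Fs (hc j) rmorph0 mulr0.
exists d, b; apply/seteqP; split=> [y Iy|]; last first.
  by apply: ideal_gen_sub => // _ [i _ <-].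
have [c /eqP] := sb y Iy; rewrite subr_eq0 => /eqP ->.
by apply/ideal_gen_rangeP; exists (fun i => iK (c i)).
Qed.

End CompletedAlgebra.

(** * Semisimplicity and finiteness of the integral closure *)

Section Core.
Variable A : idomainType.
Hypothesis hA : dedekind A.
Variable p : spec A.
Hypothesis p0 : spec_set p <> [set 0].
Variable L : fieldExtType {fraction A}.
Local Notation K := {fraction A}.
Local Notation "a %:F" := (@FracField.tofrac A a).
Local Notation Kp := (completion (padic p)).
Local Notation iota := (to_completion (padic p)).
Local Notation V := (tensor_alg (in_alg L) iota).
Local Notation iL := (tensor_inl (in_alg L) iota).
Local Notation iK := (tensor_inr (in_alg L) iota).
Local Notation cvset := (@cvset A p).
Local Notation vset := (@vset A p).
Local Notation n := (\dim {:L}).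
Local Notation B := (integral_closure L).
Local Notation tc := (to_closure L).
Local Notation te := (to_ext L).
Local Notation cv := (closure_val L).
Local Notation extend := (@extend_ideal A L).
Implicit Types (M : set L) (v : V) (k : int).

Let mp := spec_maximal hA p0.

(** The additive subgroup generated by M times the k-th power of the maximal
    ideal of the valuation ring of the completion. *)
Definition vspan M k : set V := [set v | forall S : set V, S 0 ->
  (forall u v, S u -> S v -> S (u + v)) ->
  (forall x z, M x -> cvset k z -> S (iL x * iK z)) -> S v].

Lemma vspan0 M k : vspan M k 0. Proof. by move=> S. Qed.

Lemma vspanD M k u v : vspan M k u -> vspan M k v -> vspan M k (u + v).
Proof. by move=> hu hv S S0 SD SM; exact: SD (hu S S0 SD SM) (hv S S0 SD SM). Qed.

Lemma vspan_pure M k x z : M x -> cvset k z -> vspan M k (iL x * iK z).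
Proof. by move=> Mx kz S _ _; apply. Qed.

Lemma vspan_sum M k T (r : seq T) (f : T -> V) :
  (forall i, vspan M k (f i)) -> vspan M k (\sum_(i <- r) f i).
Proof.
move=> h; elim/big_rec: _ => [|i v _ hv]; first exact: vspan0.
by apply: vspanD => //; apply: h.
Qed.

Lemma vspanN M k v : vspan M k v -> vspan M k (- v).
Proof.
move/(_ [set v | vspan M k (- v)]); apply.
- by rewrite /= oppr0.
- by move=> u w /= hu hw; rewrite opprD; apply: vspanD.
move=> x z Mx kz /=; rewrite -mulrN -rmorphN; apply: vspan_pure => //.
exact: (cvsetN hA p0).
Qed.

Lemma vspan_le M j k v : j <= k -> vspan M k v -> vspan M j v.
Proof.
move=> jk /(_ (vspan M j)); apply; [exact: vspan0|exact: vspanD|].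
by move=> x z Mx /(cvset_le hA p0 jk); apply: vspan_pure.
Qed.

Lemma vspanM M M' M'' j k u v : (forall x y, M x -> M' y -> M'' (x * y)) ->
  vspan M j u -> vspan M' k v -> vspan M'' (j + k) (u * v).
Proof.
move=> MM /(_ [set u | vspan M'' (j + k) (u * v)]) + hv; apply.
- by rewrite /= mul0r.
- by move=> u1 u2 /= h1 h2; rewrite mulrDl; apply: vspanD.
move=> x z Mx jz /=.
move: hv => /(_ [set v | vspan M'' (j + k) (iL x * iK z * v)]); apply.
- by rewrite /= mulr0.
- by move=> u1 u2 /= h1 h2; rewrite mulrDr; apply: vspanD.
move=> y t My kt /=; rewrite mulrACA -!rmorphM; apply: vspan_pure; first exact: MM.
exact: (cvsetM hA p0).
Qed.

Lemma vspan_family M k v : vspan M k v -> exists m (x : 'I_m -> L) (z : 'I_m -> Kp),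
  [/\ forall i, M (x i), forall i, cvset k (z i) & v = \sum_i iL (x i) * iK (z i)].
Proof.
move/(_ [set v | exists m (x : 'I_m -> L) (z : 'I_m -> Kp),
  [/\ forall i, M (x i), forall i, cvset k (z i) & v = \sum_i iL (x i) * iK (z i)]]).
apply.
- by exists 0%N, (fun=> 0), (fun=> 0); split=> [[]|[]|]; rewrite ?big_ord0.
- move=> _ _ [m [x [z [Mx kz ->]]]] [m' [x' [z' [Mx' kz' ->]]]].
  exists (m + m')%N, (fcat x x'), (fcat z z'); split; try exact: forall_fcat.
  by rewrite (sum_fcat (fun x z => iL x * iK z)).
move=> x z Mx kz; exists 1%N, (fun=> x), (fun=> z); split=> //.
by rewrite big_ord1.
Qed.

(** The case where M is the integral closure of A in L. *)
Definition integral_set : set L := [set x | exists b, x = cv b].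
Local Notation W := (vspan integral_set).

Lemma WM j k u v : W j u -> W k v -> W (j + k) (u * v).
Proof.
by apply: vspanM => _ _ [b ->] [b' ->]; exists (b * b'); rewrite rmorphM.
Qed.

Lemma W_integral b : W 0 (iL (cv b)).
Proof.
rewrite -[iL _]mulr1 -(rmorph1 iK); apply: vspan_pure; first by exists b.
rewrite -(rmorph1 iota) (cvset_iota hA p0) -(@tofrac1 A); exact: vset0_tofrac.
Qed.

Lemma W_exists v : exists k, W k v.
Proof.
elim/tensor_alg_ind: v => [x z|u v [j hu] [k hv]]; last first.
  exists (Num.min j k); apply: vspanD; [apply: vspan_le hu|apply: vspan_le hv]; lia.
have [a [b [a0 e]]] := integral_closure_span x.
have [k hk] := cvset_exists hA p0 (iota (a%:F)^-1 * z); exists k.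
have -> : iL x * iK z = iL (cv b) * iK (iota (a%:F)^-1 * z).
  rewrite e iL_scale rmorphM mulrACA -!rmorphM divff ?tofrac_eq0//.
  by rewrite !rmorph1 mul1r.
by apply: vspan_pure => //; exists b.
Qed.

Lemma W_extend (k : nat) b : extend (idealX p k) b -> W k (iL (cv b)).
Proof.
move: b; apply: (@ideal_gen_sub _ _ [set b | W k (iL (cv b))]).
  split=> [|b b' /= hb hb'|a b /= hb]; rewrite /= ?rmorph0 ?rmorphD ?rmorphM.
  - exact: vspan0.
  - exact: vspanD.
  - by rewrite -[k%:Z]add0r; apply: WM => //; apply: W_integral.
move=> _ [a pa <-]; change (W k (iL (te a))); rewrite to_extE iL_scale rmorph1 mulr1.
rewrite -[iK _]mul1r -(rmorph1 iL) -(rmorph1 cv); apply: vspan_pure; first by exists 1.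
by apply/cvset_iota => //; apply/vset_tofrac.
Qed.

(** The elements of V which are infinitely divisible by p inside the lattice W 0. *)
Definition divisible : set V := [set v | forall k, W k v].

Lemma divisible_ideal : is_ideal divisible.
Proof.
split=> [k|u v hu hv k|u v hv k]; first exact: vspan0.
  by apply: vspanD; [apply: hu|apply: hv].
have [j hj] := W_exists u; rewrite -(subrKC j k); apply: WM => //; exact: hv.
Qed.

(** Finitely many integral elements stabilize a finitely generated A-module; what
    matters below is that its coordinates are bounded at p. *)
Definition bounded M := exists k, forall x, M x ->
  forall j : 'I_n, vset k (coord (vbasis {:L}) j x).

Lemma bounded_mul M y : bounded M -> bounded [set y * x | x in M].
Proof.
move=> [k hk].
have [m hm] : exists m, forall j l : 'I_n,
    vset m (coord (vbasis {:L}) j (y * (vbasis {:L})`_l)).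
  have /choice[f hf] : forall jl : 'I_n * 'I_n, exists m,
      vset m (coord (vbasis {:L}) jl.1 (y * (vbasis {:L})`_jl.2)).
    by move=> jl; apply: vset_exists.
  exists (- (\max_jl `|f jl|%N)%:Z) => j l; apply: vset_le (hf (j, l)).
  by have := leq_bigmax (F := fun jl => `|f jl|%N) (j, l); lia.
exists (k + m) => _ [x Mx <-] j.
rewrite [X in y * X](coord_vbasis (memvf x)) mulr_sumr linear_sum.
apply: (vset_sum hA p0) => l _; rewrite -scalerAr linearZ.
by apply: (vsetM hA); [apply: hk|apply: hm].
Qed.

Lemma bounded_sum d (M : 'I_d -> set L) : (forall i, bounded (M i)) ->
  bounded [set x | exists2 y : 'I_d -> L, (forall i, M i (y i)) & x = \sum_i y i].
Proof.
move=> /choice[f hf]; exists (- (\max_i `|f i|%N)%:Z) => _ [y My ->] j.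
rewrite linear_sum; apply: (vset_sum hA p0) => i _; apply: vset_le (hf i _ (My i) j).
by have := leq_bigmax (F := fun i => `|f i|%N) i; lia.
Qed.

Definition stable_module M := [/\ M 1, forall x y, M x -> M y -> M (x + y),
  forall a x, M x -> M (te a * x) & bounded M].

(** M' is the set of values at b of the polynomials with coefficients in M. *)
Lemma stable_module_adjoin M b : stable_module M -> exists M', [/\ stable_module M',
  forall x, M' x -> M' (cv b * x) &
  forall y, (forall x, M x -> M (y * x)) -> forall x, M' x -> M' (y * x)].
Proof.
move=> [M1 MD MA Mb].
have M0 : M 0 by rewrite -(mul0r 1) -(rmorph0 te); apply: MA.
have [q mq rq] := integral_closureP b.
pose M' := [set x | exists2 P : {poly L}, (forall i, M P`_i) & x = P.[cv b]].
(* Reducing modulo q: only polynomials of degree less than that of q matter. *)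
have red (P : {poly L}) : (forall i, M P`_i) -> exists2 Q : {poly L}, (forall i, M Q`_i) &
    (size Q <= (size q).-1)%N /\ P.[cv b] = Q.[cv b].
  elim: (size P) {-2}P (leqnn (size P)) => {P} [|s IHs] P sP MP.
    by exists P => //; split=> //; move: sP; rewrite leqn0 => /eqP ->.
  have [?|lt_qP] := leqP (size P) (size q).-1; first by exists P.
  have [sPs|lt_sP] := leqP (size P) s; first exact: IHs.
  have {sP lt_sP}eP : size P = s.+1 by apply/eqP; rewrite eqn_leq sP lt_sP.
  have qs : ((size q).-1 <= s)%N by rewrite -ltnS -eP.
  pose q' := map_poly te q; set e := (s - (size q).-1)%N.
  pose P1 := P - P`_s *: ('X^e * q').
  have cX i : ('X^e * q')`_i = if (i < e)%N then 0 else te q`_(i - e).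
    by rewrite coefXnM coef_map.
  have [||Q MQ [sQ eQ]] := IHs P1.
  - apply/leq_sizeP => j sj; rewrite coefB coefZ cX.
    rewrite ltnNge (leq_trans (leq_subr _ _) sj) /=.
    move: sj; rewrite leq_eqVlt => /predU1P[<-|sj].
      rewrite subKn//; move/monicP: mq; rewrite lead_coefE => ->.
      by rewrite rmorph1 mulr1 subrr.
    rewrite [P`_j]nth_default ?eP// [q`_ _]nth_default ?rmorph0 ?mulr0 ?subr0//.
    by rewrite /e; move: qs sj; clear; case: (size q) => [|z] /=; lia.
  - move=> i; rewrite coefB coefZ cX; apply: MD => //.
    case: ifP => _; first by rewrite mulr0 oppr0.
    by rewrite -mulrN -rmorphN mulrC; apply: MA.
  exists Q => //; split=> //; rewrite -eQ /P1 hornerD hornerN hornerZ hornerM.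
  by rewrite (rootP rq) !mulr0 oppr0 addr0.
exists M'; split; first split.
- exists 1; last by rewrite hornerC.
  by move=> i; rewrite coef1; case: (i == 0%N).
- move=> _ _ [P MP ->] [Q MQ ->]; exists (P + Q); last by rewrite hornerD.
  by move=> i; rewrite coefD; apply: MD.
- move=> a _ [P MP ->]; exists (te a *: P); last by rewrite hornerZ.
  by move=> i; rewrite coefZ; apply: MA.
- have [|k hk] := @bounded_sum (size q).-1 (fun i => [set cv b ^+ i * x | x in M]).
    by move=> i; apply: bounded_mul.
  exists k => _ [P /red[Q MQ [sQ ->]] ->]; apply: hk.
  exists (fun i => cv b ^+ i * Q`_i) => [i|]; first by exists Q`_i.
  by rewrite (horner_coef_wide _ sQ); apply: eq_bigr => i _; rewrite mulrC.
- move=> _ [P MP ->]; exists ('X * P); last by rewrite hornerM hornerX.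
  by move=> i; rewrite coefXM; case: (i == 0%N).
- move=> y My _ [P MP ->]; exists (y *: P); last by rewrite hornerZ.
  by move=> i; rewrite coefZ; apply: My.
Qed.

Lemma stable_module_exists m (b : 'I_m -> B) :
  exists2 M, stable_module M & forall i x, M x -> M (cv (b i) * x).
Proof.
elim: m b => [|m IHm] b.
  exists (range te); last by case.
  split=> [|_ _ [a _ <-] [a' _ <-]|a _ [a' _ <-]|].
  - by exists 1; rewrite ?rmorph1.
  - by exists (a + a'); rewrite ?rmorphD.
  - by exists (a * a'); rewrite ?rmorphM.
  have [k hk] : bounded [set (1 : L)].
    have [|k hk] := @bounded_sum 1 (fun=> [set (1 : L)]).
      move=> _; have /choice[f hf] : forall j : 'I_n, exists m,
          vset m (coord (vbasis {:L}) j 1) by move=> j; apply: vset_exists.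
      exists (- (\max_j `|f j|%N)%:Z) => _ -> j; apply: vset_le (hf j).
      by have := leq_bigmax (F := fun j => `|f j|%N) j; lia.
    by exists k => x x1 j; apply: hk; exists (fun=> x) => //; rewrite big_ord1.
  exists k => _ [a _ <-] j; rewrite to_extE linearZ -[k]add0r.
  by apply: (vsetM hA); [apply: vset0_tofrac|apply: hk].
have [M sM Mb] := IHm (fun i => b (lift ord0 i)).
have [M' [sM' M'b M'y]] := stable_module_adjoin (b ord0) sM.
exists M' => // i; case: (unliftP ord0 i) => [j|] ->; last exact: M'b.
by apply: M'y => x; apply: Mb.
Qed.

(** The integral elements which express e as a member of W 1 stabilize a module M, and
    e = e ^ j is a combination of elements of M with coefficients of valuation at
    least j; as M is bounded, the coordinates of e are zero. *)
Lemma idempotent_W1_eq0 e : e * e = e -> W 1 e -> e = 0.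
Proof.
move=> ee /vspan_family[m [x [z [/choice[b hb] hz ex]]]].
have [M [M1 MD MA [k hk]] Mb] := stable_module_exists b.
have eX j : e ^+ j.+1 = e by elim: j => [//|j IHj]; rewrite exprS IHj.
have eW (j : nat) : vspan M j (e ^+ j).
  elim: j => [|j IHj].
    rewrite expr0 -[1]mulr1 -{1}(rmorph1 iL) -(rmorph1 iK); apply: vspan_pure => //.
    by rewrite -(rmorph1 iota) (cvset_iota hA p0) -(@tofrac1 A); apply: vset0_tofrac.
  rewrite exprS {1}ex mulr_suml; apply: vspan_sum => i.
  rewrite -addn1 PoszD addrC; apply: (@vspanM [set x i] M) IHj.
    by move=> _ y -> My; rewrite hb; apply: Mb.
  exact: vspan_pure.
have [F [FE FD _ Fv]] := completed_coords p L.
rewrite [LHS]Fv big1// => j _.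
suff -> : F j e = 0 by rewrite rmorph0 mulr0.
apply: (cvset_sep hA p0) => l.
have := eW `|l%:Z - k|.+1%N; rewrite eX => /(_ [set v | cvset l (F j v)]).
apply.
- rewrite /=; have -> : F j 0 = 0 by apply: (addIr (F j 0)); rewrite add0r -FD add0r.
  exact: cvset0.
- by move=> u v /=; rewrite FD; apply: (cvsetD hA p0).
move=> y t My ht /=; rewrite FE.
apply: (cvset_le hA p0 (k := k + `|l%:Z - k|.+1%:Z)); first by lia.
by apply: (cvsetM hA p0) => //; apply/(cvset_iota hA p0); apply: hk.
Qed.

End Core.

(** * Semisimplicity and the dimension of B / pB *)

Section CoreEquivalence.
Variable A : idomainType.
Hypothesis hA : dedekind A.
Variable p : spec A.
Hypothesis p0 : spec_set p <> [set 0].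
Variable L : fieldExtType {fraction A}.
Local Notation K := {fraction A}.
Local Notation "a %:F" := (@FracField.tofrac A a).
Local Notation Kp := (completion (padic p)).
Local Notation iota := (to_completion (padic p)).
Local Notation V := (tensor_alg (in_alg L) iota).
Local Notation iL := (tensor_inl (in_alg L) iota).
Local Notation iK := (tensor_inr (in_alg L) iota).
Local Notation cvset := (@cvset A p).
Local Notation vset := (@vset A p).
Local Notation n := (\dim {:L}).
Local Notation B := (integral_closure L).
Local Notation tc := (to_closure L).
Local Notation te := (to_ext L).
Local Notation cv := (closure_val L).
Local Notation extend := (@extend_ideal A L).
Local Notation W := (@vspan A p L (@integral_set A L)).
Implicit Types (v : V).

Let mp := spec_maximal hA p0.
Let ip := prime_ideal (specP p).
Let hE : is_ideal (extend p) := ideal_gen_ideal _.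

(** The dimension of B / pB is at most [L : K]; this is the case of equality. *)
Definition full_residual_dim := exists b : 'I_n -> B,
  residual_basis tc p setT (extend p) b.

Lemma extend_mull a (y : B) : spec_set p a -> setT y -> extend p (tc a * y).
Proof. by move=> pa _; apply: extend_ideal_mull. Qed.

Lemma residual_basis_extend : exists d (b : 'I_d -> B),
  residual_basis tc p setT (extend p) b.
Proof.
apply: (closure_residual_basis hA p0); [exact: setT_ideal|exact: hE|exact: extend_mull].
Qed.

Section Divisible.
Variables (d : nat) (b : 'I_d -> B).
Hypothesis hb : residual_basis tc p setT (extend p) b.

(** A residual basis approximates every element modulo pB; this improves an
    approximation modulo p^k B to one modulo p^(k+1) B. *)
Lemma residual_basis_refine k (x : B) : extend (idealX p k) x ->
  exists c : 'I_d -> A, (forall i, idealX p k (c i)) /\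
    extend (idealX p k.+1) (x - \sum_i tc (c i) * b i).
Proof.
have hX := idealX_ideal p k.
have hX1 : is_ideal (extend (idealX p k.+1)) := ideal_gen_ideal _.
suff h : extend (idealX p k) `<=` [set x | forall y, exists c : 'I_d -> A,
    (forall i, idealX p k (c i)) /\
    extend (idealX p k.+1) (y * x - \sum_i tc (c i) * b i)].
  by move=> /h /(_ 1); rewrite mul1r.
apply: ideal_gen_sub.
  split=> [y|x1 x2 h1 h2 y|a x1 h1 y] /=.
  - exists (fun=> 0); split=> [_|]; first exact: ideal0.
    rewrite mulr0 big1 ?subr0; first exact: (ideal0 hX1).
    by move=> i _; rewrite rmorph0 mul0r.
  - have [[c [pc hc]] [c' [pc' hc']]] := (h1 y, h2 y).
    exists (fun i => c i + c' i); split=> [i|]; first exact: idealD.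
    have -> : y * (x1 + x2) - \sum_i tc (c i + c' i) * b i =
        (y * x1 - \sum_i tc (c i) * b i) + (y * x2 - \sum_i tc (c' i) * b i).
      rewrite mulrDr addrACA -opprD -big_split /=; congr (_ - _).
      by apply: eq_bigr => i _; rewrite rmorphD mulrDl.
    exact: (idealD hX1).
  - by rewrite mulrA; apply: h1.
move=> _ [a pa <-] y; have [_ sb _] := hb; have [c hc] := sb y Logic.I.
exists (fun i => a * c i); split=> [i|]; first exact: ideal_mulr.
have -> : y * tc a - \sum_i tc (a * c i) * b i = tc a * (y - \sum_i tc (c i) * b i).
  rewrite mulrBr mulr_sumr mulrC; congr (_ - _).
  by apply: eq_bigr => i _; rewrite rmorphM mulrA.
move: (y - _) hc; apply: ideal_gen_sub; first exact: (ideal_colon _ hX1).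
move=> _ [e pe <-] /=; apply: ideal_genS; exists (e * a); first exact: idealM_in.
by rewrite rmorphM mulrC.
Qed.

Lemma residual_basis_approx (y : B) : exists c : nat -> 'I_d -> A, forall k,
  extend (idealX p k) (y - \sum_i tc (c k i) * b i) /\
  forall i, idealX p k (c k.+1 i - c k i).
Proof.
have /choice[F hF] : forall kc : nat * ('I_d -> A), exists c' : 'I_d -> A,
    extend (idealX p kc.1) (y - \sum_i tc (kc.2 i) * b i) ->
    extend (idealX p kc.1.+1) (y - \sum_i tc (c' i) * b i) /\
    forall i, idealX p kc.1 (c' i - kc.2 i).
  move=> [k c] /=.
  have [h|h] := pselect (extend (idealX p k) (y - \sum_i tc (c i) * b i)); last by exists c.
  have [e [pe he]] := residual_basis_refine h; exists (fun i => c i + e i) => _; split.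
    move: he; congr (extend _ _); rewrite -addrA -opprD -big_split /=; congr (_ - _).
    by apply: eq_bigr => i _; rewrite rmorphD mulrDl.
  by move=> i; rewrite addrAC subrr add0r.
pose c := fix c k := if k is k'.+1 then F (k', c k') else (fun=> 0).
have hc k : extend (idealX p k) (y - \sum_i tc (c k i) * b i).
  elim: k => [|k IHk]; last by have [] := hF (k, c k) IHk.
  suff -> : extend (idealX p 0) = setT by [].
  apply: idealT_eq; first exact: ideal_gen_ideal.
  by apply: ideal_genS; exists 1; rewrite ?rmorph1.
exists c => k; split=> //; by have [_] := hF (k, c k) (hc k).
Qed.

(** If the b i do not span L, some y in B is a K_p-combination of the b i in the
    closure of B without being a K-combination of them; the difference of the two
    is a nonzero divisible element. *)
Lemma divisible_neq0 : (d < n)%N -> exists2 v, v <> 0 & @divisible A p L v.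
Proof.
move=> ltd; have [_ _ fb] := hb.
have lb : linearly_free (cv \o b).
  by apply: (residually_free_linear hA p0 _ fb); apply: ideal0.
have [x nx] := not_spanning (cv \o b) ltd.
have [a [y [a0 ey]]] := integral_closure_span x.
have ny c : cv y <> \sum_i c i *: (cv \o b) i.
  move=> e; apply: (nx (fun i => (a%:F)^-1 * c i)).
  under eq_bigr do rewrite -scalerA.
  by rewrite -scaler_sumr -e ey scalerK// tofrac_eq0.
have [c hc] := residual_basis_approx y.
have /choice[z hz] : forall i, exists z, forall k : nat, cvset k (z - iota (c k i)%:F).
  move=> i; apply: (cvset_limit hA p0) => k; rewrite -tofracB.
  by apply/(vset_tofrac hA p0); case: (hc k).
exists (iL (cv y) - \sum_i iL (cv (b i)) * iK (z i)).
  move=> e.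
  have := @completed_coef_eq0 A p L (d + 1) _ (fcat (fun i => - z i) (fun=> 1))
    (linearly_free_adjoin lb ny).
  rewrite (sum_fcat (fun x z => iL x * iK z)) big_ord1 rmorph1 mulr1 addrC.
  under eq_bigr do rewrite rmorphN mulrN.
  rewrite sumrN => /(_ e)/(_ (rshift d ord0)).
  rewrite fcat_rshift; exact: (completion_1neq0 hA p0).
have key (k : nat) : W k (iL (cv y) - \sum_i iL (cv (b i)) * iK (z i)).
  have -> : iL (cv y) - \sum_i iL (cv (b i)) * iK (z i) =
      iL (cv (y - \sum_i tc (c k i) * b i)) -
      \sum_i iL (cv (b i)) * iK (z i - iota (c k i)%:F).
    rewrite (rmorphB cv) (rmorphB iL) val_to_closure_sum (rmorph_sum iL).
    under [X in _ = _ - _ - X]eq_bigr do rewrite rmorphB mulrBr.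
    have -> : \sum_i iL ((c k i)%:F *: cv (b i)) = \sum_i iL (cv (b i)) * iK (iota (c k i)%:F).
      by apply: eq_bigr => i _; rewrite iL_scale mulrC.
    by rewrite sumrB opprB addrA subrK.
  have [h _] := hc k.
  apply: vspanD; first by apply: W_extend.
  apply: (vspanN hA p0); apply: vspan_sum => i; apply: vspan_pure => //; by exists (b i).
move=> k; apply: (vspan_le hA p0) (key `|k|%N); lia.
Qed.

End Divisible.

(** The ideal of divisible elements is generated by an idempotent, which vanishes; so
    the residual basis spans L. *)
Lemma semisimple_full : semisimple V -> full_residual_dim.
Proof.
move=> ssV; have [d [b hb]] := residual_basis_extend.
have led : (d <= n)%N.
  by have [_ _ fb] := hb; apply: (residually_free_le hA p0 _ fb); apply: ideal0.
move: led; rewrite leq_eqVlt => /predU1P[ed|ltd]; first by subst d; exists b.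
have [v v0 hv] := divisible_neq0 hb ltd.
have [e [De ee eD]] := semisimple_idempotent ssV (divisible_ideal hA p0 L).
case: v0; rewrite -(eD v hv) (idempotent_W1_eq0 hA p0 ee) ?mulr0//.
Qed.

Section Full.
Variable b : 'I_n -> B.
Hypothesis hb : residual_basis tc p setT (extend p) b.

Let lb : linearly_free (cv \o b).
Proof. by have [_ _ fb] := hb; apply: (residually_free_linear hA p0 _ fb); apply: ideal0. Qed.

(** Let e scale the coordinates of y to a primitive family. If they are not all integral
    at p, then e is in the maximal ideal of the valuation ring, so that e y, up to a unit at p,
    is in pB, and its coordinates form a nontrivial relation modulo pB. *)
Lemma full_integral_coords (y : B) : exists c : 'I_n -> K,
  (forall i, vset 0 (c i)) /\ cv y = \sum_i c i *: cv (b i).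
Proof.
have [c ec] := linearly_free_full lb erefl (cv y).
exists c; split=> //; apply: contrapT => /existsNP[l cl].
have cl0 : c l != 0 by apply: contra_notN cl => /eqP ->; left.
have [e e0 [a ha [j pj]]] := primitive_scaling hA p0 (ex_intro _ l cl0).
have e1 : vset 1 e.
  apply: contrapT => /(vset1M hA) h; apply: cl; apply: h; rewrite -ha; exact: vset0_tofrac.
have /(vset0P hA p0)[x [s [ps es]]] : vset 0 e by apply: vset_le e1.
have s0 : s%:F != 0 by rewrite tofrac_eq0 (denom_neq0 ps).
have px : spec_set p x.
  apply/(vset1_tofrac hA p0); rewrite -[x%:F](divfK s0) -es -[1]addr0.
  by apply: (vsetM hA) => //; apply: vset0_tofrac.
have /(_ (fun i => s * a i)) : residually_free tc p (extend p) b by case: hb.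
move=> h; case: (specP p) => _ _ /(_ s (a j)) h'; apply: pj; case: h' => //; apply: h.
have -> : \sum_i tc (s * a i) * b i = tc x * y; last exact: extend_ideal_mull.
apply: closure_val_inj; rewrite val_to_closure_sum val_to_closureM ec scaler_sumr.
apply: eq_bigr => i _; rewrite tofracM ha es scalerA.
by rewrite mulrA (mulrC s%:F) divfK.
Qed.

Lemma full_W_coords k v : W k v -> exists z : 'I_n -> Kp,
  (forall i, cvset k (z i)) /\ v = \sum_i iL (cv (b i)) * iK (z i).
Proof.
move/(_ [set v | exists z : 'I_n -> Kp,
  (forall i, cvset k (z i)) /\ v = \sum_i iL (cv (b i)) * iK (z i)]); apply.
- exists (fun=> 0); split=> [i|]; first exact: cvset0.
  by rewrite big1// => i _; rewrite rmorph0 mulr0.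
- move=> _ _ [z [hz ->]] [t [ht ->]]; exists (fun i => z i + t i); split=> [i|].
    exact: (cvsetD hA p0).
  by rewrite -big_split; apply: eq_bigr => i _ /=; rewrite rmorphD mulrDr.
move=> _ z [y ->] hz; have [c [hc ->]] := full_integral_coords y.
exists (fun i => iota (c i) * z); split=> [i|].
  by rewrite -[k]add0r; apply: (cvsetM hA p0) => //; apply/(cvset_iota hA p0).
rewrite rmorph_sum mulr_suml.
by apply: eq_bigr => i _; rewrite /= iL_scale rmorphM mulrAC mulrA mulrC mulrA.
Qed.

Lemma integral_sqrt x : integralOver te (x * x) -> integralOver te x.
Proof.
move=> ix; apply: (@integral_root_monic _ _ _ _ ('X^2 - (x * x)%:P)).
- by apply: monicXnsubC.
- by rewrite rootE !hornerE expr2 subrr.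
apply/integral_poly => i; rewrite coefB coefXn coefC.
apply: integral_sub; first exact: integral_nat.
by case: ifP => _ //; apply: integral0.
Qed.

(** The square of an element x of the lattice which is not divisible by a
    uniformizer pi is not zero: approximating x by some y in B, the square of
    y / pi would be integral up to a unit at p. *)
Lemma full_reduced : reduced_ring V.
Proof.
move=> v vv; apply: contrapT => v0.
have [z0 ez0] := completed_span lb v.
have [i0 zi0] : exists i, z0 i <> 0.
  apply: contrapT => /forallNP h; apply: v0; rewrite ez0 big1// => i _.
  by rewrite (contrapT (h i)) rmorph0 mulr0.
have [k [hk [i1 ni1]]] := cvset_val hA p0 (ex_intro _ i0 zi0).
pose z i := iota (pi_exp p (- k)) * z0 i.
have hz i : cvset 0 (z i) by rewrite /z -(cvset_scale hA p0) addr0.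
have nz : ~ cvset 1 (z i1) by rewrite /z -(cvset_scale hA p0).
pose u := \sum_i iL (cv (b i)) * iK (z i).
have eu : u = iK (iota (pi_exp p (- k))) * v.
  rewrite ez0 mulr_sumr; apply: eq_bigr => i _.
  by rewrite /z rmorphM mulrCA.
have uu : u * u = 0 by rewrite eu mulrACA vv mulr0.
have /choice[a ha] : forall i, exists a, cvset 2 (z i - iota a%:F).
  by move=> i; apply: (cvset0_approx hA p0 2).
pose y := \sum_i tc (a i) * b i.
pose w := \sum_i iL (cv (b i)) * iK (z i - iota (a i)%:F).
have Wb i t m : cvset m t -> W m (iL (cv (b i)) * iK t).
  by move=> ht; apply: vspan_pure => //; exists (b i).
have ey : iL (cv y) = u - w.
  rewrite /u /w /y val_to_closure_sum rmorph_sum -sumrB; apply: eq_bigr => i _.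
  by rewrite /= iL_scale -mulrBr -rmorphB subKr mulrC.
have W2 : W 2 (iL (cv (y * y))).
  have -> : iL (cv (y * y)) = w * w - (u * w + u * w).
    have -> : iL (cv (y * y)) = iL (cv y) * iL (cv y).
      by rewrite (rmorphM cv) (rmorphM iL).
    rewrite ey.
    have -> : (u - w) * (u - w) = u * u + (w * w - (u * w + u * w)) by ring.
    by rewrite uu add0r.
  have Wu : W 0 u by apply: vspan_sum => i; apply: Wb.
  have Ww : W 2 w by apply: vspan_sum => i; apply: Wb.
  have Wuw : W 2 (u * w) by rewrite -[X in W X _]add0r; apply: (WM hA p0).
  apply: vspanD; last by apply: (vspanN hA p0); apply: vspanD.
  by apply: (vspan_le hA p0 (k := 2 + 2)) => //; apply: (WM hA p0).
have [t [ht et]] := full_W_coords W2.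
have [c ec] := linearly_free_full lb erefl (cv (y * y)).
have hc i : vset 2 (c i).
  suff e : t i - iota (c i) = 0.
    by apply/(cvset_iota hA p0); rewrite -(subr0_eq e).
  move: i; apply: (completed_coef_eq0 lb).
  under eq_bigr do rewrite rmorphB mulrBr.
  rewrite sumrB -et ec rmorph_sum; apply/eqP; rewrite subr_eq0; apply/eqP.
  by apply: eq_bigr => i _; rewrite /= iL_scale mulrC.
have hc' i : vset 0 (pi_exp p (- 2%:Z) * c i) by rewrite -(vsetE hA p0) addr0.
have [s ps [a' ha']] := vset0_common_denominator hA p0 hc'.
pose pi := uniformizer p.
have pi0 : te pi != 0 by rewrite to_ext_eq0 -tofrac_eq0 (uniformizer_neq0 hA p0).
have [x ex] : exists x : B, cv x = te s * cv y / te pi.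
  apply: integral_closure_lift; apply: integral_sqrt.
  have -> : te s * cv y / te pi * (te s * cv y / te pi) =
      cv (tc s * \sum_i tc (a' i) * b i).
    have -> : cv (tc s * \sum_i tc (a' i) * b i) =
        te s * ((s%:F * pi_exp p (- 2%:Z)) *: (cv y * cv y)).
      rewrite rmorphM val_to_closure_sum -rmorphM ec scaler_sumr; congr (_ * _).
      apply: eq_bigr => i _; rewrite scalerA -mulrA ha' [s%:F * _]mulrC divfK//.
      by rewrite tofrac_eq0 (denom_neq0 ps).
    have -> : (s%:F * pi_exp p (- 2%:Z)) *: (cv y * cv y) =
        te s * ((te pi)^-1 * (te pi)^-1) * (cv y * cv y).
      have -> : pi_exp p (- 2%:Z) = (pi%:F * pi%:F)^-1 by rewrite pi_expN.
      rewrite -mulr_algl; congr (_ * _).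
      rewrite -[LHS]/(in_alg L (s%:F * (pi%:F * pi%:F)^-1)) rmorphM fmorphV.
      by rewrite (rmorphM (in_alg L)) invfM.
    by ring.
  exact: integral_closureP.
have : extend p (tc s * y).
  have -> : tc s * y = tc pi * x.
    by apply: closure_val_inj; rewrite !(rmorphM cv) ex [RHS]mulrC divfK.
  by apply: extend_ideal_mull; apply: (uniformizer_in hA p0).
rewrite mulr_sumr => hs.
case: nz; rewrite -(subrK (iota (a i1)%:F) (z i1)); apply: (cvsetD hA p0).
  by apply: (cvset_le hA p0) (ha i1).
apply/(cvset_iota hA p0)/(vset1_tofrac hA p0).
have /(_ (fun i => s * a i)) : residually_free tc p (extend p) b by case: hb.
move=> h; case: (specP p) => _ _ /(_ s (a i1)) h'; case: h' => //; apply: (h _ i1).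
by move: hs; congr (extend _ _); apply: eq_bigr => i _; rewrite rmorphM mulrA.
Qed.

Lemma full_semisimple : semisimple V.
Proof.
apply: semisimple_reduced; [exact: full_reduced|exact: completed_pi_regular|].
exact: completed_noetherian.
Qed.

End Full.

Theorem semisimple_fullP : semisimple V <-> full_residual_dim.
Proof. by split=> [|[b hb]]; [exact: semisimple_full|exact: full_semisimple hb]. Qed.

Lemma reduced_fullP : reduced_ring V -> full_residual_dim.
Proof.
move=> redV; apply: semisimple_full; apply: semisimple_reduced => //.
  exact: completed_pi_regular.
exact: completed_noetherian.
Qed.

End CoreEquivalence.

(** * Change of the base field along an isomorphism *)

Section RestrictScalars.
Variables (F F' : fieldType) (phi : {rmorphism F -> F'}) (psi : {rmorphism F' -> F}).
Variables (psiK : cancel psi phi) (phiK : cancel phi psi) (L : fieldExtType F').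

(** Both cancellation proofs occur in the type, since they are needed to give it the
    structure of a finite extension of F. *)
Definition restrict_scalars (_ : cancel psi phi) (_ : cancel phi psi) : Type := L.
Local Notation L0 := (restrict_scalars psiK phiK).

HB.instance Definition _ := GRing.Field.on L0.

Definition restrict_scale (a : F) (u : L0) : L0 := phi a *: (u : L).

Fact restrict_scaleA a b u : restrict_scale a (restrict_scale b u) = restrict_scale (a * b) u.
Proof. by rewrite /restrict_scale scalerA -rmorphM. Qed.
Fact restrict_scale1 : left_id 1 restrict_scale.
Proof. by move=> u; rewrite /restrict_scale rmorph1 scale1r. Qed.
Fact restrict_scaleDr : right_distributive restrict_scale +%R.
Proof. by move=> a u v; apply: scalerDr. Qed.
Fact restrict_scaleDl v : {morph restrict_scale^~ v : a b / a + b}.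
Proof. by move=> a b; rewrite /restrict_scale rmorphD scalerDl. Qed.
HB.instance Definition _ := GRing.Zmodule_isLmodule.Build F L0
  restrict_scaleA restrict_scale1 restrict_scaleDr restrict_scaleDl.

Fact restrict_scaleAl a (u v : L0) : a *: (u * v) = (a *: u) * v.
Proof. exact: scalerAl. Qed.
HB.instance Definition _ := GRing.Lmodule_isLalgebra.Build F L0 restrict_scaleAl.

Fact restrict_scaleAr a (u v : L0) : a *: (u * v) = u * (a *: v).
Proof. exact: scalerAr. Qed.
HB.instance Definition _ := GRing.Lalgebra_isAlgebra.Build F L0 restrict_scaleAr.

Fact restrict_vectMixin : Lmodule_hasFinDim F L0.
Proof.
pose bL := vbasis {:L}; set m := \dim {:L} in bL.
pose v2r (x : L0) : 'rV[F]_m := \row_i psi (coord bL i (x : L)).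
have v2r_lin : linear v2r.
  move=> a x y; apply/rowP => i; rewrite !mxE.
  rewrite -[X in coord bL i X]/(phi a *: (x : L) + (y : L)) linearP.
  by rewrite rmorphD rmorphM phiK.
pose r2v (r : 'rV[F]_m) : L0 := \sum_(i < m) phi (r 0 i) *: bL`_i.
exists m, v2r => //; exists r2v => [x|r].
  rewrite [RHS](coord_vbasis (memvf (x : L))); apply: eq_bigr => i _.
  by rewrite mxE psiK.
by apply/rowP => i; rewrite mxE coord_sum_free ?phiK// (basis_free (vbasisP _)).
Qed.
HB.instance Definition _ := restrict_vectMixin.

Definition restrict_ext : fieldExtType F := L0.

Definition restrict_id (x : restrict_ext) : L := x.
Fact restrict_id_zmod : zmod_morphism restrict_id. Proof. by []. Qed.
Fact restrict_id_monoid : monoid_morphism restrict_id. Proof. by []. Qed.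
HB.instance Definition _ :=
  GRing.isZmodMorphism.Build restrict_ext L restrict_id restrict_id_zmod.
HB.instance Definition _ :=
  GRing.isMonoidMorphism.Build restrict_ext L restrict_id restrict_id_monoid.

End RestrictScalars.

(** Finite extensions of isomorphic fields correspond to each other. *)
Definition base_change (F F' : fieldType) (phi : F -> F')
    (L : fieldExtType F) (L' : fieldExtType F') (g : L -> L') :=
  bijective g /\ forall a x, g (a *: x) = phi a *: g x.

Lemma base_change_restrict (F F' : fieldType) (phi : {rmorphism F -> F'})
    (psi : {rmorphism F' -> F}) (L' : fieldExtType F') :
  cancel psi phi -> cancel phi psi ->
  exists (L : fieldExtType F) (g : {rmorphism L -> L'}), base_change phi g.
Proof.
move=> psiK phiK; exists (restrict_ext psiK phiK L').
exists (@restrict_id _ _ _ _ psiK phiK L'); split=> //; by exists id.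
Qed.

Lemma base_change_extend (F F' : fieldType) (phi : {rmorphism F -> F'})
    (psi : {rmorphism F' -> F}) (L : fieldExtType F) :
  cancel psi phi -> cancel phi psi ->
  exists (L' : fieldExtType F') (g : {rmorphism L -> L'}), base_change phi g.
Proof.
move=> psiK phiK; pose L' := restrict_ext phiK psiK L.
have gB : zmod_morphism (fun x : L => x : L') by [].
have gM : monoid_morphism (fun x : L => x : L') by [].
exists L', (HB.pack_for {rmorphism L -> L'} (fun x : L => x : L')
  (GRing.isZmodMorphism.Build L L' (fun x : L => x : L') gB)
  (GRing.isMonoidMorphism.Build L L' (fun x : L => x : L') gM)).
split=> [|a x]; first by exists id.
by rewrite -[RHS]/(psi (phi a) *: x) phiK.
Qed.

(** A field whose elements are the quotients of elements of A is the fraction field. *)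
Section FractionFieldUniversal.
Variables (A : idomainType) (F : fieldType) (f : {rmorphism A -> F}).
Local Notation K := {fraction A}.
Local Notation "a %:F" := (@FracField.tofrac A a).
Hypothesis finj : forall a, f a = 0 -> a = 0.
Hypothesis fquot : forall y, exists a b, b != 0 /\ y = f a / f b.

Let f0 a : a != 0 -> f a != 0.
Proof. by apply: contra_neq; apply: finj. Qed.

Definition frac_map (x : K) : F := f \n_(repr x) / f \d_(repr x).

Lemma frac_mapE a b : b != 0 -> frac_map (a%:F / b%:F) = f a / f b.
Proof.
move=> b0; rewrite /frac_map; set x := a%:F / b%:F.
have d0 := denom_ratioP (repr x).
apply/eqP; rewrite eqr_div ?f0// -!rmorphM; apply/eqP; congr (f _).
have := frac_repr x; rewrite {1}/x => /eqP; rewrite eqr_div ?tofrac_eq0//.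
by rewrite -!tofracM tofrac_eq => /eqP <-.
Qed.

Fact frac_map_zmod : zmod_morphism frac_map.
Proof.
move=> x y; have [[a [b [b0 ->]]] [c [d [d0 ->]]]] := (fracP x, fracP y).
rewrite -mulNr addf_div ?tofrac_eq0// -!tofracN -!tofracM -tofracD.
rewrite !frac_mapE ?mulf_neq0// -mulNr addf_div ?f0//.
by rewrite rmorphD !rmorphM rmorphN.
Qed.

Fact frac_map_monoid : monoid_morphism frac_map.
Proof.
split=> [|x y].
  by rewrite -[1]divr1 -(@tofrac1 A) frac_mapE ?oner_neq0// rmorph1 divr1.
have [[a [b [b0 ->]]] [c [d [d0 ->]]]] := (fracP x, fracP y).
by rewrite mulf_div -!tofracM !frac_mapE ?mulf_neq0// !rmorphM mulf_div.
Qed.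

Lemma fraction_field_iso : exists (phi : {rmorphism K -> F}) (psi : {rmorphism F -> K}),
  [/\ cancel psi phi, cancel phi psi & forall a, phi a%:F = f a].
Proof.
pose phi := HB.pack_for {rmorphism K -> F} frac_map
  (GRing.isZmodMorphism.Build K F frac_map frac_map_zmod)
  (GRing.isMonoidMorphism.Build K F frac_map frac_map_monoid).
have phia a : phi a%:F = f a.
  by rewrite -[a%:F]divr1 -(@tofrac1 A) [LHS]frac_mapE ?oner_neq0// rmorph1 divr1.
have /choice[psi psiK] : forall y, exists x, phi x = y.
  move=> y; have [a [b [b0 ->]]] := fquot y; exists (a%:F / b%:F); exact: frac_mapE.
have phi_inj : injective phi by apply: fmorph_inj.
have phiK : cancel phi psi by move=> x; apply: phi_inj; rewrite psiK.
have psiB : zmod_morphism psi by move=> x y; apply: phi_inj; rewrite rmorphB !psiK.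
have psiM : monoid_morphism psi.
  by split=> [|x y]; apply: phi_inj; rewrite ?rmorph1 ?rmorphM !psiK.
exists phi, (HB.pack_for {rmorphism F -> K} psi
  (GRing.isZmodMorphism.Build F K psi psiB) (GRing.isMonoidMorphism.Build F K psi psiM)).
by split.
Qed.

End FractionFieldUniversal.

(** * Localizations *)

Section LocalizationTheory.
Variables (R : comPzRingType) (q : spec R).
Local Notation Rq := (localization q).
Implicit Types (a b : R) (s t : denom q).

Lemma loc_fracK a s : loc_frac a s * to_loc q (den s) = to_loc q a.
Proof.
rewrite loc_fracM; apply/loc_frac_eq; exists 1; first by case: (specP q).
by have [d1 dM] := denE q; rewrite !dM !d1; ring.
Qed.

Lemma loc_frac_unit s : loc_frac 1 s * to_loc q (den s) = 1.
Proof. by rewrite loc_fracK rmorph1. Qed.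

Lemma loc_fracE a s : loc_frac a s = to_loc q a * loc_frac 1 s.
Proof. by rewrite -(loc_fracK a s) -mulrA (mulrC (to_loc _ _)) loc_frac_unit mulr1. Qed.

Lemma to_loc_eq0 a : to_loc q a = 0 -> exists2 s, ~ spec_set q s & s * a = 0.
Proof.
have -> : (0 : Rq) = loc_frac 0 (denom1 q) by [].
move=> /loc_frac_eq[u qu]; rewrite /= mul0r subr0 mulr1 => e; by exists u.
Qed.

Lemma to_loc_unit a : ~ spec_set q a -> exists x, x * to_loc q a = 1.
Proof. by move=> qa; exists (loc_frac 1 (mk_denom qa)); apply: (loc_frac_unit (mk_denom qa)). Qed.

Lemma loc_max_ideal : is_ideal (loc_max q). Proof. exact: ideal_gen_ideal. Qed.

Lemma loc_unit_notin (x : Rq) : ~ loc_max q x -> exists y, x * y = 1.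
Proof.
have [a [s ->]] := loc_frac_surj x => h.
have qa : ~ spec_set q a by move=> qa; apply: h; apply/loc_maxP.
have [y ya] := to_loc_unit qa; exists (y * to_loc q (den s)).
by rewrite loc_fracE mulrACA (mulrC _ y) ya mul1r loc_frac_unit.
Qed.

Lemma loc_max_not1 : ~ loc_max q 1.
Proof. by move=> /loc_maxP; case: (specP q). Qed.

Lemma loc_max_maximal : is_maximal_ideal (loc_max q).
Proof.
apply/maximal_idealP; split; [exact: loc_max_ideal|exact: loc_max_not1|].
move=> x /loc_unit_notin[y e]; exists y; rewrite e subrr; exact: ideal0 loc_max_ideal.
Qed.

Lemma maximal_loc_max (m : set Rq) : is_maximal_ideal m -> m = loc_max q.
Proof.
move=> [hm m1 mmax]; apply/esym/mmax; [exact: loc_max_ideal|exact: loc_max_not1|].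
move=> x mx; apply: contrapT => /loc_unit_notin[y e]; apply: m1; rewrite -e.
exact: ideal_mulr.
Qed.

(** Ideals of a localization are extended from R. *)
Lemma loc_noetherian : noetherian R -> noetherian Rq.
Proof.
move=> nR I hI.
have hJ := ideal_preim (to_loc q) hI.
have [n [b eJ]] := nR _ hJ.
have bI i : I (to_loc q (b i)).
  by have : (to_loc q @^-1` I) (b i) by rewrite eJ; apply: ideal_genS; exists i.
exists n, (fun i => to_loc q (b i)); apply/seteqP; split=> [x|]; last first.
  by apply: ideal_gen_sub => // _ [i _ <-].
have [a [s ->]] := loc_frac_surj x => Ix.
have : (to_loc q @^-1` I) a by rewrite /= -(loc_fracK a s); apply: ideal_mulr.
rewrite eJ => /ideal_gen_rangeP[c ea]; apply/ideal_gen_rangeP.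
exists (fun i => to_loc q (c i) * loc_frac 1 s).
rewrite loc_fracE ea rmorph_sum mulr_suml; apply: eq_bigr => i _.
by rewrite rmorphM mulrAC.
Qed.

End LocalizationTheory.

Section LocalizationFractions.
Variables (A : idomainType) (q : spec A).
Local Notation Aq := (localization q).

Lemma to_loc_inj a : to_loc q a = 0 -> a = 0.
Proof.
move=> /to_loc_eq0[s qs /eqP]; rewrite mulf_eq0 => /orP[/eqP s0|/eqP//].
by case: qs; rewrite s0; case: (specP q) => -[].
Qed.

Lemma den_neq0 (s : denom q) : den s != 0.
Proof.
apply/eqP => s0; have := @denomP _ _ s; rewrite s0; apply.
by case: (specP q) => -[].
Qed.

Lemma loc_fraction_iso : exists (phi : {rmorphism {fraction A} -> {fraction Aq}})
  (psi : {rmorphism {fraction Aq} -> {fraction A}}),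
  [/\ cancel psi phi, cancel phi psi
    & forall a, phi (FracField.tofrac a) = FracField.tofrac (to_loc q a)].
Proof.
apply: (@fraction_field_iso A _ (@FracField.tofrac Aq \o to_loc q)) => [a /= /eqP|y].
  by rewrite tofrac_eq0 => /eqP/to_loc_inj.
have [x [z [z0 ->]]] := fracP y.
have [[a [s ex]] [b [t ez]]] := (loc_frac_surj x, loc_frac_surj z).
have b0 : b != 0.
  by apply: contra_neq z0 => b0; rewrite ez loc_fracE b0 rmorph0 mul0r.
have lneq0 c : c != 0 -> to_loc q c != 0 by apply: contra_neq; apply: to_loc_inj.
exists (a * den t), (b * den s); split; first by rewrite mulf_neq0 ?den_neq0.
apply/eqP; rewrite eqr_div ?tofrac_eq0 ?lneq0 ?mulf_neq0 ?den_neq0// -!tofracM tofrac_eq.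
rewrite ex ez; apply/eqP; rewrite [LHS]loc_fracM [RHS]loc_fracM; apply/loc_frac_eq.
exists 1; first by case: (specP q).
by have [d1 dM] := denE q; rewrite !dM !d1; ring.
Qed.

End LocalizationFractions.

(** * Finiteness of the integral closure over the localization *)

Section Finiteness.
Variable A : idomainType.
Hypothesis hA : dedekind A.
Variable p : spec A.
Hypothesis p0 : spec_set p <> [set 0].
Local Notation K := {fraction A}.
Local Notation "a %:F" := (@FracField.tofrac _ a).
Local Notation vset := (@vset A p).
Local Notation R := (localization p).

(** If a finite family h generates B over the valuation ring and the residual basis
    does not span L, a linear form f killing its span takes values in a bounded
    set on B, while f (y) is arbitrarily small as y is approximated by the span. *)
Lemma finite_full (L : fieldExtType K) m (h : 'I_m -> L) :
  (forall y, exists d : 'I_m -> K,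
    (forall j, vset 0 (d j)) /\ closure_val L y = \sum_j d j *: h j) ->
  full_residual_dim p L.
Proof.
move=> gen; have [d [b hb]] := residual_basis_extend hA p0 L.
have [_ _ fb] := hb.
have lb := residually_free_linear hA p0 (ideal0 (ideal_gen_ideal _)) fb.
have led := linearly_free_le lb.
move: led; rewrite leq_eqVlt => /predU1P[ed|ltd]; first by subst d; exists b.
have [x nx] := not_spanning (closure_val L \o b) ltd.
have la := linearly_free_adjoin lb nx.
pose X := [tuple fcat (closure_val L \o b) (fun=> x) i | i < d + 1].
have XE (i : 'I_(d + 1)) : X`_i = fcat (closure_val L \o b) (fun=> x) i.
  by rewrite (nth_map i) ?size_enum_ord// nth_ord_enum.
have frX : free X.
  apply/freeP => k ek j; apply: (la k); apply: etrans ek.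
  by apply: eq_bigr => l _; rewrite XE.
pose f : {scalar L} := coord X (rshift d ord0).
have fb0 i : f (closure_val L (b i)) = 0.
  have -> : closure_val L (b i) = X`_(lshift 1 i) by rewrite (XE (lshift 1 i)) fcat_lshift.
  by rewrite [LHS](coord_free _ _ frX) eq_lrshift.
have fx : f x = 1.
  have -> : x = X`_(rshift d (ord0 : 'I_1)) by rewrite (XE (rshift d ord0)) fcat_rshift.
  by rewrite [LHS](coord_free _ _ frX) eqxx.
have [k hk] : exists k, forall y, vset k (f (closure_val L y)).
  have /choice[e he] : forall j, exists k, vset k (f (h j)).
    by move=> j; apply: vset_exists.
  exists (- (\max_j `|e j|%N)%:Z) => y; have [c [hc ->]] := gen y.
  rewrite linear_sum; apply: (vset_sum hA p0) => j _; rewrite linearZ.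
  rewrite -[X in vset X _]add0r; apply: (vsetM hA) => //.
  apply: vset_le (he j); have := leq_bigmax (F := fun j => `|e j|%N) j; lia.
have small (i : nat) y : @extend_ideal A L (idealX p i) y ->
    forall z, vset (i%:Z + k) (f (closure_val L (z * y))).
  move: y; apply: ideal_gen_sub.
    split=> [z|y y' hy hy' z|c y hy z].
    - by rewrite mulr0 rmorph0 linear0; left.
    - by rewrite mulrDr rmorphD linearD; apply: (vsetD hA p0); [apply: hy|apply: hy'].
    - by rewrite mulrA; apply: hy.
  move=> _ [c pc <-] z; rewrite mulrC.
  rewrite (val_to_closureM c z) linearZ; apply: (vsetM hA) => //.
  exact/(vset_tofrac hA p0).
have [a [y [a0 ey]]] := integral_closure_span x.
have [c hc] := residual_basis_approx hb y.
case/negP: a0; rewrite -tofrac_eq0; apply/eqP; apply: (@vset_sep _ p) => l.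
have -> : a%:F = f (closure_val L (1 * (y - \sum_i to_closure L (c `|l%:Z - k|%N i) * b i))).
  rewrite mul1r rmorphB ey linearB linearZ fx -[X in _ = X - _]/(a%:F * 1) mulr1 val_to_closure_sum linear_sum.
  by rewrite big1 ?subr0// => i _; rewrite linearZ fb0 /= mulr0.
have [hl _] := hc `|l%:Z - k|%N.
by apply: vset_le (small _ _ hl 1); lia.
Qed.

Variables (phi : {rmorphism K -> {fraction R}}) (psi : {rmorphism {fraction R} -> K}).
Hypotheses (psiK : cancel psi phi) (phiK : cancel phi psi).
Hypothesis phiE : forall a, phi a%:F = (to_loc p a)%:F.

Lemma phi_frac a (s : denom p) : phi (a%:F / (den s)%:F) = (loc_frac a s)%:F.
Proof.
rewrite fmorph_div !phiE; apply: canLR (mulfK _) _.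
  by rewrite tofrac_eq0; apply: contraTneq (den_neq0 s) => /to_loc_inj ->; rewrite eqxx.
by rewrite -tofracM loc_fracK.
Qed.

Lemma phi_vset0 c : vset 0 c <-> exists r : R, phi c = r%:F.
Proof.
split=> [/(vset0P hA p0)[a [s [ps ->]]]|[r e]].
  by exists (loc_frac a (mk_denom ps)); apply: (phi_frac a (mk_denom ps)).
have [a [s er]] := loc_frac_surj r.
apply/(vset0P hA p0); exists a, (den s); split; first exact: denomP.
by rewrite -[c]phiK e er -phi_frac phiK.
Qed.

Section BaseChange.
Variables (L : fieldExtType K) (E : fieldExtType {fraction R}) (g : {rmorphism L -> E}).
Hypothesis hg : base_change phi g.

Let gZ a x : g (a *: x) = phi a *: g x. Proof. by case: hg => _; apply. Qed.

Lemma base_change_to_ext a : g (to_ext L a) = to_ext E (to_loc p a).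
Proof. by rewrite to_extE gZ phiE rmorph1. Qed.

Lemma base_change_integral x :
  integralOver (to_ext L) x -> integralOver (to_ext E) (g x).
Proof.
move=> [q mq rq]; exists (map_poly (to_loc p) q); first exact: monic_map.
have -> : map_poly (to_ext E) (map_poly (to_loc p) q) = map_poly g (map_poly (to_ext L) q).
  by apply/polyP => i; rewrite !coef_map /= -base_change_to_ext.
by rewrite fmorph_root.
Qed.

(** It suffices to clear the denominators of one integral equation of g x. *)
Lemma base_change_integral_inv x : integralOver (to_ext E) (g x) ->
  exists2 s, ~ spec_set p s & integralOver (to_ext L) (to_ext L s * x).
Proof.
move=> [q mq rq]; pose theta : {rmorphism R -> L} := in_alg L \o (psi \o @FracField.tofrac R).
have gth r : g (theta r) = to_ext E r by rewrite /= gZ psiK rmorph1.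
have hq i : vset 0 (psi (q`_i)%:F) by apply/phi_vset0; exists q`_i; rewrite psiK.
have [s ps [a ha]] := vset0_common_denominator hA p0
  (fun i : 'I_(size q).-1 => hq i).
exists s => //; apply: (@integral_scale _ _ _ _ (map_poly theta q)).
- exact: monic_map.
- rewrite -(fmorph_root g); move: rq; congr (root _ _).
  by apply/polyP => i; rewrite !coef_map; apply/esym; apply: gth.
- exact: integral_id.
move=> i; rewrite size_map_poly_id0 ?(monicP mq) ?rmorph1 ?oner_neq0// => iq; rewrite coef_map /= (ha (Ordinal iq)) to_extE.
rewrite mulr_algl scalerA mulrC divfK; first exact: integral_id.
by rewrite tofrac_eq0 (denom_neq0 ps).
Qed.

Definition finite_closure := exists m (b : 'I_m -> integral_closure E),
  forall y, exists c : 'I_m -> R, y = \sum_(i < m) to_closure E (c i) * b i.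

(** A lifted basis of B / pB generates the closure of R since integral elements have
    coordinates in the valuation ring with respect to it. *)
Lemma finite_closureP : finite_closure <-> full_residual_dim p L.
Proof.
have [[ginv gK ginvK] _] := hg.
split=> [[m [b hb]]|[b hb]].
  apply: (@finite_full L m (fun j => ginv (closure_val E (b j)))) => y.
  have [z ez] := integral_closure_lift (base_change_integral (integral_closureP y)).
  have [c ec] := hb z.
  exists (fun j => psi (c j)%:F); split=> [j|].
    by apply/phi_vset0; exists (c j); rewrite psiK.
  apply: (can_inj gK); rewrite -ez ec val_to_closure_sum rmorph_sum.
  by apply: eq_bigr => j _; rewrite /= gZ psiK ginvK.
have /choice[e he] : forall i, exists z : integral_closure E,
    closure_val E z = g (closure_val L (b i)).
  move=> i; apply: integral_closure_lift; apply: base_change_integral.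
  exact: integral_closureP.
exists (\dim {:L}), e => y.
have := integral_closureP y; rewrite -[closure_val E y]ginvK.
move=> /base_change_integral_inv[s ps /integral_closure_lift[z ez]].
have [d [hd ed]] := full_integral_coords hA p0 hb z.
have s0 : s%:F != 0 by rewrite tofrac_eq0 (denom_neq0 ps).
have hds i : vset 0 (s%:F^-1 * d i).
  rewrite -[X in vset X _]addr0; apply: (vsetM hA) => //; apply/(vset0P hA p0).
  by exists 1, s; split=> //; rewrite tofrac1 mul1r.
have /choice[c hc] : forall i, exists r : R, phi (s%:F^-1 * d i) = r%:F.
  by move=> i; apply/phi_vset0.
exists c; apply: closure_val_inj; rewrite val_to_closure_sum.
rewrite -[LHS]ginvK.
have -> : ginv (closure_val E y) = \sum_i (s%:F^-1 * d i) *: closure_val L (b i).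
  under eq_bigr do rewrite -scalerA.
  by rewrite -scaler_sumr -ed ez to_extE mulr_algl scalerA mulVf// scale1r.
rewrite rmorph_sum; apply: eq_bigr => i _.
by rewrite [LHS]gZ hc he.
Qed.

End BaseChange.

Lemma japanese_fullP : japanese R <-> forall L : fieldExtType K, full_residual_dim p L.
Proof.
split=> [japR L|fullA E].
  have [E [g hg]] := base_change_extend L psiK phiK.
  by apply/(finite_closureP hg); apply: japR.
have [L [g hg]] := base_change_restrict E psiK phiK.
by apply/(finite_closureP hg).
Qed.

End Finiteness.

(** * Regularity of zero-dimensional rings *)

Section Isomorphisms.
Variables (T V : comPzRingType) (F : {rmorphism T -> V}).

Lemma rmorphism_inverse : bijective F ->
  exists G : {rmorphism V -> T}, cancel F G /\ cancel G F.
Proof.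
move=> [G FK GK]; have Finj := can_inj FK.
have GB : zmod_morphism G by move=> x y; apply: Finj; rewrite rmorphB !GK.
have GM : monoid_morphism G.
  by split=> [|x y]; apply: Finj; rewrite ?rmorph1 ?rmorphM !GK.
by exists (HB.pack_for {rmorphism V -> T} G
  (GRing.isZmodMorphism.Build V T G GB) (GRing.isMonoidMorphism.Build V T G GM)).
Qed.

Lemma semisimple_surj : (forall y, exists x, F x = y) -> semisimple T -> semisimple V.
Proof.
move=> Fs ssT; apply: semisimple_of_idempotent => I hI.
have hJ := ideal_preim F hI.
have [e [Ie ee eI]] := semisimple_idempotent ssT hJ.
exists (F e); split=> //; first by rewrite -rmorphM ee.
by move=> y; have [x <-] := Fs y => Ix; rewrite -rmorphM eI.
Qed.

Lemma noetherian_surj : (forall y, exists x, F x = y) -> noetherian T -> noetherian V.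
Proof.
move=> Fs nT I hI.
have hJ := ideal_preim F hI.
have [n [b eJ]] := nT _ hJ; exists n, (F \o b); apply/seteqP; split=> [y|].
  have [x <-] := Fs y => Ix; have : (F @^-1` I) x by [].
  rewrite eJ => /ideal_gen_rangeP[c ->]; apply/ideal_gen_rangeP; exists (F \o c).
  by rewrite rmorph_sum; apply: eq_bigr => i _; rewrite rmorphM.
apply: ideal_gen_sub => // _ [i _ <-].
by have : (F @^-1` I) (b i) by rewrite eJ; apply: ideal_genS; exists i.
Qed.

Lemma pi_regular_inj : bijective F -> pi_regular V -> pi_regular T.
Proof.
move=> [G FK GK] preg x; have [j [y e]] := preg (F x); exists j, (G y).
by apply: (can_inj FK); rewrite rmorphM rmorphXn rmorphB rmorph1 rmorphM GK e rmorph0.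
Qed.

Lemma reduced_surj : bijective F -> reduced_ring T -> reduced_ring V.
Proof.
move=> [G FK GK] redT y yy; rewrite -(GK y) [G y]redT ?rmorph0//.
by apply: (can_inj FK); rewrite rmorphM !GK yy rmorph0.
Qed.

End Isomorphisms.

Section Regular.
Variable T : comPzRingType.

Lemma semisimple_noetherian : semisimple T -> noetherian T.
Proof.
move=> ssT I hI; have [e [Ie _ eI]] := semisimple_idempotent ssT hI.
exists 1%N, (fun=> e); apply/seteqP; split=> [x Ix|]; last first.
  by apply: ideal_gen_sub => // _ [_ _ <-].
by apply/ideal_gen_rangeP; exists (fun=> x); rewrite big_ord1 eI.
Qed.

(** A prime P is generated by an idempotent e, which vanishes in the localization
    because 1 - e is outside P; so this localization is a field. *)
Lemma semisimple_loc_max (P : spec T) : semisimple T -> loc_max P = [set 0].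
Proof.
move=> ssT; have [iP P1 _] := specP P.
have [e [Pe ee eP]] := semisimple_idempotent ssT iP.
have P1e : ~ spec_set P (1 - e).
  by move=> h; apply: P1; rewrite -(subrK e 1); apply: idealD.
apply/seteqP; split=> [x|_ ->]; last exact: ideal0 (loc_max_ideal P).
have [a [s ->]] := loc_frac_surj x => /loc_maxP Pa /=.
rewrite loc_fracE; have [y ey] := to_loc_unit P1e.
suff -> : to_loc P a = 0 by rewrite mul0r.
have e0 : (1 - e) * a = 0 by rewrite mulrBl mul1r [e * a]mulrC eP// subrr.
by rewrite -[to_loc P a]mul1r -ey -mulrA -rmorphM e0 rmorph0 mulr0.
Qed.

Lemma semisimple_regular : semisimple T -> regular_ring T.
Proof.
move=> ssT; have nT := semisimple_noetherian ssT; split=> // P.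
have m0 := semisimple_loc_max P ssT.
split; first exact: loc_noetherian.
exists (loc_max P); split; [exact: loc_max_maximal|exact: maximal_loc_max|].
exists 0%N; split; last first.
  by exists (fun=> 0); rewrite m0 ideal_gen_range0.
split.
  exists (fun=> Spec (maximal_prime (loc_max_maximal P))) => i j.
  by rewrite !ord1.
move=> [//|n] [c hc].
have c0 i : spec_set (c i) `<=` [set 0].
  move=> x cx; apply: contrapT; rewrite -m0 => /loc_unit_notin[y e].
  have [ci c1 _] := specP (c i); apply: c1; rewrite -e; exact: ideal_mulr.
have [_ []] := hc ord0 (lift ord0 ord0) isT.
by move=> x /c0 ->; have [ci _ _] := specP (c ord0); apply: ideal0.
Qed.

Lemma pi_regular_prime_maximal (P : set T) : pi_regular T -> is_prime_ideal P ->
  is_maximal_ideal P.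
Proof.
move=> preg hP; have [iP P1 PM] := hP; apply/maximal_idealP; split=> // x Px.
have [j [y e]] := preg x; exists y.
have : P (x ^+ j * (1 - x * y)) by rewrite e; apply: ideal0.
by case/PM => [/(prime_exp hP)//|h]; rewrite -opprB; apply: idealN.
Qed.

(** In a zero-dimensional ring a regular local ring has dimension zero, so that its
    maximal ideal is generated by no element. *)
Lemma regular_reduced : pi_regular T -> regular_ring T -> reduced_ring T.
Proof.
move=> preg [nT reg] x xx; apply: contrapT => x0.
pose I := [set y | y * x = 0].
have hI : is_ideal I.
  split=> [|y z|a y]; rewrite /I /= ?mul0r ?mulrDl //.
    by move=> -> ->; rewrite addr0.
  by rewrite -mulrA => ->; rewrite mulr0.
have [|P0 mP IP] := noetherian_maximal_ideal nT hI; first by rewrite /I /= mul1r.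
pose P := Spec (maximal_prime mP).
have [_ [m [mm _ [d [[[c hc] _] [b eb]]]]]] := reg P.
have d0 : d = 0%N.
  case: d c hc b eb => // d c hc _ _.
  pose i0 : 'I_d.+2 := ord0; pose i1 : 'I_d.+2 := lift ord0 ord0.
  have [c01 c10] := hc i0 i1 isT; case: c10 => y cy.
  have pre i := prime_preim (to_loc P) (specP (c i)).
  have [_ _ pmax] := pi_regular_prime_maximal preg (pre i0).
  have [hi1 ci11 _] := pre i1.
  have e := pmax _ hi1 ci11 (fun u => c01 (to_loc P u)).
  have [a [s ey]] := loc_frac_surj y.
  have [hc0 _ _] := specP (c i0); have [hc1 _ _] := specP (c i1).
  have : (to_loc P @^-1` spec_set (c i1)) a.
    by rewrite /= -(loc_fracK a s) -ey; apply: ideal_mulr.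
  rewrite e /= => ca; rewrite ey loc_fracE; exact: ideal_mulr.
subst d.
have m0 : m = [set 0] by rewrite eb ideal_gen_range0.
have Px : spec_set P x.
  have [iP _ PM] := specP P; have : spec_set P (x * x) by rewrite xx; apply: ideal0.
  by case/PM.
have /to_loc_eq0[s Ps sx] : to_loc P x = 0.
  have : loc_max P (to_loc P x) by apply/loc_maxP.
  by rewrite -(maximal_loc_max mm) m0.
by apply: Ps; apply: IP.
Qed.

End Regular.

Lemma semisimple_field_image (k : fieldType) (T : comPzRingType) (h : {rmorphism k -> T}) :
  (forall t, exists y, t = h y) -> semisimple T.
Proof.
move=> hs I hI; have [I0|I0] := pselect (I = [set 0]).
  exists setT; split; [exact: setT_ideal|by rewrite setIT|].
  by move=> x; exists 0 => //; apply: ideal0.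
have [x Ix x0] := ideal_neq0 hI I0.
have IT : I = setT.
  apply: idealT_eq => //; have [y ex] := hs x.
  have y0 : y != 0 by apply: contra_neq x0 => y0; rewrite ex y0 rmorph0.
  rewrite -(rmorph1 h) -(mulVf y0) rmorphM -ex; exact: ideal_mull.
exists [set 0]; rewrite IT; split; [exact: zero_ideal|by rewrite setTI|].
by move=> z; exists z; rewrite ?subrr.
Qed.

(** A nonzero ideal is generated by the smallest power of t which it contains. *)
Lemma noetherian_uniformizer (S : comPzRingType) (t : S) :
  (forall x, x <> 0 -> exists k u v, u * v = 1 /\ x = u * t ^+ k) -> noetherian S.
Proof.
move=> ht I hI; have [I0|I0] := pselect (I = [set 0]).
  by exists 0%N, (fun=> 0); rewrite ideal_gen_range0.
have It x : I x -> x <> 0 -> exists k u, I (t ^+ k) /\ x = u * t ^+ k.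
  move=> Ix /ht[k [u [v [uv ex]]]]; exists k, u; split=> //.
  have -> : t ^+ k = v * x by rewrite ex mulrA (mulrC v) uv mul1r.
  exact: ideal_mull.
have [x Ix /eqP x0] := ideal_neq0 hI I0.
have exk : exists k, `[< I (t ^+ k) >].
  by have [k [u [Ik _]]] := It x Ix x0; exists k; apply/asboolP.
case: (ex_minnP exk) => k /asboolP Ik kmin.
exists 1%N, (fun=> t ^+ k); apply/seteqP; split=> [y Iy|]; last first.
  by apply: ideal_gen_sub => // _ [_ _ <-].
apply/ideal_gen_rangeP; have [->|/eqP y0] := eqVneq y 0.
  by exists (fun=> 0); rewrite big_ord1 mul0r.
have [j [u [/asboolP/kmin kj ->]]] := It y Iy y0.
by exists (fun=> u * t ^+ (j - k)); rewrite big_ord1 -mulrA -exprD subnK.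
Qed.

(** * Fibers *)

Section Fiber.
Variables (R S : comPzRingType) (f : {rmorphism R -> S}) (q : spec R).
Local Notation k := (residue_field q).
Local Notation Sk := (tensor_alg f (to_residue q)).
Local Notation inl := (tensor_inl f (to_residue q)).
Local Notation inr := (tensor_inr f (to_residue q)).

Lemma to_residue_eq0 a : to_residue q a = 0 <-> spec_set q a.
Proof.
rewrite -(rmorph0 (to_quot (loc_max q))) to_quot_eq subr0.
by rewrite (ideal_gen_id (loc_max_ideal q)) loc_maxP.
Qed.

Lemma residue_frac (y : k) : exists a b, ~ spec_set q b /\ y = to_residue q a / to_residue q b.
Proof.
have [x ->] := to_quot_surj y; have [a [s ->]] := loc_frac_surj x.
exists a, (den s); split; first exact: denomP.
apply/esym; apply: canLR (mulfK _) _.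
  by apply/eqP => /to_residue_eq0; apply: denomP.
by rewrite -[X in _ * X]/(to_quot _ (to_loc q (den s))) -rmorphM loc_fracK.
Qed.

(** The fiber is a localization of S / q S. *)
Lemma fiber_pure (u : Sk) : exists s b, ~ spec_set q b /\ u * inr (to_residue q b) = inl s.
Proof.
elim/tensor_alg_ind: u => [s y|u v [s [b [qb e]]] [t [c [qc e']]]].
  have [a [b [qb ->]]] := residue_frac y.
  have b0 : to_residue q b != 0 by apply/eqP => /to_residue_eq0.
  exists (s * f a), b; split=> //.
  rewrite -mulrA -rmorphM divfK// (rmorphM inl); congr (_ * _).
  exact/esym/tensor_inl_base.
exists (s * f c + t * f b), (b * c); split; first by case: (specP q) => _ _ h /h[].
transitivity (u * inr (to_residue q b) * inr (to_residue q c) +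
              v * inr (to_residue q c) * inr (to_residue q b)).
  by rewrite !rmorphM; ring.
by rewrite e e' -!tensor_inl_base rmorphD !rmorphM.
Qed.

Lemma fiber_noetherian : noetherian S -> noetherian Sk.
Proof.
move=> nS I hI.
have hJ := ideal_preim inl hI.
have [n [b eJ]] := nS _ hJ; exists n, (inl \o b); apply/seteqP; split=> [u Iu|].
  have [s [c [qc e]]] := fiber_pure u.
  have c0 : to_residue q c != 0 by apply/eqP => /to_residue_eq0.
  have : (inl @^-1` I) s by rewrite /= -e; apply: ideal_mulr.
  rewrite eJ => /ideal_gen_rangeP[d es]; apply/ideal_gen_rangeP.
  exists (fun i => inl (d i) * inr (to_residue q c)^-1).
  rewrite -[LHS]mulr1 -(rmorph1 inr) -(divff c0) rmorphM mulrA e es rmorph_sum mulr_suml.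
  by apply: eq_bigr => i _; rewrite rmorphM mulrAC.
apply: ideal_gen_sub => // _ [i _ <-].
by have : (inl @^-1` I) (b i) by rewrite eJ; apply: ideal_genS; exists i.
Qed.

End Fiber.

(** * Flatness of torsion-free modules over a valuation ring *)

Section TorsionFreeFlat.
Variables (R S : comPzRingType) (f : {rmorphism R -> S}).
Hypothesis valR : forall x y : R, (exists c, x = c * y) \/ (exists c, y = c * x).
Hypothesis tfS : forall r (s : S), f r * s = 0 -> r = 0 \/ s = 0.

Definition free_over n (t : 'I_n -> S) :=
  forall a : 'I_n -> R, \sum_j f (a j) * t j = 0 -> forall j, a j = 0.

Definition span_over n (t : 'I_n -> S) (s : S) :=
  exists a : 'I_n -> R, s = \sum_j f (a j) * t j.

Lemma valuation_min n (a : 'I_n.+1 -> R) : exists i, forall j, exists c, a j = c * a i.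
Proof.
elim: n a => [|n IHn] a.
  by exists ord0 => j; rewrite ord1; exists 1; rewrite mul1r.
have [i hi] := IHn (fun j => a (lift ord0 j)).
have [[c e]|[c e]] := valR (a ord0) (a (lift ord0 i)).
  exists (lift ord0 i) => j; case: (unliftP ord0 j) => [l|] ->; last by exists c.
  exact: hi.
exists ord0 => j; case: (unliftP ord0 j) => [l|] ->; last by exists 1; rewrite mul1r.
by have [d ->] := hi l; exists (d * c); rewrite e mulrA.
Qed.

(** A minimal generating family is free: in a nontrivial relation, the coefficient
    dividing all the others can be cancelled, so that its generator is redundant. *)
Lemma free_span_exists m (s : 'I_m -> S) : exists n (t : 'I_n -> S),
  free_over t /\ forall i, span_over t (s i).
Proof.
have exn : exists n, `[< exists t : 'I_n -> S, forall i, span_over t (s i) >].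
  exists m; apply/asboolP; exists s => i; exists (fun j => (j == i)%:R).
  rewrite (bigD1 i)//= eqxx rmorph1 mul1r big1 ?addr0// => j /negbTE ->.
  by rewrite rmorph0 mul0r.
case: (ex_minnP exn) => n /asboolP[t ht] nmin; exists n, t; split=> // a ea.
apply: contrapT => /existsNP[j0 aj0].
case: n t ht nmin a ea j0 aj0 => [|n] t ht nmin a ea j0 aj0; first by case: j0 aj0.
have [i hi] := valuation_min a.
have ai0 : a i <> 0 by move=> e; apply: aj0; have [c ->] := hi j0; rewrite e mulr0.
have /choice[c hc] := hi.
have : f (a i) * (t i + \sum_j f (c (lift i j)) * t (lift i j)) = 0.
  rewrite -[RHS]ea (bigD1_ord i)//= mulrDr mulr_sumr; congr (_ + _).
  by apply: eq_bigr => j _; rewrite (hc (lift i j)) rmorphM mulrA (mulrC (f (a i))).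
case/tfS => // /eqP; rewrite addr_eq0 => /eqP eti.
suff /nmin : `[< exists t' : 'I_n -> S, forall i, span_over t' (s i) >] by rewrite ltnn.
apply/asboolP; exists (fun j => t (lift i j)) => l; have [d ->] := ht l.
exists (fun j => d (lift i j) - d i * c (lift i j)).
rewrite (bigD1_ord i)//= eti mulrN mulr_sumr -sumrN -big_split; apply: eq_bigr => j _ /=.
by rewrite rmorphB rmorphM; ring.
Qed.

(** Equal formal sums have equal coordinates in every free family which is large
    enough to express the elements used in the derivation of the equality. *)
Lemma tensor_eq_coord (M : lmodType R) (l l' : seq (S * M)) :
  tensor_eq (fun r x => f r * x) *:%R l l' ->
  exists F : seq S, forall n (t : 'I_n -> S) (c : S -> 'I_n -> R), free_over t ->
    (forall s, s \in F -> s = \sum_j f (c s j) * t j) -> forall j,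
    \sum_(x <- l) c x.1 j *: x.2 = \sum_(x <- l') c x.1 j *: x.2.
Proof.
elim=> {l l'}.
- by move=> l; exists [::].
- by move=> l l' _ [F hF]; exists F => n t c ft hc j; rewrite (hF n t c ft hc j).
- move=> l1 l2 l3 _ [F hF] _ [G hG]; exists (F ++ G) => n t c ft hc j.
  rewrite (hF n t c ft _ j) ?(hG n t c ft _ j)// => s sF.
    by apply: hc; rewrite mem_cat sF orbT.
  by apply: hc; rewrite mem_cat sF.
- move=> l1 l1' l2 l2' _ [F hF] _ [G hG]; exists (F ++ G) => n t c ft hc j.
  rewrite !big_cat /= (hF n t c ft _ j) ?(hG n t c ft _ j)// => s sF.
    by apply: hc; rewrite mem_cat sF orbT.
  by apply: hc; rewrite mem_cat sF.
- by move=> l l'; exists [::] => n t c _ _ j; rewrite !big_cat /= addrC.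
- move=> y; exists [:: 0] => n t c ft hc j; rewrite big_seq1 big_nil /=.
  by rewrite (ft _ (esym (hc 0 (mem_head _ _)))) scale0r.
- move=> x x' y; exists [:: x; x'; x + x'] => n t c ft hc j.
  rewrite !big_cons big_nil /= !addr0 -scalerDl; congr (_ *: _).
  apply/eqP; rewrite -subr_eq0; apply/eqP.
  apply: (ft (fun j => c (x + x') j - (c x j + c x' j))).
  under eq_bigr do rewrite rmorphB rmorphD mulrBl mulrDl.
  rewrite sumrB big_split /= -!hc ?subrr// !inE ?eqxx ?orbT//.
- move=> x y y'; exists [::] => n t c _ _ j.
  by rewrite !big_cons big_nil /= !addr0 scalerDr.
- move=> r x y; exists [:: x; f r * x] => n t c ft hc j.
  rewrite !big_seq1 /= scalerA; congr (_ *: _).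
  apply/eqP; rewrite -subr_eq0; apply/eqP.
  apply: (ft (fun j => c (f r * x) j - c x j * r)).
  under eq_bigr do rewrite rmorphB rmorphM mulrBl [f (c x _) * f r]mulrC -mulrA.
  by rewrite sumrB -mulr_sumr -!hc ?subrr// !inE ?eqxx ?orbT.
Qed.

Lemma tensor_pi_coord (M : lmodType R) n (t : 'I_n -> S) (c : S -> 'I_n -> R)
    (l : seq (S * M)) : (forall x, x \in map fst l -> x = \sum_j f (c x j) * t j) ->
  tensor_pi (fun r x => f r * x) *:%R l =
  \sum_j pure (fun r x => f r * x) *:%R (t j) (\sum_(x <- l) c x.1 j *: x.2).
Proof.
set ac := (fun r x => f r * x).
have pr x : {morph pure ac *:%R x : y y' / (y : M) + y' >-> y + y'}.
  by move=> y y'; apply: pureDr.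
have pl (y : M) : {morph (fun x => pure ac *:%R x y) : x x' / x + x' >-> x + x'}.
  by move=> x x'; apply: pureDl.
rewrite tensor_piE; elim: l => [_|x l IHl hl].
  by rewrite big_nil big1// => j _; rewrite big_nil pure0r.
rewrite big_cons IHl => [|s sl]; last by apply: hl; rewrite inE sl orbT.
under [RHS]eq_bigr do rewrite big_cons pureDr.
rewrite big_split /=; congr (_ + _).
rewrite {1}(hl x.1) ?mem_head// (big_morph _ (pl x.2) (pure0l ac *:%R x.2)).
by apply: eq_bigr => j _; rewrite (pure_act ac).
Qed.

Theorem torsion_free_flat : flat f.
Proof.
move=> M N g ginj u v; rewrite /tensor_mapr => /tensor_pi_eq/tensor_eq_coord[F hF].
rewrite -[u]reprK -[v]reprK -!/(tensor_pi _ _ _).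
set l := repr u in hF *; set l' := repr v in hF *.
pose G := F ++ map fst l ++ map fst l'.
have [n [t [ft ht]]] := free_span_exists (fun i : 'I_(size G) => G`_i).
have /choice[c hc] : forall s, exists a : 'I_n -> R, s \in G -> s = \sum_j f (a j) * t j.
  move=> s; have [sG|nsG] := boolP (s \in G); last by exists (fun=> 0).
  have [a ea] := ht (Ordinal (etrans (index_mem s G) sG)).
  by exists a => _; rewrite -ea /= nth_index.
have e j : \sum_(x <- l) c x.1 j *: x.2 = \sum_(x <- l') c x.1 j *: x.2.
  apply: ginj; rewrite !linear_sum.
  have := hF n t c ft _ j; rewrite !big_map /= => h.
  under eq_bigr do rewrite linearZ; under [RHS]eq_bigr do rewrite linearZ.
  by apply: h => s sF; apply: hc; rewrite mem_cat sF.
rewrite !(@tensor_pi_coord _ _ t c) => [|x xl|x xl].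
- by apply: eq_bigr => j _; rewrite e.
- by apply: hc; rewrite !mem_cat xl !orbT.
- by apply: hc; rewrite !mem_cat xl !orbT.
Qed.

End TorsionFreeFlat.

(** * The completed local ring at a nonzero prime *)

Section CompletionMap.
Variables (R R' : comPzRingType) (U : filtration R) (U' : filtration R').
Hypotheses (topU : ring_topology U) (topU' : ring_topology U').
Variable theta : {rmorphism R -> R'}.
Hypothesis continuous : forall k x, U k x -> U' k (theta x).
Local Notation cls := (to_quot (@null_seq R U)).
Local Notation cls' := (to_quot (@null_seq R' U')).

Lemma cauchy_map x : is_cauchy U x -> is_cauchy U' (theta \o x).
Proof.
move=> hx k; have [N hN] := hx k; exists N => m n Nm Nn /=.
by rewrite -rmorphB; apply: continuous; apply: hN.
Qed.

Definition map_cauchy (u : cauchy_seq U) : cauchy_seq U' :=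
  mk_cauchy topU' (cauchy_map (cauchy_seqP topU u)).

Definition completion_fun (z : completion U) : completion U' := cls' (map_cauchy (repr z)).

Lemma completion_funE u : completion_fun (cls u) = cls' (map_cauchy u).
Proof.
apply/(completion_eq topU') => k.
have : cls (repr (cls u)) = cls u by rewrite /to_quot reprK.
move=> /(completion_eq topU)/(_ k)[N hN]; exists N => n Nn.
rewrite [val _ n]/(theta (val (repr (cls u)) n)) [X in _ - X]/(theta (val u n)).
by rewrite -rmorphB; apply: continuous; apply: hN.
Qed.

Fact completion_fun_zmod : zmod_morphism completion_fun.
Proof.
move=> x y; have [[u ->] [v ->]] := (to_quot_surj x, to_quot_surj y).
rewrite -rmorphB !completion_funE -rmorphB; congr (cls' _); apply: val_inj.
by apply/funext => n; exact: (rmorphB theta (val u n) (val v n)).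
Qed.

Fact completion_fun_monoid : monoid_morphism completion_fun.
Proof.
split=> [|x y].
  rewrite -[1 in LHS](rmorph1 cls) completion_funE -(rmorph1 cls'); congr (cls' _).
  by apply: val_inj; apply/funext => n; exact: (rmorph1 theta).
have [[u ->] [v ->]] := (to_quot_surj x, to_quot_surj y).
rewrite -rmorphM !completion_funE -rmorphM; congr (cls' _); apply: val_inj.
by apply/funext => n; exact: (rmorphM theta (val u n) (val v n)).
Qed.

HB.instance Definition _ := GRing.isZmodMorphism.Build _ _ completion_fun completion_fun_zmod.
HB.instance Definition _ := GRing.isMonoidMorphism.Build _ _ completion_fun completion_fun_monoid.

Definition completion_map : {rmorphism completion U -> completion U'} := completion_fun.

Lemma completion_mapE u : completion_map (cls u) = cls' (map_cauchy u).
Proof. exact: completion_funE. Qed.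

Lemma completion_map_base a :
  completion_map (to_completion U a) = to_completion U' (theta a).
Proof. by rewrite !to_completionE completion_mapE; congr (cls' _); apply: val_inj. Qed.

Lemma completion_map_inj : (forall k x, U' k (theta x) -> U k x) ->
  forall z, completion_map z = 0 -> z = 0.
Proof.
move=> opn z; have [u ->] := to_quot_surj z; rewrite completion_mapE.
move=> /(completion_eq0 topU') hu; apply/(completion_eq0 topU) => k.
by have [N hN] := hu k; exists N => n Nn; apply: opn; apply: hN.
Qed.

End CompletionMap.

Lemma adic_topology (R : comPzRingType) (I : set R) : is_ideal I -> ring_topology (adic I).
Proof.
move=> hI; have hX k := idealX_ideal I k; split=> [k x y|j k x jk|k|a k].
- by move=> hx hy; exact: (idealB (hX k) hx hy).
- elim: k jk => [|k IHk]; first by rewrite leqn0 => /eqP ->.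
  rewrite leq_eqVlt => /predU1P[->//|jk] h; apply: (IHk jk).
  exact: idealXS h.
- by exists k => x y _; apply: (ideal_mull _ (hX k)).
- by exists k => x; apply: (ideal_mull _ (hX k)).
Qed.

Section LocalCompletion.
Variable A : idomainType.
Hypothesis hA : dedekind A.
Variable p : spec A.
Hypothesis p0 : spec_set p <> [set 0].
Local Notation K := {fraction A}.
Local Notation "a %:F" := (@FracField.tofrac A a).
Local Notation R := (localization p).
Local Notation S := (completion (adic (loc_max p))).
Local Notation Kp := (completion (padic p)).
Local Notation iota := (to_completion (padic p)).
Local Notation f := (to_completion (adic (loc_max p))).
Local Notation vset := (@vset A p).
Local Notation cvset := (@cvset A p).
Variable theta : {rmorphism R -> K}.
Hypothesis thetaE : forall a, theta (to_loc p a) = a%:F.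
Implicit Types (r : R) (s : S) (k : nat).

Let hX k := idealX_ideal (loc_max p) k.

Lemma theta_frac a (s : denom p) : theta (loc_frac a s) = a%:F / (den s)%:F.
Proof.
apply/esym; apply: canLR (mulfK _) _; first by rewrite tofrac_eq0 den_neq0.
by rewrite -!thetaE -rmorphM loc_fracK.
Qed.

Lemma theta_vset0 r : vset 0 (theta r).
Proof.
have [a [s ->]] := loc_frac_surj r; apply/(vset0P hA p0).
by exists a, (den s); split; [apply: denomP|apply: theta_frac].
Qed.

Lemma theta_surj x : vset 0 x -> exists r, theta r = x.
Proof.
move=> /(vset0P hA p0)[a [s [ps ->]]].
by exists (loc_frac a (mk_denom ps)); apply: (theta_frac a (mk_denom ps)).
Qed.

Lemma theta_inj r : theta r = 0 -> r = 0.
Proof.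
have [a [s ->]] := loc_frac_surj r; rewrite theta_frac => /eqP.
rewrite mulf_eq0 invr_eq0 !tofrac_eq0 (negbTE (den_neq0 s)) orbF => /eqP ->.
by rewrite loc_fracE rmorph0 mul0r.
Qed.

Lemma theta_loc_max r : loc_max p r <-> vset 1 (theta r).
Proof.
have [a [s ->]] := loc_frac_surj r; rewrite loc_maxP.
rewrite -(vset1_tofrac hA p0) theta_frac; split=> [h|h].
  rewrite -[1]addr0; apply: (vsetM hA) => //; apply/(vset0P hA p0).
  by exists 1, (den s); split; [apply: denomP|rewrite tofrac1 mul1r].
rewrite -[a%:F](divfK (_ : (den s)%:F != 0)) ?tofrac_eq0 ?den_neq0//.
by rewrite -[1]addr0; apply: (vsetM hA) => //; apply: vset0_tofrac.
Qed.

Lemma theta_adic k r : idealX (loc_max p) k r <-> vset k (theta r).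
Proof.
split.
  elim: k r => [|k IHk] r; first by move=> _; apply: theta_vset0.
  move: r; apply: (@idealM_sub _ _ _ [set r | vset k.+1 (theta r)]).
    split=> [|x y|c x] /=; rewrite ?rmorph0 ?rmorphD ?rmorphM; first by left.
      exact: (vsetD hA p0).
    by move=> h; rewrite -[X in vset X _]add0r; apply: (vsetM hA) => //; apply: theta_vset0.
  move=> x y /theta_loc_max hx /IHk hy /=; rewrite rmorphM -add1n PoszD.
  exact: (vsetM hA).
move=> h; have : vset 0 (pi_exp p (- k%:Z) * theta r) by rewrite -(vsetE hA p0) addr0.
move=> /theta_surj[c ec].
have -> : r = to_loc p (uniformizer p) ^+ k * c.
  apply/eqP; rewrite -subr_eq0; apply/eqP; apply: theta_inj; rewrite rmorphB rmorphM ec.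
  rewrite rmorphXn thetaE mulrA -[_ ^+ k]/(pi_exp p k) -(pi_expD hA p0) subrr pi_exp0.
  by rewrite mul1r subrr.
apply: (ideal_mulr _ (hX k)); apply: idealX_exp.
by apply/theta_loc_max; rewrite thetaE; apply/(vset1_tofrac hA p0)/(uniformizer_in hA p0).
Qed.

Let topU : ring_topology (adic (loc_max p)) := adic_topology (loc_max_ideal p).
Let topU' := padic_topology hA p0.
Let theta_cont k r : adic (loc_max p) k r -> padic p k (theta r) := (theta_adic k r).1.

(** By [sigma_inj], [sigma_cvset0] and [sigma_surj], the completed local ring is the
    valuation ring of the completion of K. *)
Definition sigma : {rmorphism S -> Kp} := completion_map topU topU' theta_cont.

Lemma sigma_base r : sigma (f r) = iota (theta r).
Proof. exact: completion_map_base. Qed.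

Lemma sigma_inj s : sigma s = 0 -> s = 0.
Proof. by apply: completion_map_inj => k x; move/theta_adic. Qed.

Lemma sigma_cvset0 s : cvset 0 (sigma s).
Proof.
have [u ->] := to_quot_surj s; rewrite completion_mapE; apply/(cvsetP hA p0).
by exists 0%N => n _; apply: theta_vset0.
Qed.

Lemma sigma_surj z : cvset 0 z -> exists s, sigma s = z.
Proof.
have [u ->] := to_quot_surj z; move=> /(cvsetP hA p0)[N hN].
have /choice[r hr] : forall n, exists r, (N <= n)%N -> theta r = val u n.
  move=> n; have [/hN/theta_surj[r er]|ltn] := leqP N n; first by exists r.
  by exists 0.
have cr : is_cauchy (adic (loc_max p)) r.
  move=> k; have [M hM] := cauchy_seqP topU' u k; exists (maxn N M) => m n.
  rewrite !geq_max => /andP[Nm Mm] /andP[Nn Mn]; apply/theta_adic.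
  by rewrite rmorphB !hr//; apply: hM.
exists (to_quot _ (mk_cauchy topU cr)); rewrite completion_mapE.
apply/(completion_eq topU') => k; exists N => n Nn.
rewrite (_ : _ - _ = 0); first exact: fil0.
by apply/eqP; rewrite subr_eq0; apply/eqP; apply: hr.
Qed.

Lemma local_completion_torsion_free r s : f r * s = 0 -> r = 0 \/ s = 0.
Proof.
have [->|/eqP r0] := eqVneq r 0; first by left.
move=> e; right; apply: sigma_inj; apply: (completion_neq0M hA p0 (z := iota (theta r))).
  by move=> /(iota_eq0 hA p0)/theta_inj.
by rewrite -sigma_base -rmorphM e rmorph0.
Qed.

Lemma local_valuation (x y : R) : (exists c, x = c * y) \/ (exists c, y = c * x).
Proof.
have [->|x0] := eqVneq x 0; first by left; exists 0; rewrite mul0r.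
have [->|y0] := eqVneq y 0; first by right; exists 0; rewrite mul0r.
have t0 z : z != 0 -> theta z != 0 by apply: contra_neq; apply: theta_inj.
have dvd (u v : R) : u != 0 -> v != 0 -> padic_val p (theta u) <= padic_val p (theta v) ->
    exists c, v = c * u.
  move=> /t0 u0 /t0 v0 uv.
  have vu0 : theta v / theta u != 0 by rewrite mulf_neq0 ?invr_eq0.
  have : vset 0 (theta v / theta u).
    right; have := padic_valM hA p vu0 u0; rewrite divfK//; lia.
  move=> /theta_surj[c ec]; exists c; apply/eqP; rewrite -subr_eq0; apply/eqP.
  by apply: theta_inj; rewrite rmorphB rmorphM ec divfK// subrr.
have [h|h] := leP (padic_val p (theta x)) (padic_val p (theta y)).
  by right; apply: dvd.
by left; apply: dvd => //; apply: ltW.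
Qed.

Lemma local_completion_flat : flat f.
Proof. exact: torsion_free_flat local_valuation local_completion_torsion_free. Qed.

Lemma local_completion_noetherian : noetherian S.
Proof.
apply: (@noetherian_uniformizer S (f (to_loc p (uniformizer p)))) => s s0.
have z0 : sigma s <> 0 by move=> /sigma_inj.
have [k [hk nk]] := completion_normalize hA p0 z0.
have [t ht et] := completion_unit hA p0 hk nk.
have [[u eu] [v ev]] := (sigma_surj hk, sigma_surj ht).
have uv : u * v = 1.
  by apply/eqP; rewrite -subr_eq0; apply/eqP; apply: sigma_inj;
    rewrite rmorphB rmorphM rmorph1 eu ev et subrr.
have k0 : (0 <= k)%R.
  rewrite leNgt; apply/negP => kn; apply: nk; rewrite -(cvset_scale hA p0).
  by apply: (cvset_le hA p0) (sigma_cvset0 s); lia.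
exists `|k|%N, u, v; split=> //.
apply/eqP; rewrite -subr_eq0; apply/eqP; apply: sigma_inj.
rewrite rmorphB rmorphM eu rmorphXn sigma_base thetaE -rmorphXn.
have -> : (uniformizer p)%:F ^+ `|k| = pi_exp p k by rewrite /pi_exp -{2}(gez0_abs k0).
have e : iota (pi_exp p (- k)) * iota (pi_exp p k) = 1.
  by rewrite -rmorphM -(pi_expD hA p0) addNr pi_exp0 rmorph1.
by rewrite mulrAC e mul1r subrr.
Qed.

Lemma local_completion_dense s : exists r, ideal_gen (f @` loc_max p) (s - f r).
Proof.
have [a ha] := cvset0_approx hA p0 1 (sigma_cvset0 s); exists (to_loc p a).
set pi := uniformizer p.
have [t et] : exists t, sigma t = iota (pi_exp p (- 1)) * (sigma s - iota a%:F).
  by apply: sigma_surj; rewrite -(cvset_scale hA p0) addr0.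
have -> : s - f (to_loc p a) = f (to_loc p pi) * t.
  apply/eqP; rewrite -subr_eq0; apply/eqP; apply: sigma_inj.
  have e : iota pi%:F * iota (pi_exp p (- 1)) = 1.
    transitivity (iota (pi_exp p 1 * pi_exp p (- 1))); first by rewrite (rmorphM iota).
    by rewrite -(pi_expD hA p0) subrr pi_exp0 rmorph1.
  by rewrite rmorphB rmorphB rmorphM et !sigma_base !thetaE mulrA e mul1r subrr.
apply: (ideal_mulr _ (ideal_gen_ideal _)); apply: ideal_genS; exists (to_loc p pi) => //.
by apply/theta_loc_max; rewrite thetaE; apply/(vset1_tofrac hA p0)/(uniformizer_in hA p0).
Qed.

End LocalCompletion.

(** * The formal fibers *)

Lemma eq_quotient (F : fieldType) (x y z t : F) : y != 0 -> t != 0 ->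
  x * t = z * y -> x / y = z / t.
Proof. by move=> y0 t0 e; apply/eqP; rewrite eqr_div// e. Qed.

Lemma generic_residue_iso (A : idomainType) (p : spec A) (q : spec (localization p)) :
  spec_set q = [set 0] ->
  exists (phi : {rmorphism {fraction A} -> residue_field q})
    (psi : {rmorphism residue_field q -> {fraction A}}),
  [/\ cancel psi phi, cancel phi psi
    & forall a, phi (FracField.tofrac a) = to_residue q (to_loc p a)].
Proof.
move=> q0; have res0 r : to_residue q r = 0 -> r = 0.
  by move=> /to_residue_eq0; rewrite q0.
apply: (@fraction_field_iso A _ (to_residue q \o to_loc p)) => [a /= /res0/to_loc_inj//|y].
have [x [z [qz ->]]] := residue_frac y.
have [[a [s ex]] [b [t ez]]] := (loc_frac_surj x, loc_frac_surj z).
have b0 : b != 0.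
  apply/eqP => b0; apply: qz; rewrite q0 ez loc_fracE b0 rmorph0 mul0r//.
have res_neq0 c : c != 0 -> to_residue q (to_loc p c) != 0.
  by apply: contra_neq => /res0/to_loc_inj.
have z0 : to_residue q z != 0.
  by apply/eqP => /res0 e; apply: qz; rewrite q0.
exists (a * den t), (b * den s); split; first by rewrite mulf_neq0 ?den_neq0.
have d0 : to_residue q (to_loc p (b * den s)) != 0.
  by apply: res_neq0; rewrite mulf_neq0 ?den_neq0.
have e : x * to_loc p (b * den s) = to_loc p (a * den t) * z.
  rewrite ex ez [LHS]loc_fracM [RHS]loc_fracM; apply/loc_frac_eq.
  exists 1; first by case: (specP p).
  by have [d1 dM] := denE p; rewrite !dM !d1; ring.
apply: (eq_quotient z0 d0); have := congr1 (to_residue q) e.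
by rewrite (rmorphM (to_residue q)) (rmorphM (to_residue q)).
Qed.

(** Two presentations of L (x) K_p: a ring T generated by the images of the completed
    local ring S and of L, in which the two images of A agree, maps isomorphically to
    the tensor product as soon as it maps to it compatibly. *)
Section GenericFiber.
Variable A : idomainType.
Hypothesis hA : dedekind A.
Variable p : spec A.
Hypothesis p0 : spec_set p <> [set 0].
Variable L : fieldExtType {fraction A}.
Local Notation K := {fraction A}.
Local Notation "a %:F" := (@FracField.tofrac A a).
Local Notation Kp := (completion (padic p)).
Local Notation iota := (to_completion (padic p)).
Local Notation V := (tensor_alg (in_alg L) iota).
Local Notation iL := (tensor_inl (in_alg L) iota).
Local Notation iK := (tensor_inr (in_alg L) iota).
Local Notation n := (\dim {:L}).
Variables (S T : comPzRingType) (sig : {rmorphism S -> Kp}) (fA : {rmorphism A -> S}).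
Hypothesis sig_inj : forall s, sig s = 0 -> s = 0.
Hypothesis sig_surj : forall z, @cvset A p 0 z -> exists s, sig s = z.
Variables (jS : {rmorphism S -> T}) (jL : {rmorphism L -> T}).
Hypothesis jbase : forall a, jL (to_ext L a) = jS (fA a).
Hypothesis jind : forall Q : T -> Prop, (forall s y, Q (jS s * jL y)) ->
  (forall u v, Q u -> Q v -> Q (u + v)) -> forall t, Q t.

(** The coordinates in a basis of L have denominators in A, which d clears. *)
Lemma generic_fiber_coords (t : T) : exists d (s : 'I_n -> S), d != 0 /\
  jL (to_ext L d) * t = \sum_(j < n) jS (s j) * jL (vbasis {:L})`_j.
Proof.
elim/jind: t => [s x|t t' [d [s [d0 e]]] [d' [s' [d0' e']]]]; last first.
  exists (d * d'), (fun j => s j * fA d' + s' j * fA d).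
  split; first exact: mulf_neq0.
  transitivity (jL (to_ext L d') * (jL (to_ext L d) * t) +
                jL (to_ext L d) * (jL (to_ext L d') * t')).
    by rewrite !rmorphM; ring.
  rewrite e e' !mulr_sumr -big_split /=; apply: eq_bigr => j _.
  by rewrite !jbase !rmorphD !rmorphM; ring.
have [d d0 [a ha]] := common_denominator (fun j : 'I_n => coord (vbasis {:L}) j x).
exists d, (fun j => s * fA (a j)); split=> //.
rewrite mulrCA -rmorphM.
have -> : to_ext L d * x = \sum_(j < n) to_ext L (a j) * (vbasis {:L})`_j.
  rewrite {1}(coord_vbasis (memvf x)) mulr_sumr; apply: eq_bigr => j _.
  rewrite ha !to_extE !mulr_algl scalerA; congr (_ *: _).
  by rewrite mulrC divfK// tofrac_eq0.
rewrite rmorph_sum mulr_sumr; apply: eq_bigr => j _.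
by rewrite (rmorphM jL) jbase (rmorphM jS) mulrA.
Qed.

Lemma generic_fiber_iso (F : {rmorphism T -> V}) :
  (forall s, F (jS s) = iK (sig s)) -> (forall x, F (jL x) = iL x) -> bijective F.
Proof.
move=> FS FL.
have Finj t : F t = 0 -> t = 0.
  move=> Ft; have [d [s [d0 e]]] := generic_fiber_coords t.
  have s0 : forall j, s j = 0.
    move=> j; apply: sig_inj; move: j.
    apply: (@completed_coef_eq0 A p L n (fun j => (vbasis {:L})`_j)).
      by apply/freeP/basis_free/vbasisP.
    have := congr1 F e; rewrite rmorphM Ft mulr0 rmorph_sum => e0.
    rewrite [RHS]e0; apply: eq_bigr => j _.
    by rewrite rmorphM FS FL mulrC.
  have e0 : jL (to_ext L d) * t = 0.
    by rewrite e big1// => j _; rewrite s0 rmorph0 mul0r.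
  have d1 : to_ext L d != 0 by rewrite to_ext_eq0.
  by rewrite -[t]mul1r -(rmorph1 jL) -(mulVf d1) rmorphM -mulrA e0 mulr0.
have Fsurj v : exists t, F t = v.
  elim/tensor_alg_ind: v => [x z|v v' [t <-] [t' <-]]; last first.
    by exists (t + t'); rewrite rmorphD.
  have [m hm] := cvset_exists hA p0 z.
  have [s es] : exists s, sig s = iota (pi_exp p (- m)) * z.
    by apply: sig_surj; rewrite -(cvset_scale hA p0) addr0.
  exists (jS s * jL (pi_exp p m *: x)).
  have e : iota (pi_exp p (- m)) * iota (pi_exp p m) = 1.
    by rewrite -rmorphM -(pi_expD hA p0) addNr pi_exp0 rmorph1.
  rewrite rmorphM FS FL es iL_scale rmorphM mulrACA -[iK _ * iK _]rmorphM.
  by rewrite e rmorph1 mul1r mulrC.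
have /choice[G FG] := Fsurj; exists G => // t.
apply/eqP; rewrite -subr_eq0; apply/eqP; apply: Finj.
by rewrite rmorphB FG subrr.
Qed.

End GenericFiber.

Section FormalFiber.
Variable A : idomainType.
Hypothesis hA : dedekind A.
Variable p : spec A.
Hypothesis p0 : spec_set p <> [set 0].
Local Notation K := {fraction A}.
Local Notation iota := (to_completion (padic p)).
Local Notation R := (localization p).
Local Notation f := (to_completion (adic (loc_max p))).
Variable q : spec R.
Local Notation k0 := (residue_field q).
Variables (phi : {rmorphism K -> k0}) (psi : {rmorphism k0 -> K}).
Hypotheses (psiK : cancel psi phi) (phiK : cancel phi psi).
Hypothesis phiE : forall a, phi (FracField.tofrac a) = to_residue q (to_loc p a).
Variables (L : fieldExtType K) (k' : fieldExtType k0) (g : {rmorphism L -> k'}).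
Hypothesis hg : base_change phi g.

Let theta : {rmorphism R -> K} := psi \o to_residue q.

Let thetaE a : theta (to_loc p a) = FracField.tofrac a.
Proof. by rewrite /theta /= -phiE phiK. Qed.

(** After the base change from K to L, the generic fiber of the completed local ring
    is the tensor product of L with the completion of K. *)
Lemma formal_fiber_iso : exists F : {rmorphism
    tensor_alg (tensor_inr f (to_residue q)) (in_alg k') -> tensor_alg (in_alg L) iota},
  bijective F.
Proof.
have [g' [gK g'K]] := rmorphism_inverse (proj1 hg).
have gZ a x : g (a *: x) = phi a *: g x by case: hg => _; apply.
have g'Z c : g' (in_alg k' c) = in_alg L (psi c).
  by apply: (can_inj gK); rewrite g'K /= gZ psiK rmorph1.
pose iL : {rmorphism L -> _} := tensor_inl (in_alg L) iota.
pose iK : {rmorphism completion (padic p) -> _} := tensor_inr (in_alg L) iota.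
pose sig := sigma hA p0 thetaE.
have [|F [FS Fk]] := @tower_lift _ _ _ _ f (to_residue q) (in_alg k') _
    (iK \o sig) (iL \o g').
  move=> r; rewrite [LHS]/= [RHS]/= g'Z /sig sigma_base.
  exact/esym/(tensor_inl_base (in_alg L) iota).
exists F.
pose jS := tower_inl f (to_residue q) (in_alg k').
pose jL : {rmorphism L -> _} := tower_inr f (to_residue q) (in_alg k') \o g.
apply: (@generic_fiber_iso A hA p p0 L _ _ sig (f \o to_loc p) _ _ jS jL) => //.
- exact: sigma_inj.
- exact: sigma_surj.
- move=> a; apply: etrans _ (esym (tower_base f (to_residue q) (in_alg k') _)).
  rewrite [LHS]/=; congr (tower_inr _ _ _ _).
  by rewrite to_extE gZ phiE rmorph1.
- move=> Q Qp QD t; elim/tower_ind: t => [s y|]; last exact: QD.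
  by have := Qp s (g' y); rewrite /jL /= g'K.
- by move=> x; rewrite /jL /= Fk /= gK.
Qed.

End FormalFiber.

(** At the closed point the fiber is the residue field itself, because S is the sum
    of the image of R and of the extension of the maximal ideal. *)
Lemma closed_fiber_regular (R S : comPzRingType) (f : {rmorphism R -> S}) (q : spec R) :
  (forall s, exists r, ideal_gen (f @` spec_set q) (s - f r)) ->
  forall k' : fieldExtType (residue_field q),
  regular_ring (tensor_alg (tensor_inr f (to_residue q)) (in_alg k')).
Proof.
move=> dense k'; apply: semisimple_regular.
apply: (@semisimple_field_image k' _ (tensor_inr _ (in_alg k'))).
pose inl : {rmorphism S -> _} := tensor_inl f (to_residue q).
pose inr : {rmorphism residue_field q -> _} := tensor_inr f (to_residue q).
have base r : inl (f r) = inr (to_residue q r) := tensor_inl_base f (to_residue q) r.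
have ker s : ideal_gen (f @` spec_set q) s -> inl s = 0.
  apply: (@ideal_gen_sub _ _ [set s | inl s = 0]).
    split=> [|x y ex ey|a x ex]; first exact: (rmorph0 inl).
      by apply: etrans (rmorphD inl x y) _; rewrite (ex : inl x = 0) (ey : inl y = 0) addr0.
    by apply: etrans (rmorphM inl a x) _; rewrite (ex : inl x = 0) mulr0.
  by move=> _ [a qa <-]; apply: etrans (base a) _; rewrite (proj2 (to_residue_eq0 q a) qa) rmorph0.
have inl_inr s : exists c, inl s = inr c.
  have [r hr] := dense s; exists (to_residue q r).
  by rewrite -base -[s](subrK (f r)) (rmorphD inl) (ker _ hr) add0r.
have Sk u : exists c, u = inr c.
  elim/tensor_alg_ind: u => [s c|u v [c ->] [d ->]]; last first.
    by exists (c + d); rewrite (rmorphD inr).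
  have [d e] := inl_inr s; exists (d * c); rewrite (rmorphM inr) -e; reflexivity.
elim/tensor_alg_ind => [u y|u v [c ->] [d ->]]; last by exists (c + d); rewrite rmorphD.
have [c ->] := Sk u; exists (in_alg k' c * y).
rewrite rmorphM; congr (_ * _).
exact: (tensor_inl_base (tensor_inr f (to_residue q)) (in_alg k') c).
Qed.

Section GRing.
Variable A : idomainType.
Hypothesis hA : dedekind A.

Let nA : noetherian A. Proof. by case: hA. Qed.

Lemma zero_prime (D : idomainType) : is_prime_ideal [set 0 : D].
Proof.
split; [exact: zero_ideal|exact/eqP/oner_neq0|].
by move=> x y /= /eqP; rewrite mulf_eq0 => /orP[]/eqP; [left|right].
Qed.

Lemma local_primes (p : spec A) (q : spec (localization p)) :
  spec_set q = [set 0] \/ spec_set q = loc_max p.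
Proof.
have [iq q1 _] := specP q.
have qm : spec_set q `<=` loc_max p.
  move=> x qx; apply: contrapT => /loc_unit_notin[y e]; apply: q1; rewrite -e.
  exact: ideal_mulr.
have hc := prime_preim (to_loc p) (specP q).
have mem x a s : x = loc_frac a s -> spec_set q x -> (to_loc p @^-1` spec_set q) a.
  by move=> ->; rewrite /= -(loc_fracK a s) => ?; apply: ideal_mulr.
have [c0|c0] := pselect (to_loc p @^-1` spec_set q = [set 0]).
  left; apply/seteqP; split=> [x qx|_ ->]; last exact: ideal0.
  have [a [s ex]] := loc_frac_surj x; have := mem _ _ _ ex qx.
  by rewrite c0 /= ex loc_fracE => ->; rewrite rmorph0 mul0r.
right; apply/seteqP; split=> // x; have [a [s ex]] := loc_frac_surj x.
rewrite {1}ex => /loc_maxP pa; rewrite ex loc_fracE; apply: ideal_mulr => //.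
have [_ _ dimA] := hA; have [_ _ cmax] := dimA (Spec hc) c0.
have [ip p1 _] := specP p.
have ecp : spec_set p = to_loc p @^-1` spec_set q.
  apply: (cmax _ ip p1) => b qb.
  by have /loc_maxP : loc_max p (loc_frac b (denom1 p)) := qm _ qb.
by have : spec_set p a by []; rewrite ecp.
Qed.

Lemma zero_local_ideal (p : spec A) : spec_set p = [set 0] ->
  loc_max p = [set 0].
Proof.
move=> p0; apply/seteqP; split=> [x|_ ->]; last exact: ideal0 (loc_max_ideal p).
have [a [s ->]] := loc_frac_surj x => /loc_maxP; rewrite p0 => -> /=.
by rewrite loc_fracE rmorph0 mul0r.
Qed.

(** When p = 0 the local ring is a field and is its own completion. *)
Lemma zero_completion_surj (p : spec A) : spec_set p = [set 0] ->
  forall s, exists r, to_completion (adic (loc_max p)) r = s.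
Proof.
move=> p0 s; have top := adic_topology (loc_max_ideal p).
have [u ->] := to_quot_surj s; have [N hN] := cauchy_seqP top u 1%N.
exists (val u N); rewrite to_completionE; apply/(completion_eq top) => k.
exists N => n Nn.
have -> : val (cst_seq (adic (loc_max p)) (val u N)) n - val u n = 0.
  have : idealX (loc_max p) 1 (val u N - val u n) := hN N n (leqnn _) Nn.
  rewrite (_ : idealX _ 1 = [set 0]) // -(zero_local_ideal p0).
  exact/idealX1/loc_max_ideal.
exact: idealX0.
Qed.

Lemma zero_regular_hom (p : spec A) : spec_set p = [set 0] ->
  regular_hom (to_completion (adic (loc_max p))).
Proof.
move=> p0; have surj := zero_completion_surj p0; have m0 := zero_local_ideal p0.
have nR := loc_noetherian (q := p) nA.
have nS := noetherian_surj surj nR.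
have unit (r : localization p) : r <> 0 -> exists y, r * y = 1.
  by move=> r0; apply: loc_unit_notin; rewrite m0.
split=> //.
  apply: torsion_free_flat => [x y|r s e].
    have [->|/eqP/unit[z e]] := eqVneq x 0; first by left; exists 0; rewrite mul0r.
    by right; exists (y * z); rewrite -mulrA (mulrC z) e mulr1.
  have [->|/eqP/unit[z ez]] := eqVneq r 0; [by left|right].
  rewrite -[s]mul1r -(rmorph1 (to_completion (adic (loc_max p)))) -ez mulrC.
  by rewrite rmorphM mulrA (mulrC s) e mul0r.
move=> q; split; first exact: fiber_noetherian.
apply: closed_fiber_regular => s; have [r <-] := surj s; exists r.
by rewrite subrr; apply: ideal0; apply: ideal_gen_ideal.
Qed.

(** The condition is the one on the generic fibers at nonzero primes, after base change:
    these are zero-dimensional, so that regular implies reduced. *)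
Lemma G_ring_full : G_ring A -> forall (p : spec A) (L : fieldExtType {fraction A}),
  spec_set p <> [set 0] -> full_residual_dim p L.
Proof.
move=> [_ G] p L p0; have [_ _ _ fib] := G p.
pose q : spec (localization p) := Spec (@zero_prime (localization p)).
have [phi [psi [psiK phiK phiE]]] := @generic_residue_iso A p q erefl.
have [k' [g hg]] := base_change_extend L psiK phiK.
have [F Fbij] := formal_fiber_iso hA p0 psiK phiK phiE hg.
apply: (reduced_fullP hA p0); apply: (reduced_surj Fbij).
have [_ reg] := fib q; apply: regular_reduced (reg k').
apply: pi_regular_inj Fbij _; exact: completed_pi_regular.
Qed.

Lemma full_G_ring : (forall (p : spec A) (L : fieldExtType {fraction A}),
  spec_set p <> [set 0] -> full_residual_dim p L) -> G_ring A.
Proof.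
move=> full; split=> // p.
have [p0|p0] := pselect (spec_set p = [set 0]); first exact: zero_regular_hom.
have [th thE] : exists th : {rmorphism localization p -> {fraction A}},
    forall a, th (to_loc p a) = FracField.tofrac a.
  have [phi [psi [_ phiK phiE]]] := loc_fraction_iso p.
  by exists (psi \o @FracField.tofrac (localization p)) => a /=; rewrite -phiE phiK.
split.
- exact: loc_noetherian.
- exact: (@local_completion_noetherian A hA p p0 th thE).
- exact: (@local_completion_flat A hA p p0 th thE).
move=> q; split; first exact/fiber_noetherian/(@local_completion_noetherian A hA p p0 th thE).
have [q0|qm] := local_primes q; last first.
  apply: closed_fiber_regular; rewrite qm; exact: (local_completion_dense hA p0 thE).
move=> k'; have [phi [psi [psiK phiK phiE]]] := generic_residue_iso q0.
have [L [g hg]] := base_change_restrict k' psiK phiK.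
have [F Fbij] := formal_fiber_iso hA p0 psiK phiK phiE hg.
have [G [FK GK]] := rmorphism_inverse Fbij.
apply: semisimple_regular; apply: (@semisimple_surj _ _ G).
  by move=> t; exists (F t).
by apply/(semisimple_fullP hA p0); apply: full.
Qed.

End GRing.

(** * The four conditions *)

(** The residue degrees, weighted by the ramification indices, add up to the dimension
    of B/pB, so condition (1) says that this dimension is [L : K]. *)
Lemma ramification_fullP (A : idomainType) (hA : dedekind A) (p : spec A)
    (p0 : spec_set p <> [set 0]) (L : fieldExtType {fraction A}) :
  \sum_(P \in primes_over L p)
    (ramification_index p P * residue_degree p P)%N = \dim {:L} <->
  full_residual_dim p L.
Proof.
have [b hb] := sum_ramification_residue L hA p0.
split=> [e|[b' hb']]; first by move: b hb; rewrite e => b hb; exists b.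
apply: (residual_basis_card (spec_maximal hA p0) _ _ hb hb') => [|a y pa _].
  exact: ideal_gen_ideal.
exact: extend_ideal_mull.
Qed.

Theorem proposition44 (A : idomainType) (hA : dedekind A) :
  [<-> (forall (L : fieldExtType {fraction A}) (p : spec A),
          spec_set p <> [set 0] ->
          \sum_(P \in primes_over L p)
            (ramification_index p P * residue_degree p P)%N = \dim {:L});
       (forall (L : fieldExtType {fraction A}) (p : spec A),
          spec_set p <> [set 0] ->
          semisimple (tensor_alg (in_alg L) (to_completion (padic p))));
       G_ring A;
       (forall p : spec A, spec_set p <> [set 0] -> japanese (localization p))].
Proof.
tfae.
- move=> ram L p p0; apply/(semisimple_fullP hA p0).
  exact/(ramification_fullP hA p0)/ram.
- move=> ss; apply: (full_G_ring hA) => p L p0.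
  exact/(semisimple_fullP hA p0)/ss.
- move=> G p p0; have [phi [psi [psiK phiK phiE]]] := loc_fraction_iso p.
  by apply/(japanese_fullP hA p0 psiK phiK phiE) => L; apply: (G_ring_full hA).
- move=> jap L p p0; have [phi [psi [psiK phiK phiE]]] := loc_fraction_iso p.
  apply/(ramification_fullP hA p0).
  exact: (proj1 (japanese_fullP hA p0 psiK phiK phiE)) (jap p p0) L.
Qed.
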